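(* Let $N\in\mathbb{C}\setminus\{0\}$ and let $\sqrt N$ be a square root of $N$. The category $\mathsf{NCBipartEven}_N$ is isomorphic (but not monoidally isomorphic) to $\mathsf{NCPair}_{\sqrt N}\times\mathsf{NCPair}_{\sqrt N}$. Consequently, for real $N\ge4$, any fibre functor on $\mathsf{NCBipartEven}_N$ is injective (on all morphism spaces).
   Context: All categories are strict rigid monoidal $\mathbb{C}$-linear $\dagger$-categories with object set $\mathbb{N}_0$, tensor product of objects being addition; $\mathcal{C}(k,l)$ is the space of morphisms $k\to l$. For $N\in\mathbb{C}\setminus\{0\}$, $\mathsf{NCBipart}_N$ is the category presented by generators $b_{k,l},w_{k,l}\colon k\to l$ ($k,l\in\mathbb{N}_0$; black and white spiders), with $b_{k,l}^\dagger=b_{l,k}$, $w_{k,l}^\dagger=w_{l,k}$ (flip of diagrams), and relations (together with those obtained by applying $\dagger$): (1) $b_{1,1}=w_{1,1}=\mathrm{id}_1$, $b_{0,0}=w_{0,0}=N$; (2) for $s=b$ and $s=w$ and $m\ge1$: $(s_{k_1+m,l_1}\otimes\mathrm{id}_{l_2})(\mathrm{id}_{k_1}\otimes s_{k_2,m+l_2})=s_{k_1+k_2,l_1+l_2}$; (3) $b_{0,2}=w_{0,2}$; (4) $b_{2,1}w_{1,2}=N^{-1}b_{0,1}w_{1,0}$. $\mathsf{NCBipartEven}_N$ is the smallest subcategory of $\mathsf{NCBipart}_N$ on all objects, closed under composition, tensor product, linear combinations and $\dagger$, containing all identities, $b_{2,2}$, $w_{2,2}$ and $b_{2,0}$. $\mathsf{NCPair}_\delta$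 is the Temperley–Lieb category: $\mathsf{NCPair}_\delta(k,l)$ has as basis the non-crossing pairings of $k$ lower and $l$ upper points, composition is by stacking with each closed loop replaced by the factor $\delta$, and tensor product is by juxtaposition. For categories $\mathcal{C}_1,\mathcal{C}_2$, the category $\mathcal{C}_1\times\mathcal{C}_2$ has morphism spaces $(\mathcal{C}_1\times\mathcal{C}_2)(k,l)=\mathcal{C}_1(k,l)\otimes\mathcal{C}_2(k,l)$ with all operations (composition, tensor product, involution) defined entrywise. A fibre functor on $\mathcal{C}$ is a (non-trivial, $\mathbb{C}$-linear) monoidal $\dagger$-functor from $\mathcal{C}$ to the category of matrices, i.e. of linear maps between finite-dimensional Hilbert spaces $(\mathbb{C}^M)^{\otimes k}$. *)

(* Defs.v *)
From HB Require Import structures.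
From mathcomp Require Import all_boot all_order all_algebra.
From mathcomp Require Import boolp reals.
From mathcomp Require Import complex mxtens.
Set Implicit Arguments.
Unset Strict Implicit.
Unset Printing Implicit Defensive.
Import Order.TTheory GRing.Theory Num.Theory.
Local Open Scope ring_scope.
Local Open Scope quotient_scope.

(* [ldcat] packs the operations of a strict monoidal linear dagger-category
   with object set nat, where the tensor product of objects is addition.
   [ldhom A k l] is the space of morphisms k -> l and [ldcomp g f] is g after
   f.  The record carries operations only, since functors are required to
   preserve operations. *)
Record ldcat (C : numClosedFieldType) := LDCat {
  ldhom : nat -> nat -> lmodType C;
  ldid : forall k, ldhom k k;
  ldcomp : forall k l m, ldhom l m -> ldhom k l -> ldhom k m;
  ldtens : forall k l k' l',
    ldhom k l -> ldhom k' l' -> ldhom (k + k')%N (l + l')%N;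
  lddag : forall k l, ldhom k l -> ldhom l k }.
Arguments ldid {C} _ k.
Arguments ldcomp {C} _ {k l m}.
Arguments ldtens {C} _ {k l k' l'}.
Arguments lddag {C} _ {k l}.

(* Functors are the identity on objects; for a monoidal isomorphism this is no
   restriction, since the identity is the only automorphism of (nat, +). *)
Record functor (C : numClosedFieldType) (A B : ldcat C) := Functor {
  fmor :> forall k l, {linear ldhom A k l -> ldhom B k l};
  fmor_id : forall k, fmor k k (ldid A k) = ldid B k;
  fmor_comp : forall k l m (g : ldhom A l m) (f : ldhom A k l),
    fmor k m (ldcomp A g f) = ldcomp B (fmor l m g) (fmor k l f) }.

Section FunctorProperties.
Variables (C : numClosedFieldType) (A B : ldcat C) (F : functor A B).

Definition isomorphism : Prop := forall k l, bijective (F k l).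

Definition monoidal : Prop :=
  forall k l k' l' (f : ldhom A k l) (g : ldhom A k' l'),
    F _ _ (ldtens A f g) = ldtens B (F _ _ f) (F _ _ g).

Definition dagger : Prop :=
  forall k l (f : ldhom A k l), F _ _ (lddag A f) = lddag B (F _ _ f).

Definition nontrivial : Prop :=
  exists k l (f : ldhom A k l), F _ _ f != 0.

End FunctorProperties.

(* The dagger of a diagram is its flip, extended to linear combinations either
   linearly ([anti = false]) or antilinearly ([anti = true]).  The antilinear
   extension is compatible with a loop parameter only if the parameter is real,
   so nonreal parameters are treated with the linear one. *)
Definition star (C : numClosedFieldType) (anti : bool) (x : C) : C :=
  if anti then x^* else x.

Definition hcast (H : nat -> nat -> Type) k k' l l'
    (ek : k = k') (el : l = l') : H k l -> H k' l' :=
  match ek in _ = a, el in _ = b return H k l -> H a b with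
  | erefl, erefl => id
  end.
Arguments hcast H {k k' l l'} ek el _.

(* [TSpider false k l] is the black spider, [TSpider true k l] the white one. *)
Inductive term (C : Type) : nat -> nat -> Type :=
| TSpider (white : bool) k l : term C k l
| TId k : term C k k
| TComp k l m : term C l m -> term C k l -> term C k m
| TTens k l k' l' : term C k l -> term C k' l' -> term C (k + k')%N (l + l')%N
| TZero k l : term C k l
| TAdd k l : term C k l -> term C k l -> term C k l
| TScale k l : C -> term C k l -> term C k l.
Arguments TSpider {C}.
Arguments TId {C}.
Arguments TZero {C}.

HB.instance Definition _ C k l := gen_eqMixin (term C k l).
HB.instance Definition _ C k l := gen_choiceMixin (term C k l).

Section NCBipart.
Variables (C : numClosedFieldType) (anti : bool) (N : C).

Fixpoint tdag k l (t : term C k l) : term C l k :=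
  match t in term _ k l return term C l k with
  | TSpider c k l => TSpider c l k
  | TId k => TId k
  | TComp _ _ _ g f => TComp (tdag f) (tdag g)
  | TTens _ _ _ _ f g => TTens (tdag f) (tdag g)
  | TZero k l => TZero l k
  | TAdd _ _ f g => TAdd (tdag f) (tdag g)
  | TScale _ _ a f => TScale (star anti a) (tdag f)
  end.

(* The least dagger-closed congruence making terms into a strict monoidal linear
   category and containing the spider relations.  With [anti = true] it is
   meaningful only for real N: otherwise it also contains
   b_{0,0} = N^* id_0, and everything becomes zero. *)
Inductive teq : forall k l, term C k l -> term C k l -> Prop :=
| teq_refl k l (f : term C k l) : teq f f
| teq_sym k l (f g : term C k l) : teq f g -> teq g f
| teq_trans k l (f g h : term C k l) : teq f g -> teq g h -> teq f h
| teq_comp k l m (g g' : term C l m) (f f' : term C k l) :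
    teq g g' -> teq f f' -> teq (TComp g f) (TComp g' f')
| teq_tens k l k' l' (f f' : term C k l) (g g' : term C k' l') :
    teq f f' -> teq g g' -> teq (TTens f g) (TTens f' g')
| teq_add k l (f f' g g' : term C k l) :
    teq f f' -> teq g g' -> teq (TAdd f g) (TAdd f' g')
| teq_scale k l a (f f' : term C k l) :
    teq f f' -> teq (TScale a f) (TScale a f')
| teq_dag k l (f f' : term C k l) : teq f f' -> teq (tdag f) (tdag f')
| teq_addA k l (f g h : term C k l) :
    teq (TAdd f (TAdd g h)) (TAdd (TAdd f g) h)
| teq_addC k l (f g : term C k l) : teq (TAdd f g) (TAdd g f)
| teq_add0 k l (f : term C k l) : teq (TAdd (TZero k l) f) f
| teq_addN k l (f : term C k l) : teq (TAdd (TScale (-1) f) f) (TZero k l)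
| teq_scaleA k l a b (f : term C k l) :
    teq (TScale a (TScale b f)) (TScale (a * b) f)
| teq_scale1 k l (f : term C k l) : teq (TScale 1 f) f
| teq_scaleDr k l a (f g : term C k l) :
    teq (TScale a (TAdd f g)) (TAdd (TScale a f) (TScale a g))
| teq_scaleDl k l a b (f : term C k l) :
    teq (TScale (a + b) f) (TAdd (TScale a f) (TScale b f))
| teq_compA k l m n (h : term C m n) (g : term C l m) (f : term C k l) :
    teq (TComp h (TComp g f)) (TComp (TComp h g) f)
| teq_comp1l k l (f : term C k l) : teq (TComp (TId l) f) f
| teq_comp1r k l (f : term C k l) : teq (TComp f (TId k)) f
| teq_compDl k l m (g g' : term C l m) (f : term C k l) :
    teq (TComp (TAdd g g') f) (TAdd (TComp g f) (TComp g' f))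
| teq_compDr k l m (g : term C l m) (f f' : term C k l) :
    teq (TComp g (TAdd f f')) (TAdd (TComp g f) (TComp g f'))
| teq_compZl k l m a (g : term C l m) (f : term C k l) :
    teq (TComp (TScale a g) f) (TScale a (TComp g f))
| teq_compZr k l m a (g : term C l m) (f : term C k l) :
    teq (TComp g (TScale a f)) (TScale a (TComp g f))
| teq_tensA k l k' l' k'' l''
      (f : term C k l) (g : term C k' l') (h : term C k'' l'') :
    teq (hcast (term C) (addnA k k' k'') (addnA l l' l'')
           (TTens f (TTens g h)))
        (TTens (TTens f g) h)
| teq_tens1l k l (f : term C k l) :
    teq (hcast (term C) (add0n k) (add0n l) (TTens (TId 0) f)) f
| teq_tens1r k l (f : term C k l) :
    teq (hcast (term C) (addn0 k) (addn0 l) (TTens f (TId 0))) f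
| teq_tens_id k l : teq (TTens (TId k) (TId l)) (TId (k + l))
| teq_tens_comp k l m k' l' m' (g : term C l m) (f : term C k l)
      (g' : term C l' m') (f' : term C k' l') :
    teq (TTens (TComp g f) (TComp g' f')) (TComp (TTens g g') (TTens f f'))
| teq_tensDl k l k' l' (f f' : term C k l) (g : term C k' l') :
    teq (TTens (TAdd f f') g) (TAdd (TTens f g) (TTens f' g))
| teq_tensDr k l k' l' (f : term C k l) (g g' : term C k' l') :
    teq (TTens f (TAdd g g')) (TAdd (TTens f g) (TTens f g'))
| teq_tensZl k l k' l' a (f : term C k l) (g : term C k' l') :
    teq (TTens (TScale a f) g) (TScale a (TTens f g))
| teq_tensZr k l k' l' a (f : term C k l) (g : term C k' l') :
    teq (TTens f (TScale a g)) (TScale a (TTens f g))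
| teq_spider11 s : teq (TSpider s 1 1) (TId 1)
| teq_spider00 s : teq (TSpider s 0 0) (TScale N (TId 0))
| teq_spider_fuse s k1 l1 k2 l2 m : (0 < m)%N ->
    teq (TComp (TTens (TSpider s (k1 + m) l1) (TId l2))
               (hcast (term C) erefl (addnA k1 m l2)
                  (TTens (TId k1) (TSpider s k2 (m + l2)))))
        (TSpider s (k1 + k2) (l1 + l2))
| teq_spider02 : teq (TSpider false 0 2) (TSpider true 0 2)
| teq_spider_bw :
    teq (TComp (TSpider false 2 1) (TSpider true 1 2))
        (TScale N^-1 (TComp (TSpider false 0 1) (TSpider true 1 0))).

Definition teqb k l : rel (term C k l) := fun f g => `[< teq f g >].

Lemma teqb_refl k l : reflexive (@teqb k l).
Proof. by move=> f; apply/asboolP; exact: teq_refl. Qed.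
Lemma teqb_sym k l : symmetric (@teqb k l).
Proof. by move=> f g; apply/asboolP/asboolP; exact: teq_sym. Qed.
Lemma teqb_trans k l : transitive (@teqb k l).
Proof.
by move=> g f h /asboolP fg /asboolP gh; apply/asboolP; exact: teq_trans fg gh.
Qed.

Canonical teqb_equiv k l :=
  EquivRel (@teqb k l) (@teqb_refl k l) (@teqb_sym k l) (@teqb_trans k l).

Definition bhom k l : Type := {eq_quot (@teqb k l)}.
HB.instance Definition _ k l := Choice.on (bhom k l).

Definition bpi k l (t : term C k l) : bhom k l := \pi_({eq_quot (@teqb k l)}) t.
Definition brepr k l (f : bhom k l) : term C k l :=
  @repr _ {eq_quot (@teqb k l)} f.

Lemma bpiP k l (t u : term C k l) : bpi t = bpi u <-> teq t u.
Proof.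
split=> [/eqP|tu]; first by rewrite /bpi (@eqmodE _ (@teqb_equiv k l)) => /asboolP.
by apply/eqP; rewrite /bpi (@eqmodE _ (@teqb_equiv k l)); apply/asboolP.
Qed.

Lemma breprK k l (f : bhom k l) : bpi (brepr f) = f.
Proof. exact: reprK. Qed.

Lemma brepr_pi k l (t : term C k l) : teq (brepr (bpi t)) t.
Proof. by apply/bpiP; rewrite breprK. Qed.

Definition bzero k l : bhom k l := bpi (TZero k l).
Definition badd k l (f g : bhom k l) : bhom k l := bpi (TAdd (brepr f) (brepr g)).
Definition bscale k l (a : C) (f : bhom k l) : bhom k l :=
  bpi (TScale a (brepr f)).
Definition bopp k l (f : bhom k l) : bhom k l := bscale (-1) f.

Lemma badd_pi k l (t u : term C k l) : badd (bpi t) (bpi u) = bpi (TAdd t u).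
Proof. by apply/bpiP; apply: teq_add; exact: brepr_pi. Qed.
Lemma bscale_pi k l a (t : term C k l) : bscale a (bpi t) = bpi (TScale a t).
Proof. by apply/bpiP; apply: teq_scale; exact: brepr_pi. Qed.

Lemma baddA k l : associative (@badd k l).
Proof.
move=> f g h; rewrite -(breprK f) -(breprK g) -(breprK h) !badd_pi.
by apply/bpiP; exact: teq_addA.
Qed.
Lemma baddC k l : commutative (@badd k l).
Proof.
move=> f g; rewrite -(breprK f) -(breprK g) !badd_pi.
by apply/bpiP; exact: teq_addC.
Qed.
Lemma badd0 k l : left_id (@bzero k l) (@badd k l).
Proof.
by move=> f; rewrite -(breprK f) badd_pi; apply/bpiP; exact: teq_add0.
Qed.
Lemma baddN k l : left_inverse (@bzero k l) (@bopp k l) (@badd k l).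
Proof.
move=> f; rewrite -(breprK f) /bopp bscale_pi badd_pi.
by apply/bpiP; exact: teq_addN.
Qed.

HB.instance Definition _ k l := GRing.isZmodule.Build (bhom k l)
  (@baddA k l) (@baddC k l) (@badd0 k l) (@baddN k l).

Lemma bscaleA k l a b (f : bhom k l) :
  bscale a (bscale b f) = bscale (a * b) f.
Proof.
by rewrite -(breprK f) !bscale_pi; apply/bpiP; exact: teq_scaleA.
Qed.
Lemma bscale1 k l : left_id 1 (@bscale k l).
Proof.
by move=> f; rewrite -(breprK f) bscale_pi; apply/bpiP; exact: teq_scale1.
Qed.
Lemma baddE k l (f g : bhom k l) : f + g = badd f g.
Proof. by []. Qed.
Lemma bscaleDr k l : right_distributive (@bscale k l) +%R.
Proof.
move=> a f g; rewrite -(breprK f) -(breprK g) !baddE.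
by rewrite !(bscale_pi, badd_pi); apply/bpiP; exact: teq_scaleDr.
Qed.
Lemma bscaleDl k l (f : bhom k l) :
  {morph (@bscale k l)^~ f : a b / a + b}.
Proof.
move=> a b; rewrite -(breprK f) baddE.
by rewrite !(bscale_pi, badd_pi); apply/bpiP; exact: teq_scaleDl.
Qed.

HB.instance Definition _ k l := GRing.Zmodule_isLmodule.Build C (bhom k l)
  (@bscaleA k l) (@bscale1 k l) (@bscaleDr k l) (@bscaleDl k l).

Definition NCBipart : ldcat C := {|
  ldhom := bhom;
  ldid k := bpi (TId k);
  ldcomp k l m g f := bpi (TComp (brepr g) (brepr f));
  ldtens k l k' l' f g := bpi (TTens (brepr f) (brepr g));
  lddag k l f := bpi (tdag (brepr f)) |}.

Definition spider_b k l : bhom k l := bpi (TSpider false k l).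
Definition spider_w k l : bhom k l := bpi (TSpider true k l).

Inductive even_mor : forall k l, bhom k l -> Prop :=
| even_id k : even_mor (ldid NCBipart k)
| even_b22 : even_mor (spider_b 2 2)
| even_w22 : even_mor (spider_w 2 2)
| even_b20 : even_mor (spider_b 2 0)
| even_comp k l m (g : bhom l m) (f : bhom k l) :
    even_mor g -> even_mor f -> even_mor (ldcomp NCBipart g f)
| even_tens k l k' l' (f : bhom k l) (g : bhom k' l') :
    even_mor f -> even_mor g -> even_mor (ldtens NCBipart f g)
| even_zero k l : even_mor (0 : bhom k l)
| even_lin k l a (f g : bhom k l) :
    even_mor f -> even_mor g -> even_mor (a *: f + g)
| even_dag k l (f : bhom k l) : even_mor f -> even_mor (lddag NCBipart f).

Definition even_pred k l : {pred bhom k l} := fun f => `[< even_mor f >].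

Lemma even_predP k l (f : bhom k l) : reflect (even_mor f) (f \in @even_pred k l).
Proof. exact: asboolP. Qed.

Lemma even_submod_closed k l : GRing.submod_closed (@even_pred k l).
Proof.
split=> [|a f g /even_predP ef /even_predP eg]; apply/even_predP.
  exact: even_zero.
exact: even_lin.
Qed.

HB.instance Definition _ k l :=
  GRing.isSubmodClosed.Build C (bhom k l) (@even_pred k l)
    (@even_submod_closed k l).

Record ehom k l := EHom { ehom_val :> bhom k l; _ : ehom_val \in @even_pred k l }.
HB.instance Definition _ k l := [isSub for @ehom_val k l].
HB.instance Definition _ k l := [Choice of ehom k l by <:].
HB.instance Definition _ k l := [SubChoice_isSubLmodule of ehom k l by <:].

Lemma ehomP k l (f : ehom k l) : even_mor f.
Proof. by case: f => f /= /even_predP. Qed.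

Definition EMor k l (f : bhom k l) (ef : even_mor f) : ehom k l :=
  EHom (introT (even_predP f) ef).

Definition NCBipartEven : ldcat C := {|
  ldhom := ehom;
  ldid k := EMor (even_id k);
  ldcomp k l m g f := EMor (even_comp (ehomP g) (ehomP f));
  ldtens k l k' l' f g := EMor (even_tens (ehomP f) (ehomP g));
  lddag k l f := EMor (even_dag (ehomP f)) |}.

End NCBipart.

(* A category whose morphism spaces have distinguished finite bases, described
   by structure constants: [bscomp q p r] is the coefficient of r in q o p. *)
Record based_cat (C : numClosedFieldType) := BasedCat {
  bsbasis : nat -> nat -> finType;
  bsid : forall k, bsbasis k k -> C;
  bscomp : forall k l m, bsbasis l m -> bsbasis k l -> bsbasis k m -> C;
  bstens : forall k l k' l',
    bsbasis k l -> bsbasis k' l' -> bsbasis (k + k') (l + l') -> C;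
  bsdag : forall k l, bsbasis k l -> bsbasis l k -> C }.

Definition of_basis (C : numClosedFieldType) (anti : bool) (A : based_cat C) :
    ldcat C := {|
  ldhom k l := {ffun bsbasis A k l -> C^o};
  ldid k := [ffun p => bsid p];
  ldcomp k l m g f := [ffun r => \sum_q \sum_p g q * f p * bscomp q p r];
  ldtens k l k' l' f g := [ffun r => \sum_p \sum_q f p * g q * bstens p q r];
  lddag k l f := [ffun r => \sum_p star anti (f p) * bsdag p r] |}.

(* The entrywise product: the tensor product of the spaces with bases X and Y
   is the space with basis X * Y, the pair (x, y) standing for x (x) y. *)
Definition prod_cat (C : numClosedFieldType) (A B : based_cat C) :
    based_cat C := {|
  bsbasis k l := (bsbasis A k l * bsbasis B k l)%type;
  bsid k p := bsid p.1 * bsid p.2;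
  bscomp k l m q p r := bscomp q.1 p.1 r.1 * bscomp q.2 p.2 r.2;
  bstens k l k' l' p q r := bstens p.1 q.1 r.1 * bstens p.2 q.2 r.2;
  bsdag k l p r := bsdag p.1 r.1 * bsdag p.2 r.2 |}.

(* [inl i] is the i-th lower point and [inr j] the j-th upper point, both
   counted from the left. *)
Definition pt (k l : nat) : finType := ('I_k + 'I_l)%type.

(* Position of a point when walking around the boundary of the diagram: lower
   points from left to right, then upper points from right to left. *)
Definition pos k l (x : pt k l) : nat :=
  match x with inl i => i | inr j => (k + rev_ord j)%N end.

(* A pairing is encoded by the involution sending a point to its partner. *)
Definition is_ncpairing k l (p : {ffun pt k l -> pt k l}) : bool :=
  [&& [forall x, p (p x) == x],
      [forall x, p x != x] &
      [forall x, forall y,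
         ~~ [&& (pos x < pos y)%N, (pos y < pos (p x))%N &
                (pos (p x) < pos (p y))%N]]].

Definition ncpairing k l : finType :=
  {p : {ffun pt k l -> pt k l} | is_ncpairing p}.

Definition id_pairing k (p : ncpairing k k) : bool :=
  [forall i : 'I_k, val p (inl i) == inr i].

(* Stacking p : k -> l below q : l -> m. *)
Definition spt (k l m : nat) : finType := (('I_k + 'I_l) + 'I_m)%type.
Definition spt_below k l m (x : pt k l) : spt k l m := inl x.
Definition spt_above k l m (x : pt l m) : spt k l m :=
  match x with inl i => inl (inr i) | inr j => inr j end.
Definition spt_outer k l m (x : pt k m) : spt k l m :=
  match x with inl i => inl (inl i) | inr j => inr j end.

Definition stack k l m (q : ncpairing l m) (p : ncpairing k l) :
    rel (spt k l m) := fun u v =>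
  [exists x, (u == spt_below m x) && (v == spt_below m (val p x))]
  || [exists x, (u == spt_above k x) && (v == spt_above k (val q x))].

Definition is_stacking k l m (q : ncpairing l m) (p : ncpairing k l)
    (r : ncpairing k m) : bool :=
  [forall x, connect (stack q p) (spt_outer l x) (spt_outer l (val r x))].

(* Closed loops are the components that meet no outer point. *)
Definition loops k l m (q : ncpairing l m) (p : ncpairing k l) : nat :=
  n_comp (stack q p)
    [pred v | [forall x, ~~ connect (stack q p) (spt_outer l x) v]].

Definition pt_left k l k' l' (x : pt k l) : pt (k + k') (l + l') :=
  match x with inl i => inl (lshift k' i) | inr j => inr (lshift l' j) end.
Definition pt_right k l k' l' (x : pt k' l') : pt (k + k') (l + l') :=
  match x with inl i => inl (rshift k i) | inr j => inr (rshift l j) end.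

Definition is_juxtaposition k l k' l' (p : ncpairing k l)
    (q : ncpairing k' l') (r : ncpairing (k + k') (l + l')) : bool :=
  [forall x, val r (pt_left k' l' x) == pt_left k' l' (val p x)]
  && [forall x, val r (pt_right k l x) == pt_right k l (val q x)].

Definition pt_flip k l (x : pt k l) : pt l k :=
  match x with inl i => inr i | inr j => inl j end.

Definition is_flip k l (p : ncpairing k l) (r : ncpairing l k) : bool :=
  [forall x, val r (pt_flip x) == pt_flip (val p x)].

Definition NCPair (C : numClosedFieldType) (delta : C) : based_cat C := {|
  bsbasis := ncpairing;
  bsid k p := (id_pairing p)%:R;
  bscomp k l m q p r := (is_stacking q p r)%:R * delta ^+ loops q p;
  bstens k l k' l' p q r := (is_juxtaposition p q r)%:R;
  bsdag k l p r := (is_flip p r)%:R |}.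

(* The space (C^M)^{(x) k} is identified with C^(M^k), so that a linear map
   from the k-th to the l-th tensor power is an M^l by M^k matrix. *)
Definition Mat (C : numClosedFieldType) (M : nat) : ldcat C := {|
  ldhom k l := 'M[C]_(M ^ l, M ^ k);
  ldid k := 1%:M;
  ldcomp k l m g f := g *m f;
  ldtens k l k' l' f g :=
    castmx (esym (expnD M l l'), esym (expnD M k k')) (tensmx f g);
  lddag k l f := (map_mx Num.conj f)^T |}.

Definition fibre_functor (C : numClosedFieldType) (A : ldcat C) (M : nat)
    (F : functor A (Mat C M)) : Prop :=
  [/\ nontrivial F, monoidal F & dagger F].

(* Main.v *)
From HB Require Import structures.
Require Import Defs.
From mathcomp Require Import all_boot all_order all_algebra.
From mathcomp Require Import zify ring.
From mathcomp Require Import boolp functions reals complex mxtens.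
Set Implicit Arguments.
Unset Strict Implicit.
Unset Printing Implicit Defensive.
Import Order.TTheory GRing.Theory Num.Theory.
Local Open Scope ring_scope.

(** Let [N = d ^ 2] and [d = t ^ 2].  An even diagram is drawn with doubled
    strands: the black spider is the outline of a thickened black block, and the
    white spider is the same outline with the two halves of every strand
    exchanged.  The spider relations say that such outlines may be deformed, a
    closed curve being worth [d].  In this form an even diagram is a pair of
    disjoint families of curves, because the halves are used alternately along
    the sequence of strands.  Each family is a non-crossing pairing, and this
    gives the isomorphism with the product of two Temperley-Lieb categories.

    Curves are handled through their colourings by bits.  A planar picture is
    interpreted as the relation between the colourings of its lower and upper
    points that extend to a colouring constant along curves; the number of such
    extensions is [2] to the power of the number of closed curves.  That this
    interpretation respects the presentation is [ev_sound], and [Phi] reads off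
    the coefficient of a relation.  Pairings are determined by their relations
    ([Rel_inj]), stacking is the composition of relations ([composes_stacking])
    and loops are counted by extensions ([card_loops]).

    The interpretation is bijective for the following reason.  Bending strands
    down ([bendK]) reduces to functionals, that is, to morphisms to [0].  On
    functionals of [n] strands, [d] times the black and white spiders on
    neighbouring strands form two commuting actions of the Temperley-Lieb
    algebra with parameter [d].  The result of a generator on the vector of a
    Dyck path is a multiple of the vector of another Dyck path ([nf_step]), so
    the functionals of pairs of Dyck paths span the even functionals
    ([even_expand]).  They are interpreted by the pairs of non-crossing pairings
    ([is_kern_dd]), each pair arising once, and are therefore independent.

    This isomorphism is not monoidal, since adding one strand on the left
    exchanges the two families ([rtens_Rel]).  No other isomorphism is monoidal:
    the two ways of turning a morphism on two strands around a cap agree for the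
    black spider, for the white spider and for the sum of the identity and the
    cup-cap, and these three are independent.  A monoidal isomorphism would send
    them to solutions of the same equation in the product, where the equation
    has a two-dimensional space of solutions ([rot_fixed], [transfer]).

    Finally let [N >= 4], so that [d = s ^ 2 + s ^- 2] for a real [s].  Then the
    Temperley-Lieb algebra acts on a chain of spins by self-adjoint operators,
    and the vectors of Dyck paths are independent there ([avec_free]).  As the
    normal form is computed by the same scalars as for functionals, the pairing
    of two functionals is the inner product of their vectors ([link_good]), and
    the pairing of a nonzero functional with itself is a nonzero multiple of the
    identity of [0] ([gram]).  A fibre functor that kills the functional would
    kill this identity, which it preserves. *)

(** * Dyck paths and the Temperley-Lieb normal form *)

Notation U := true (only parsing).
Notation D := false (only parsing).

(** A path is a list of up steps [U] and down steps [D]; it starts at height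
    [c], stays nonnegative and ends at [0]. *)
Fixpoint dyck (c : nat) (h : seq bool) : bool :=
  match h with
  | [::] => c == 0%N
  | true :: h' => dyck c.+1 h'
  | false :: h' => (0 < c)%N && dyck c.-1 h'
  end.

Fixpoint height (c : nat) (h : seq bool) : nat :=
  match h with
  | [::] => c
  | true :: h' => height c.+1 h'
  | false :: h' => height c.-1 h'
  end.

(** The word of Temperley-Lieb generators that builds the path from the zigzag
    path: there is one letter for each square between the two paths, and the
    last letter acts first. *)
Fixpoint dyckword (i c : nat) (h : seq bool) : seq nat :=
  match h with
  | [::] => [::]
  | true :: h' => dyckword i.+1 c.+1 h' ++ iota i c
  | false :: h' => dyckword i.+1 c.-1 h'
  end.

Fixpoint zigzag (m : nat) : seq bool :=
  if m is m'.+1 then true :: false :: zigzag m' else [::].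

Lemma size_zigzag m : size (zigzag m) = m.*2.
Proof. by elim: m => //= m ->. Qed.

Lemma dyck_zigzag m : dyck 0 (zigzag m).
Proof. by elim: m. Qed.

Lemma dyckword_zigzag i m : dyckword i 0 (zigzag m) = [::].
Proof. by elim: m i => //= m IH i; rewrite IH. Qed.

Lemma dyck_size c h : dyck c h -> (c <= size h)%N.
Proof.
elim: h c => [|[] h IH] c /=; first by move=> /eqP ->.
  by move/IH; lia.
by case/andP=> _ /IH; lia.
Qed.

Lemma dyck_cat c p q : dyck c (p ++ q) -> dyck (height c p) q.
Proof. by elim: p c => [|[] p IH] c //=; [move/IH|case/andP=> _ /IH]. Qed.

Lemma dyck_catl c p q q' : dyck c (p ++ q) -> dyck (height c p) q' ->
  dyck c (p ++ q').
Proof.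
by elim: p c => [|[] p IH] c //=; [exact: IH|case/andP=> -> /IH H /H].
Qed.

Lemma dyck_raise c p q : dyck c (p ++ [:: D, U & q]) ->
  dyck c (p ++ [:: U, D & q]).
Proof.
move=> h; apply: (dyck_catl h); move/dyck_cat: h => /=.
by case: (height c p).
Qed.

Lemma dyck_lower c p q : dyck c (p ++ [:: U, D & q]) -> (0 < height c p)%N ->
  dyck c (p ++ [:: D, U & q]).
Proof.
move=> h hp; apply: (dyck_catl h); move/dyck_cat: h => /=.
by rewrite hp; case: (height c p) hp.
Qed.

Lemma height_size c p : (c <= height c p + size p)%N.
Proof.
elim: p c => [|[] p IH] c /=; first by lia.
  by have := IH c.+1; lia.
by have := IH c.-1; lia.
Qed.

Lemma dyckword_bound i c h k : dyck c h -> k \in dyckword i c h ->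
  (i <= k)%N && (k.+2 < i + size h)%N.
Proof.
elim: h i c => [|[] h IH] i c //=.
  move=> dh; rewrite mem_cat => /orP[/(IH _ _ dh)|]; first by lia.
  by rewrite mem_iota; have := dyck_size dh; lia.
by case/andP=> c0 dh /(IH _ _ dh); lia.
Qed.

(** A word has one letter for each square below the path, and turning a valley
    into a peak adds one square. *)
Lemma size_dyckword_raise i c p q : (0 < height c p)%N ->
  size (dyckword i c (p ++ [:: U, D & q])) =
  (size (dyckword i c (p ++ [:: D, U & q]))).+1.
Proof.
elim: p i c => [|[] p IH] i c /=; last exact: IH.
  by case: c => // c _; rewrite !size_cat !size_iota /= addnS.
by move=> h; rewrite !size_cat IH.
Qed.

Lemma height_cat c p q : height c (p ++ q) = height (height c p) q.
Proof. by elim: p c => [|[] p IH] c /=. Qed.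

Lemma height_ups c r : height c (nseq r U) = (c + r)%N.
Proof. by elim: r c => [|r IH] c /=; rewrite ?addn0 ?IH ?addSnnS. Qed.

Lemma height_downs c r : height c (nseq r D) = (c - r)%N.
Proof. by elim: r c => [|r IH] c /=; rewrite ?subn0 ?IH; lia. Qed.

Lemma first_false q : D \in q -> exists r q', q = nseq r U ++ D :: q'.
Proof.
elim: q => // -[] q IH; rewrite inE /=.
  by move=> /IH [r [q' ->]]; exists r.+1, q'.
by exists 0%N, q.
Qed.

Lemma last_true p : U \in p -> exists r p', p = p' ++ U :: nseq r D.
Proof.
elim/last_ind: p => // p [] IH; rewrite mem_rcons inE /=.
  by exists 0%N, p; rewrite cats1.
move=> /IH [r [p' ->]]; exists r.+1, p'.
by rewrite rcons_cat /=; congr (_ ++ _ :: _); elim: r => //= r ->.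
Qed.

Lemma dyck_hasF c h : dyck c.+1 h -> D \in h.
Proof. by elim: h c => [|[] h IH] c //=; rewrite inE //= => /IH. Qed.

(** The last step of the first run of at least two up steps, together with the
    down step after it, is a peak that can be lowered. *)
Lemma dyck_ind_cases m h : dyck 0 h -> size h = m.*2 ->
  h = zigzag m \/
  exists p q, h = p ++ [:: U, D & q] /\ dyck 0 (p ++ [:: D, U & q]).
Proof.
elim: m h => [|m IH] [|[] h] //; first by left.
rewrite doubleS; case: h => [|[] h] //= dh sh; last first.
  have sm : size h = m.*2 by lia.
  case: (IH _ dh sm) => [->|[p [q [-> dpq]]]]; first by left.
  by right; exists [:: U, D & p], q.
right; have [r [q Eh]] := first_false (dyck_hasF dh).
exists (U :: nseq r U), q; split.
  by rewrite Eh; congr (_ :: _); elim: r {Eh} => //= r ->.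
have E : [:: U, U & h] = (U :: nseq r U) ++ [:: U, D & q].
  by rewrite Eh; congr (_ :: _); elim: r {Eh} => //= r ->.
apply: dyck_lower; first by rewrite -E.
by rewrite /= height_ups.
Qed.

(** Every Dyck path is obtained from the zigzag path by turning valleys into
    peaks. *)
Lemma dyck_ind m (P : seq bool -> Prop) :
  P (zigzag m) ->
  (forall p q, dyck 0 (p ++ [:: D, U & q]) ->
     (size p + (size q).+2 = m.*2)%N ->
     P (p ++ [:: D, U & q]) -> P (p ++ [:: U, D & q])) ->
  forall h, dyck 0 h -> size h = m.*2 -> P h.
Proof.
move=> P0 PS h; have [a] := ubnP (size (dyckword 0 0 h)).
elim: a h => // a IH h ha dh sh.
case: (dyck_ind_cases dh sh) => [->//|[p [q [Eh dq]]]].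
have hp : (0 < height 0 p)%N.
  by move: (dyck_cat dq) => /=; case: (height 0 p).
have sz : (size p + (size q).+2 = m.*2)%N by rewrite -sh Eh size_cat.
rewrite Eh; apply: PS => //; apply: IH => //; last by rewrite size_cat.
by move: ha; rewrite Eh size_dyckword_raise.
Qed.

Lemma dyckword_cat i c p q :
  dyckword i c (p ++ q) = dyckword (i + size p) (height c p) q ++ dyckword i c p.
Proof.
elim: p i c => [|[] p IH] i c /=; first by rewrite addn0 cats0.
  by rewrite IH addSnnS catA.
by rewrite IH addSnnS.
Qed.

Lemma dyckword_prefix_bound i c p q k : dyck c (p ++ U :: q) ->
  k \in dyckword i c p -> (k + 4 < i + size (p ++ U :: q))%N.
Proof.
elim: p i c => [|[] p IH] i c //=; last first.
  by case/andP=> _ dp /(IH _ _ dp); lia.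
move=> dp; rewrite mem_cat => /orP[/(IH _ _ dp)|]; first by lia.
rewrite mem_iota size_cat /=.
have := height_size c.+1 p.
by have := @dyck_size (height c.+1 p).+1 q (dyck_cat dp); lia.
Qed.

(** The largest letter occurs at most once in the word of a Dyck path: only
    the last up step contributes it. Annihilating the last two strands then
    commutes with the rest of the word. *)
Lemma dyckword_last n h : dyck 0 h -> size h = n.+2 ->
  exists w b w', [/\ dyckword 0 0 h = w ++ nseq (b : bool) n.-1 ++ w',
    all (fun k => k.+1 < n)%N w, all (fun k => k.+2 < n)%N w' & (b -> 0 < n)%N].
Proof.
move=> dh sh.
have [r [p Eh]] : exists r p', h = p' ++ U :: nseq r D.
  by apply: last_true; case: h dh sh => [|[] h] //=; rewrite inE.
have rE : r = (height 0 p).+1.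
  have := dyck_cat (c := 0) (p := p) (q := U :: nseq r D); rewrite -Eh => /(_ dh) /=.
  elim: r (height 0 p).+1 {Eh} => [|r IH] c /=; first by move=> /eqP.
  by case: c => //= c /IH ->.
have sp : (size p + height 0 p = n)%N.
  by move: sh; rewrite Eh size_cat /= size_nseq rE; lia.
have E : dyckword 0 0 h = iota (size p) (height 0 p) ++ dyckword 0 0 p.
  rewrite Eh dyckword_cat /= add0n; congr (_ ++ _).
  have -> : forall i c, dyckword i c (nseq r D) = [::] by elim: r {Eh rE} => //=.
  by [].
have hw' : all (fun k => k.+2 < n)%N (dyckword 0 0 p).
  apply/allP => k kp; have := @dyckword_prefix_bound 0 0 p (nseq r D) k.
  by rewrite -Eh sh => /(_ dh kp); lia.
case: (height 0 p) E sp => [|c] E sp.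
  by exists [::], false, (dyckword 0 0 p).
exists (iota (size p) c), true, (dyckword 0 0 p); split=> //.
- by rewrite E -addn1 iotaD -catA /=; congr (_ ++ _ :: _); lia.
- by apply/allP => k; rewrite mem_iota; lia.
- by move=> _; lia.
Qed.

Section TLModule.
Variables (K : fieldType) (V : lmodType K) (d : K) (m : nat).
Variables (e : nat -> V -> V).
Hypothesis d0 : d != 0.
Hypothesis eZ : forall i a x, e i (a *: x) = a *: e i x.
Hypothesis ee : forall i x, (i.+1 < m.*2)%N -> e i (e i x) = d *: e i x.
Hypothesis eSe : forall i x, (i.+2 < m.*2)%N -> e i (e i.+1 (e i x)) = e i x.
Hypothesis eSe' : forall i x, (i.+2 < m.*2)%N ->
  e i.+1 (e i (e i.+1 x)) = e i.+1 x.
Hypothesis eC : forall i j x, (i.+1 < j)%N -> (j.+1 < m.*2)%N ->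
  e i (e j x) = e j (e i x).

Definition eword (w : seq nat) (x : V) := foldr e x w.

Lemma eword_cat w1 w2 x : eword (w1 ++ w2) x = eword w1 (eword w2 x).
Proof. by rewrite /eword foldr_cat. Qed.

Lemma ewordZ w a x : eword w (a *: x) = a *: eword w x.
Proof. by elim: w => //= i w ->; rewrite eZ. Qed.

Lemma eword_comm w i x : (forall k, k \in w -> (k.+1 < m.*2)%N) ->
  (i.+1 < m.*2)%N ->
  (forall k, k \in w -> (i.+1 < k)%N || (k.+1 < i)%N) ->
  e i (eword w x) = eword w (e i x).
Proof.
move=> hw hi; elim: w hw => //= k w IH hw far.
rewrite -IH; first last.
- by move=> j jw; apply: far; rewrite inE jw orbT.
- by move=> j jw; apply: hw; rewrite inE jw orbT.
have hk : (k.+1 < m.*2)%N by apply: hw; rewrite inE eqxx.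
by case/orP: (far k (mem_head _ _)) => h; [rewrite eC|rewrite -eC].
Qed.

(** The letter of the new square commutes past all the letters that come from
    later steps of the path. *)
Lemma raise_gen p q i c x : dyck c (p ++ [:: D, U & q]) ->
  (i + size p + (size q).+2 = m.*2)%N ->
  eword (dyckword i c (p ++ [:: U, D & q])) x =
  e (i + size p) (eword (dyckword i c (p ++ [:: D, U & q])) x).
Proof.
elim: p i c x => [|[] p IH] i c x=> /=.
- case: c => // c /= dq sz; rewrite addn0 !eword_cat /= [RHS]eword_comm //.
  + by move=> k /(dyckword_bound dq); lia.
  + by lia.
  + by move=> k /(dyckword_bound dq); lia.
- by move=> dp sz; rewrite !eword_cat IH ?addnS //; lia.
- by case/andP=> c0 dp sz; rewrite IH ?addnS //; lia.
Qed.

Section StartVector.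
Variable v : V.
Hypothesis ev : forall i, (i.+1 < m.*2)%N -> ~~ odd i -> e i v = d *: v.

Definition dvec (h : seq bool) := eword (dyckword 0 0 h) v.

Lemma dvec_raise p q : dyck 0 (p ++ [:: D, U & q]) ->
  (size p + (size q).+2 = m.*2)%N ->
  dvec (p ++ [:: U, D & q]) = e (size p) (dvec (p ++ [:: D, U & q])).
Proof. by move=> dp sz; rewrite /dvec raise_gen. Qed.

Lemma peak0 p q i c x : dyck c (p ++ [:: U, D & q]) -> height c p = 0%N ->
  (i + size p + (size q).+2 = m.*2)%N ->
  e (i + size p) x = d *: x ->
  e (i + size p) (eword (dyckword i c (p ++ [:: U, D & q])) x) =
  d *: eword (dyckword i c (p ++ [:: U, D & q])) x.
Proof.
elim: p i c x => [|[] p IH] i c x /=.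
- move=> dq hc sz ex; rewrite eword_cat /= addn0 in ex *.
  rewrite hc /= in dq *.
  rewrite eword_comm ?ex ?ewordZ //.
  + by move=> k /(dyckword_bound dq); lia.
  + by lia.
  + by move=> k /(dyckword_bound dq); lia.
- move=> dp hc sz ex; rewrite !eword_cat -addSnnS; apply: IH => //; first by lia.
  have := height_size c.+1 p; rewrite hc => hs.
  rewrite eword_comm; first by rewrite addSnnS ex ewordZ.
  + by move=> k; rewrite mem_iota; lia.
  + by lia.
  + by move=> k; rewrite mem_iota; lia.
- by case/andP=> c0 dp hc sz ex; rewrite -addSnnS; apply: IH => //;
     rewrite ?addSnnS //; lia.
Qed.

Lemma dyck_odd_height c p q : dyck c (p ++ q) ->
  odd (height c p) = odd c (+) odd (size p).
Proof.
elim: p c => [|[] p IH] c /=; first by rewrite addbF.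
  by move/IH ->; rewrite /=; case: odd; case: odd.
by case/andP; case: c => // c _ /IH -> /=; case: odd; case: odd.
Qed.

(** A peak at height one is a cap of the starting vector, and a higher one is
    a square whose generator was applied last; in both cases the generator at
    the peak acts by [d]. *)
Lemma peak p q : dyck 0 (p ++ [:: U, D & q]) ->
  (size p + (size q).+2 = m.*2)%N ->
  e (size p) (dvec (p ++ [:: U, D & q])) = d *: dvec (p ++ [:: U, D & q]).
Proof.
move=> dp sz; case: (posnP (height 0 p)) => hp.
  rewrite /dvec -[size p in LHS]add0n peak0 //= ?add0n ?ev //; first by lia.
  by have := dyck_odd_height dp; rewrite hp /= => <-.
have dl := dyck_lower dp hp.
by rewrite dvec_raise // ee //; lia.
Qed.

Definition area h := size (dyckword 0 0 h).

Lemma area_raise p q : dyck 0 (p ++ [:: D, U & q]) ->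
  area (p ++ [:: U, D & q]) = (area (p ++ [:: D, U & q])).+1.
Proof.
move=> dp; apply: size_dyckword_raise; move/dyck_cat: dp => /=.
by case: (height 0 p).
Qed.

(** The proof is by induction on the area. At a peak the generator acts by [d]
    and at a valley it raises the path. On a double slope the path is lowered
    at its nearest peak, and the generator is moved past the removed square;
    it either cancels that square by a Temperley-Lieb relation or commutes
    with it, and the remaining path has smaller area. *)
Lemma nf_step_area h i : dyck 0 h -> size h = m.*2 -> (i.+1 < m.*2)%N ->
  exists c h', [/\ dyck 0 h', size h' = m.*2,
    (area h' <= (area h).+1)%N /\
     (nth D h i = nth D h i.+1 -> area h' < area h)%N &
    e i (dvec h) = c *: dvec h'].
Proof.
have [a] := ubnP (area h).
elim: a h i => // a IH h i ha dh sh hi.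
pose p := take i h; pose q := drop i.+2 h.
have sp : size p = i by rewrite size_take; case: ltnP; lia.
have Eh : h = p ++ [:: nth D h i, nth D h i.+1 & q].
  rewrite -{1}(cat_take_drop i h) (drop_nth D); last by lia.
  by rewrite (drop_nth D) //; lia.
have sq : (size p + (size q).+2 = m.*2)%N by rewrite -sh Eh size_cat.
case: (nth D h i) (nth D h i.+1) Eh => [] [] /= Eh.
- (* on an up slope the nearest peak is to the right *)
  have dq : dyck (height 0 p).+2 q by move: dh; rewrite Eh => /dyck_cat.
  have [r [q' Eq]] := first_false (dyck_hasF dq).
  have E1 : h = (p ++ nseq r.+1 U) ++ [:: U, D & q'].
    rewrite Eh Eq -catA; congr (_ ++ _).
    by elim: r {Eq} => //= r <-.
  have hp1 c : (0 < height c (p ++ nseq r.+1 U))%N.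
    by rewrite height_cat height_ups addnS.
  have d1 : dyck 0 ((p ++ nseq r.+1 U) ++ [:: D, U & q']).
    by apply: dyck_lower => //; rewrite -E1.
  set h1 := (X in dyck 0 X) in d1.
  have s1 : (size (p ++ nseq r.+1 U) + (size q').+2 = m.*2)%N.
    by rewrite -sh E1 [RHS]size_cat.
  have sh1 : size h1 = m.*2 by rewrite size_cat.
  have a1 : area h = (area h1).+1 by rewrite E1 area_raise.
  have ek : dvec h = e (i + r.+1) (dvec h1).
    by rewrite {1}E1 dvec_raise // size_cat size_nseq sp.
  case: r Eq E1 hp1 @h1 d1 s1 sh1 a1 ek => [|r] Eq E1 hp1 h1 d1 s1 sh1 a1 ek.
    have Eh1 : h1 = p ++ [:: U, D & U :: q'] by rewrite /h1 -catA.
    exists 1, h1; split=> //; first by split; [lia|rewrite a1].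
    have pk : e i (dvec h1) = d *: dvec h1.
      rewrite Eh1 -sp peak //; first by rewrite -Eh1.
      by rewrite -sh1 Eh1 size_cat.
    have hi2 : (i.+2 < m.*2)%N.
      by move: s1; rewrite size_cat size_nseq sp; lia.
    rewrite ek addn1 scale1r; apply: (scalerI d0).
    by rewrite -2!eZ -pk eSe // eZ.
  have s1' : (i + r.+2 + (size q').+2 = m.*2)%N.
    by rewrite -s1 size_cat size_nseq sp.
  have [c [h2 [dh2 sh2 [_ ah2] eh2]]] : exists c h', [/\ dyck 0 h',
     size h' = m.*2, (area h' <= (area h1).+1)%N /\
     (nth D h1 i = nth D h1 i.+1 -> area h' < area h1)%N &
      e i (dvec h1) = c *: dvec h'] by apply: IH => //; lia.
  have {}ah2 : (area h2 < area h1)%N.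
    apply: ah2; rewrite /h1 -catA !nth_cat sp ltnn subnn.
    have -> : (i.+1 < i)%N = false by lia.
    by rewrite subSnn.
  have [c' [h3 [dh3 sh3 [ah3 _] eh3]]] : exists c h', [/\ dyck 0 h',
     size h' = m.*2, (area h' <= (area h2).+1)%N /\
     (nth D h2 (i + r.+2) = nth D h2 (i + r.+2).+1 -> area h' < area h2)%N &
      e (i + r.+2) (dvec h2) = c *: dvec h'] by apply: IH => //; lia.
  exists (c * c'), h3; split=> //; first by split; lia.
  by rewrite ek eC ?eh2 ?eZ ?eh3 ?scalerA //; lia.
- exists d, h; split=> //.
  by rewrite Eh -{1}sp peak // -Eh.
- have dU : dyck 0 (p ++ [:: U, D & q]) by apply: dyck_raise; rewrite -Eh.
  exists 1, (p ++ [:: U, D & q]); split=> //; first by rewrite size_cat.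
    by split=> //; rewrite Eh area_raise // -Eh.
  by rewrite scale1r dvec_raise // -?Eh // sp.
- (* on a down slope the nearest peak is to the left *)
  have hp : (1 < height 0 p)%N.
    by move: dh; rewrite Eh => /dyck_cat /=; case: (height 0 p) => [|[]].
  have Up : U \in p.
    have : (0 < height 0 p)%N by lia.
    elim: (p) => // -[] p' IHp /=; rewrite inE //=.
  have [r [p' Ep]] := last_true Up.
  have E1 : h = p' ++ [:: U, D & nseq r D ++ D :: q].
    rewrite Eh Ep -catA; congr (_ ++ (_ :: _)).
    by elim: r {Ep} => //= r ->.
  have hp1 : (0 < height 0 p')%N.
    move: hp; rewrite Ep.
    rewrite height_cat /=; case: (height 0 p') => //.
    by have := height_downs 1 r; lia.
  have d1 : dyck 0 (p' ++ [:: D, U & nseq r D ++ D :: q]).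
    by apply: dyck_lower => //; rewrite -E1.
  set h1 := (X in dyck 0 X) in d1.
  have s1 : (size p' + (size (nseq r D ++ D :: q)).+2 = m.*2)%N.
    by rewrite -sh E1 [RHS]size_cat.
  have sh1 : size h1 = m.*2 by rewrite size_cat.
  have a1 : area h = (area h1).+1 by rewrite E1 area_raise.
  have ek : dvec h = e (size p') (dvec h1) by rewrite {1}E1 dvec_raise.
  have Ei : i = (size p' + r.+1)%N.
    by rewrite -sp Ep size_cat /= size_nseq.
  case: r Ep E1 @h1 d1 s1 sh1 a1 ek Ei => [|r] Ep E1 h1 d1 s1 sh1 a1 ek Ei.
    have Eh1 : h1 = (p' ++ [:: D]) ++ [:: U, D & q] by rewrite /h1 -catA.
    have sp' : size (p' ++ [:: D]) = i by rewrite size_cat /= Ei.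
    exists 1, h1; split=> //; first by split; [lia|rewrite a1].
    have pk : e i (dvec h1) = d *: dvec h1.
      rewrite Eh1 -sp' peak //; first by rewrite -Eh1.
      by rewrite -sh1 Eh1 [RHS]size_cat.
    rewrite addn1 in Ei; rewrite ek scale1r; apply: (scalerI d0).
    by rewrite -2!eZ -pk Ei eSe' ?eZ //; lia.
  have [c [h2 [dh2 sh2 [_ ah2] eh2]]] : exists c h', [/\ dyck 0 h',
     size h' = m.*2, (area h' <= (area h1).+1)%N /\
     (nth D h1 i = nth D h1 i.+1 -> area h' < area h1)%N &
      e i (dvec h1) = c *: dvec h'] by apply: IH => //; lia.
  have {}ah2 : (area h2 < area h1)%N.
    have En p1 X k : nth D (p1 ++ X) (size p1 + k) = nth D X k.
      by rewrite nth_cat ltnNge leq_addr addKn.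
    apply: ah2; rewrite /h1 Ei -addnS !En.
    have -> : [:: D, U & nseq r.+1 D ++ D :: q] =
              [:: D; U] ++ nseq r.+2 D ++ q.
      by rewrite /=; congr [:: _, _, _ & _]; elim: (r) => //= r' ->.
    have Q j : (j < r.+2)%N -> nth D ([:: D; U] ++ nseq r.+2 D ++ q) j.+2 = D.
      by move=> hj; rewrite -[j.+2]/(2 + j)%N -[2%N]/(size [:: D; U]) En
        nth_cat size_nseq hj nth_nseq hj.
    by rewrite !Q.
  have [c' [h3 [dh3 sh3 [ah3 _] eh3]]] : exists c h', [/\ dyck 0 h',
     size h' = m.*2, (area h' <= (area h2).+1)%N /\
     (nth D h2 (size p') = nth D h2 (size p').+1 -> area h' < area h2)%N &
      e (size p') (dvec h2) = c *: dvec h'] by apply: IH => //; lia.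
  exists (c * c'), h3; split=> //; first by split; lia.
  by rewrite ek -eC ?eh2 ?eZ ?eh3 ?scalerA //; lia.
Qed.

Lemma nf_step h i : dyck 0 h -> size h = m.*2 -> (i.+1 < m.*2)%N ->
  exists c h', [/\ dyck 0 h', size h' = m.*2 & e i (dvec h) = c *: dvec h'].
Proof.
by move=> dh sh hi; have [c [h' [? ? _ ?]]] := nf_step_area dh sh hi; exists c, h'.
Qed.

End StartVector.
End TLModule.

(** * Strict monoidal calculus without casts *)

Section Laws.
Variables (C : numClosedFieldType) (anti : bool) (N : C).
Local Notation H := (bhom anti N).
Local Notation pi := (@bpi C anti N _ _).

Definition bcomp k l m (g : H l m) (f : H k l) : H k m := ldcomp (NCBipart anti N) g f.
Definition btens k l k' l' (f : H k l) (g : H k' l') : H (k + k') (l + l') :=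
  ldtens (NCBipart anti N) f g.
Definition bdag k l (f : H k l) : H l k := lddag (NCBipart anti N) f.
Definition bid k : H k k := bpi anti N (TId k).

Lemma bcomp_pi k l m (g : term C l m) (f : term C k l) :
  bcomp (pi g) (pi f) = pi (TComp g f).
Proof. by apply/bpiP; apply: teq_comp; exact: brepr_pi. Qed.
Lemma btens_pi k l k' l' (g : term C k l) (f : term C k' l') :
  btens (pi g) (pi f) = pi (TTens g f).
Proof. by apply/bpiP; apply: teq_tens; exact: brepr_pi. Qed.
Lemma bdag_pi k l (f : term C k l) : bdag (pi f) = pi (tdag anti f).
Proof. by apply/bpiP; apply: teq_dag; exact: brepr_pi. Qed.
Lemma hcast_pi k l k' l' (ek : k = k') (el : l = l') (f : term C k l) :
  hcast H ek el (pi f) = pi (hcast (term C) ek el f).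
Proof. by case: _ / ek; case: _ / el. Qed.
Lemma add_pi k l (f g : term C k l) : pi f + pi g = pi (TAdd f g).
Proof. exact: badd_pi. Qed.
Lemma scale_pi k l a (f : term C k l) : a *: pi f = pi (TScale a f).
Proof. exact: bscale_pi. Qed.
Lemma zero_pi k l : 0 = pi (TZero k l) :> H k l.
Proof. by []. Qed.

Lemma bcompA k l m n (h : H m n) (g : H l m) (f : H k l) :
  bcomp h (bcomp g f) = bcomp (bcomp h g) f.
Proof.
rewrite -(breprK f) -(breprK g) -(breprK h) !bcomp_pi.
by apply/bpiP; exact: teq_compA.
Qed.
Lemma bcomp1l k l (f : H k l) : bcomp (bid l) f = f.
Proof. by rewrite -(breprK f) bcomp_pi; apply/bpiP; exact: teq_comp1l. Qed.
Lemma bcomp1r k l (f : H k l) : bcomp f (bid k) = f.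
Proof. by rewrite -(breprK f) bcomp_pi; apply/bpiP; exact: teq_comp1r. Qed.
Lemma bcompDl k l m (g g' : H l m) (f : H k l) :
  bcomp (g + g') f = bcomp g f + bcomp g' f.
Proof.
rewrite -(breprK f) -(breprK g) -(breprK g') !(bcomp_pi, add_pi).
by apply/bpiP; exact: teq_compDl.
Qed.
Lemma bcompDr k l m (g : H l m) (f f' : H k l) :
  bcomp g (f + f') = bcomp g f + bcomp g f'.
Proof.
rewrite -(breprK f) -(breprK g) -(breprK f') !(bcomp_pi, add_pi).
by apply/bpiP; exact: teq_compDr.
Qed.
Lemma bcompZl k l m a (g : H l m) (f : H k l) :
  bcomp (a *: g) f = a *: bcomp g f.
Proof.
rewrite -(breprK f) -(breprK g) !(bcomp_pi, scale_pi).
by apply/bpiP; exact: teq_compZl.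
Qed.
Lemma bcompZr k l m a (g : H l m) (f : H k l) :
  bcomp g (a *: f) = a *: bcomp g f.
Proof.
rewrite -(breprK f) -(breprK g) !(bcomp_pi, scale_pi).
by apply/bpiP; exact: teq_compZr.
Qed.
Lemma bcomp0l k l m (f : H k l) : bcomp (0 : H l m) f = 0.
Proof. by rewrite -(scale0r 0) bcompZl scale0r. Qed.
Lemma bcomp0r k l m (g : H l m) : bcomp g (0 : H k l) = 0.
Proof. by rewrite -[X in bcomp _ X](scale0r 0) bcompZr scale0r. Qed.
Lemma btensA k l k' l' k'' l'' (f : H k l) (g : H k' l') (h : H k'' l'') :
  hcast H (addnA k k' k'') (addnA l l' l'') (btens f (btens g h)) =
  btens (btens f g) h.
Proof.
rewrite -(breprK f) -(breprK g) -(breprK h) !btens_pi hcast_pi.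
by apply/bpiP; exact: teq_tensA.
Qed.
Lemma btens1l k l (f : H k l) :
  hcast H (add0n k) (add0n l) (btens (bid 0) f) = f.
Proof.
by rewrite -(breprK f) btens_pi hcast_pi; apply/bpiP; exact: teq_tens1l.
Qed.
Lemma btens1r k l (f : H k l) :
  hcast H (addn0 k) (addn0 l) (btens f (bid 0)) = f.
Proof.
by rewrite -(breprK f) btens_pi hcast_pi; apply/bpiP; exact: teq_tens1r.
Qed.
Lemma btens_id k l : btens (bid k) (bid l) = bid (k + l).
Proof. by rewrite btens_pi; apply/bpiP; exact: teq_tens_id. Qed.
Lemma btens_comp k l m k' l' m' (g : H l m) (f : H k l)
    (g' : H l' m') (f' : H k' l') :
  btens (bcomp g f) (bcomp g' f') = bcomp (btens g g') (btens f f').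
Proof.
rewrite -(breprK f) -(breprK g) -(breprK f') -(breprK g').
by rewrite !(bcomp_pi, btens_pi); apply/bpiP; exact: teq_tens_comp.
Qed.
Lemma btensDl k l k' l' (f f' : H k l) (g : H k' l') :
  btens (f + f') g = btens f g + btens f' g.
Proof.
rewrite -(breprK f) -(breprK g) -(breprK f') !(btens_pi, add_pi).
by apply/bpiP; exact: teq_tensDl.
Qed.
Lemma btensDr k l k' l' (f : H k l) (g g' : H k' l') :
  btens f (g + g') = btens f g + btens f g'.
Proof.
rewrite -(breprK f) -(breprK g) -(breprK g') !(btens_pi, add_pi).
by apply/bpiP; exact: teq_tensDr.
Qed.
Lemma btensZl k l k' l' a (f : H k l) (g : H k' l') :
  btens (a *: f) g = a *: btens f g.
Proof.
rewrite -(breprK f) -(breprK g) !(btens_pi, scale_pi).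
by apply/bpiP; exact: teq_tensZl.
Qed.
Lemma btensZr k l k' l' a (f : H k l) (g : H k' l') :
  btens f (a *: g) = a *: btens f g.
Proof.
rewrite -(breprK f) -(breprK g) !(btens_pi, scale_pi).
by apply/bpiP; exact: teq_tensZr.
Qed.
Lemma btens0l k l k' l' (g : H k' l') : btens (0 : H k l) g = 0.
Proof. by rewrite -(scale0r 0) btensZl scale0r. Qed.
Lemma btens0r k l k' l' (f : H k l) : btens f (0 : H k' l') = 0.
Proof. by rewrite -[X in btens _ X](scale0r 0) btensZr scale0r. Qed.

Lemma bdag_comp k l m (g : H l m) (f : H k l) :
  bdag (bcomp g f) = bcomp (bdag f) (bdag g).
Proof. by rewrite -(breprK f) -(breprK g) !(bcomp_pi, bdag_pi). Qed.
Lemma bdag_tens k l k' l' (f : H k l) (g : H k' l') :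
  bdag (btens f g) = btens (bdag f) (bdag g).
Proof. by rewrite -(breprK f) -(breprK g) !(btens_pi, bdag_pi). Qed.
Lemma bdag_id k : bdag (bid k) = bid k.
Proof. by rewrite bdag_pi. Qed.
Lemma bdagD k l (f g : H k l) : bdag (f + g) = bdag f + bdag g.
Proof. by rewrite -(breprK f) -(breprK g) !(add_pi, bdag_pi). Qed.
Lemma bdagZ k l a (f : H k l) : bdag (a *: f) = star anti a *: bdag f.
Proof. by rewrite -(breprK f) !(scale_pi, bdag_pi). Qed.
Lemma starK : involutive (star (C := C) anti).
Proof. by move=> a; rewrite /star; case: (anti) => //; rewrite conjCK. Qed.
Lemma bdagK k l (f : H k l) : bdag (bdag f) = f.
Proof.
rewrite -(breprK f) !bdag_pi; congr bpi; elim: (brepr f) => //=.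
- by move=> k' l' m' g -> h ->.
- by move=> k' l' k'' l'' g -> h ->.
- by move=> k' l' g -> h ->.
- by move=> k' l' a g ->; rewrite starK.
Qed.
Lemma bdag0 k l : bdag (0 : H k l) = 0.
Proof. by rewrite {1}zero_pi bdag_pi. Qed.

(** Packing a morphism with its source and target removes
    the casts along associativity of addition. Composites of mismatched
    morphisms are zero, which makes composition associative without side
    conditions. *)
Definition um := {kl : nat * nat & H kl.1 kl.2}.
Definition Um k l (f : H k l) : um := existT (fun kl => H kl.1 kl.2) (k, l) f.
Definition udom (u : um) := (projT1 u).1.
Definition ucod (u : um) := (projT1 u).2.
Definition umor (u : um) : H (udom u) (ucod u) := projT2 u.

Definition typed k l (u : um) : H k l :=
  match eqVneq (udom u) k, eqVneq (ucod u) l with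
  | EqNotNeq e1, EqNotNeq e2 => hcast H e1 e2 (umor u)
  | _, _ => 0
  end.

Lemma UmE u : Um (umor u) = u.
Proof. by case: u => -[k l] f. Qed.

(** Equality of objects is decidable, so casts along it are irrelevant. *)
Lemma nat_axK (n : nat) (e : n = n) : e = erefl n.
Proof. exact: eq_axiomK. Qed.

Lemma typedK k l (f : H k l) : typed k l (Um f) = f.
Proof.
rewrite /typed /=; case: eqVneq => [e1|/eqP //]; case: eqVneq => [e2|/eqP //].
by rewrite (nat_axK e1) (nat_axK e2).
Qed.

Lemma Um_inj k l : injective (@Um k l).
Proof. by move=> f g E; rewrite -[f]typedK E typedK. Qed.

Lemma Um_typed k l u : udom u = k -> ucod u = l -> Um (typed k l u) = u.
Proof. by move=> <- <-; case: u => -[k' l'] f /=; rewrite typedK. Qed.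

Lemma Um_hcast k l k' l' (ek : k = k') (el : l = l') (f : H k l) :
  Um (hcast H ek el f) = Um f.
Proof. by case: _ / ek; case: _ / el. Qed.

Definition ucomp (g f : um) : um :=
  Um (bcomp (typed (ucod f) (ucod g) g) (umor f)).
Definition utens (f g : um) : um := Um (btens (umor f) (umor g)).
Definition uid k : um := Um (bid k).
Lemma uidE k : uid k = Um (bid k). Proof. by []. Qed.
Definition uscale a (f : um) : um := Um (a *: umor f).
Definition udag (f : um) : um := Um (bdag (umor f)).

Lemma udom_comp g f : udom (ucomp g f) = udom f. Proof. by []. Qed.
Lemma ucod_comp g f : ucod (ucomp g f) = ucod g. Proof. by []. Qed.
Lemma udom_tens g f : udom (utens g f) = (udom g + udom f)%N. Proof. by []. Qed.
Lemma ucod_tens g f : ucod (utens g f) = (ucod g + ucod f)%N. Proof. by []. Qed.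
Lemma udom_id k : udom (uid k) = k. Proof. by []. Qed.
Lemma ucod_id k : ucod (uid k) = k. Proof. by []. Qed.
Lemma udom_scale a f : udom (uscale a f) = udom f. Proof. by []. Qed.
Lemma ucod_scale a f : ucod (uscale a f) = ucod f. Proof. by []. Qed.
Lemma udom_dag f : udom (udag f) = ucod f. Proof. by []. Qed.
Lemma ucod_dag f : ucod (udag f) = udom f. Proof. by []. Qed.
Definition udim := (udom_comp, ucod_comp, udom_tens, ucod_tens, udom_id,
  ucod_id, udom_scale, ucod_scale, udom_dag, ucod_dag).

Lemma Um_comp k l m (g : H l m) (f : H k l) :
  Um (bcomp g f) = ucomp (Um g) (Um f).
Proof. by rewrite /ucomp /= typedK. Qed.
Lemma Um_tens k l k' l' (f : H k l) (g : H k' l') :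
  Um (btens f g) = utens (Um f) (Um g).
Proof. by []. Qed.
Lemma Um_scale k l a (f : H k l) : Um (a *: f) = uscale a (Um f).
Proof. by []. Qed.
Lemma Um_dag k l (f : H k l) : Um (bdag f) = udag (Um f).
Proof. by []. Qed.

Lemma typed0 k l u : ~~ ((udom u == k) && (ucod u == l)) -> typed k l u = 0.
Proof.
rewrite /typed; case: eqVneq => //= e1; case: eqVneq => //= e2.
Qed.

Lemma ucomp_mis g f : ucod f != udom g ->
  ucomp g f = Um (0 : H (udom f) (ucod g)).
Proof. by move=> h; rewrite /ucomp typed0 ?bcomp0l // eq_sym (negPf h). Qed.

Lemma ucomp0r k l g : ucomp g (Um (0 : H k l)) = Um (0 : H k (ucod g)).
Proof. by rewrite /ucomp bcomp0r. Qed.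
Lemma ucomp0l k l f : ucomp (Um (0 : H k l)) f = Um (0 : H (udom f) l).
Proof.
case: (eqVneq (ucod f) k) => [e|ne]; last by rewrite ucomp_mis.
by case: _ / e; rewrite -[in LHS](UmE f) -Um_comp bcomp0l.
Qed.

Lemma um_case g f : (ucod f != udom g) \/
  exists k l m (g' : H l m) (f' : H k l), g = Um g' /\ f = Um f'.
Proof.
case: eqVneq => [e|]; [right|by left].
case: g f e => -[l m] g [[k l'] f] /= e; rewrite /ucod /udom /= in e.
by subst l'; exists k, l, m, g, f.
Qed.

Lemma ucompA h g f : ucomp h (ucomp g f) = ucomp (ucomp h g) f.
Proof.
case: (um_case g f) => [ne|[k [l [m [g' [f' [-> ->]]]]]]].
  by rewrite (ucomp_mis ne) ucomp0r ucomp_mis ?udim.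
case: (um_case h (Um g')) => [ne|[k' [l' [m' [h' [g'' [-> E]]]]]]].
  by rewrite (ucomp_mis ne) ucomp0l ucomp_mis.
have E1 : k' = l by have /= := congr1 udom E; rewrite /udom.
have E2 : l' = m by have /= := congr1 ucod E; rewrite /ucod.
by subst k' l'; rewrite -!Um_comp bcompA.
Qed.

Lemma ucomp1l k f : ucod f = k -> ucomp (uid k) f = f.
Proof. by move=> <-; rewrite -{2 3}(UmE f) -Um_comp bcomp1l. Qed.
Lemma ucomp1r k f : udom f = k -> ucomp f (uid k) = f.
Proof. by move=> <-; rewrite -{1 3}(UmE f) -Um_comp bcomp1r. Qed.

Lemma utensA f g h : utens f (utens g h) = utens (utens f g) h.
Proof.
by move: (congr1 (@Um _ _) (btensA (umor f) (umor g) (umor h))); rewrite Um_hcast.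
Qed.
Lemma utens1l f : utens (uid 0) f = f.
Proof. by rewrite -[RHS]UmE -[in RHS](btens1l (umor f)) Um_hcast. Qed.
Lemma utens1r f : utens f (uid 0) = f.
Proof. by rewrite -[RHS]UmE -[in RHS](btens1r (umor f)) Um_hcast. Qed.
Lemma utens_id k l : utens (uid k) (uid l) = uid (k + l).
Proof. by rewrite /uid -btens_id. Qed.
Lemma utens_comp g f g' f' : ucod f = udom g -> ucod f' = udom g' ->
  ucomp (utens g g') (utens f f') = utens (ucomp g f) (ucomp g' f').
Proof.
move=> /eqP e /eqP e'.
case: (um_case g f) => [|[k [l [m [g1 [f1 [-> ->]]]]]]]; first by rewrite e.
case: (um_case g' f') => [|[k' [l' [m' [g2 [f2 [-> ->]]]]]]]; first by rewrite e'.
transitivity (Um (bcomp (btens g1 g2) (btens f1 f2))); first by rewrite Um_comp.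
by rewrite -btens_comp Um_tens !Um_comp.
Qed.

Lemma uscaleA a b f : uscale a (uscale b f) = uscale (a * b) f.
Proof. by rewrite /uscale /= scalerA. Qed.
Lemma uscale1 f : uscale 1 f = f.
Proof. by rewrite /uscale scale1r UmE. Qed.
Lemma ucompZr a g f : ucomp g (uscale a f) = uscale a (ucomp g f).
Proof. by rewrite /ucomp /= bcompZr. Qed.
Lemma ucompZl a g f : ucomp (uscale a g) f = uscale a (ucomp g f).
Proof.
case: (um_case g f) => [ne|[k [l [m [g1 [f1 [-> ->]]]]]]].
  by rewrite !ucomp_mis // /uscale scaler0.
by rewrite -Um_scale -!Um_comp bcompZl.
Qed.
Lemma utensZl a g f : utens (uscale a g) f = uscale a (utens g f).
Proof. by rewrite /utens /= btensZl. Qed.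
Lemma utensZr a g f : utens g (uscale a f) = uscale a (utens g f).
Proof. by rewrite /utens /= btensZr. Qed.
Lemma udag_comp g f : ucod f = udom g ->
  udag (ucomp g f) = ucomp (udag f) (udag g).
Proof.
move=> /eqP e.
case: (um_case g f) => [|[k [l [m [g1 [f1 [-> ->]]]]]]]; first by rewrite e.
by rewrite -Um_comp -!Um_dag -Um_comp bdag_comp.
Qed.
Lemma udag_tens f g : udag (utens f g) = utens (udag f) (udag g).
Proof. by rewrite /udag /= bdag_tens. Qed.
Lemma udag_id k : udag (uid k) = uid k.
Proof. by rewrite /udag /= bdag_id. Qed.
Lemma udag_scale a f : udag (uscale a f) = uscale (star anti a) (udag f).
Proof. by rewrite /udag /= bdagZ. Qed.

(** The morphism [f] acting on consecutive strands, with [i] strands to its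
    left and [j] strands to its right. *)
Definition wh i f j := utens (uid i) (utens f (uid j)).

Lemma wh00 f : wh 0 f 0 = f.
Proof. by rewrite /wh utens1l utens1r. Qed.
Lemma udom_wh i f j : udom (wh i f j) = (i + (udom f + j))%N. Proof. by []. Qed.
Lemma ucod_wh i f j : ucod (wh i f j) = (i + (ucod f + j))%N. Proof. by []. Qed.
Lemma whZ a i f j : wh i (uscale a f) j = uscale a (wh i f j).
Proof. by rewrite /wh utensZl utensZr. Qed.
Lemma wh_id i k j : wh i (uid k) j = uid (i + (k + j)).
Proof. by rewrite /wh !utens_id. Qed.
Lemma udag_wh i f j : udag (wh i f j) = wh i (udag f) j.
Proof. by rewrite /wh !udag_tens !udag_id. Qed.
Lemma wh_comp i g f j : ucod f = udom g ->
  ucomp (wh i g j) (wh i f j) = wh i (ucomp g f) j.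
Proof.
by move=> e; rewrite /wh !utens_comp ?udim ?e // !ucomp1l.
Qed.
Lemma wh_wh i p f q j : wh i (wh p f q) j = wh (i + p) f (q + j).
Proof. by rewrite /wh -2!utens_id -!utensA. Qed.
Lemma wh_comm i f g p j :
  ucomp (wh i f (p + (ucod g + j))) (wh (i + (udom f + p)) g j) =
  ucomp (wh (i + (ucod f + p)) g j) (wh i f (p + (udom g + j))).
Proof.
rewrite /wh -!utens_id -!utensA.
rewrite !utens_comp ?udim // ?ucomp1l ?ucomp1r //.
Qed.

End Laws.

(** * Spider identities *)

Section Spiders.
Variables (C : numClosedFieldType) (anti : bool) (N : C).
Hypothesis N0 : N != 0.
Hypothesis starN : star anti N = N.
Local Notation um := (um anti N).
Local Notation uid := (uid anti N).

Definition sp s k l : um := Um (bpi anti N (TSpider s k l)).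

Lemma udom_sp s k l : udom (sp s k l) = k. Proof. by []. Qed.
Lemma ucod_sp s k l : ucod (sp s k l) = l. Proof. by []. Qed.

Lemma sp_dag s k l : udag (sp s k l) = sp s l k.
Proof. by rewrite /udag /= bdag_pi. Qed.
Lemma sp11 s : sp s 1 1 = uid 1.
Proof. by congr Um; apply/bpiP; exact: teq_spider11. Qed.
Lemma sp00 s : sp s 0 0 = uscale N (uid 0).
Proof. by congr Um; rewrite /= scale_pi; apply/bpiP; exact: teq_spider00. Qed.

Lemma fuse_l s k1 l1 k2 l2 m : (0 < m)%N ->
  ucomp (wh 0 (sp s (k1 + m) l1) l2) (wh k1 (sp s k2 (m + l2)) 0) =
  sp s (k1 + k2) (l1 + l2).
Proof.
move=> m0; rewrite /wh utens1l utens1r /sp !uidE -!Um_tens.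
rewrite -[X in ucomp _ X](Um_hcast erefl (addnA k1 m l2)) -Um_comp !btens_pi.
rewrite hcast_pi bcomp_pi; congr Um; apply/bpiP; exact: teq_spider_fuse.
Qed.

(** The mirror image of [fuse_l], which is one of the relations, is its
    dagger. *)
Lemma fuse_r s k1 l1 k2 l2 m : (0 < m)%N ->
  ucomp (wh k1 (sp s (m + l2) k2) 0) (wh 0 (sp s l1 (k1 + m)) l2) =
  sp s (l1 + l2) (k1 + k2).
Proof.
move=> m0; have := congr1 (@udag _ _ _) (fuse_l s k1 l1 k2 l2 m0).
rewrite udag_comp ?udag_wh ?sp_dag ?udom_wh ?ucod_wh //=.
by rewrite udom_sp ucod_sp addn0 addnA.
Qed.

Lemma sp02 s : sp s 0 2 = sp false 0 2.
Proof. by case: s => //; congr Um; apply/esym/bpiP; exact: teq_spider02. Qed.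
Lemma sp20 s : sp s 2 0 = sp false 2 0.
Proof. by rewrite -(sp_dag s) sp02 sp_dag. Qed.

Lemma sp_bw s : ucomp (sp s 2 1) (sp (~~ s) 1 2) =
  uscale N^-1 (ucomp (sp s 0 1) (sp (~~ s) 1 0)).
Proof.
have bw : ucomp (sp false 2 1) (sp true 1 2) =
    uscale N^-1 (ucomp (sp false 0 1) (sp true 1 0)).
  rewrite /sp -!Um_comp !bcomp_pi -Um_scale scale_pi; congr Um; apply/bpiP.
  exact: teq_spider_bw.
case: s => //; have := congr1 (@udag _ _ _) bw.
rewrite udag_scale !udag_comp // !sp_dag => ->; congr uscale.
by move: starN; rewrite /star; case: (anti) => //; rewrite fmorphV /= => ->.
Qed.

Local Notation "g '**' f" := (ucomp g f) (at level 45, right associativity).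
Local Notation S s := (sp s 2 2).
Local Notation cup := (sp false 0 2).
Local Notation cap := (sp false 2 0).

Section Whiskering.
Variable W : nat -> um -> nat -> um.
Hypothesis W00 : forall f, W 0 f 0 = f.
Hypothesis W_comp : forall i g f j, ucod f = udom g ->
  W i g j ** W i f j = W i (g ** f) j.
Hypothesis WZ : forall a i f j, W i (uscale a f) j = uscale a (W i f j).
Hypothesis WW : forall i p f q j, W i (W p f q) j = W (i + p) f (q + j).
Hypothesis W_id : forall i k j, W i (uid k) j = uid (i + (k + j)).
Hypothesis W_dom : forall i f j, udom (W i f j) = (i + (udom f + j))%N.
Hypothesis W_cod : forall i f j, ucod (W i f j) = (i + (ucod f + j))%N.
Hypothesis W_comm : forall i f g p j,
  W i f (p + (ucod g + j)) ** W (i + (udom f + p)) g j =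
  W (i + (ucod f + p)) g j ** W i f (p + (udom g + j)).
Hypothesis W_fl : forall s k1 l1 k2 l2 m, (0 < m)%N ->
  W 0 (sp s (k1 + m) l1) l2 ** W k1 (sp s k2 (m + l2)) 0 =
  sp s (k1 + k2) (l1 + l2).
Hypothesis W_fr : forall s k1 l1 k2 l2 m, (0 < m)%N ->
  W k1 (sp s (m + l2) k2) 0 ** W 0 (sp s l1 (k1 + m)) l2 =
  sp s (l1 + l2) (k1 + k2).

(** A black and a white spider that share two legs are disconnected by the
    relation between colours; here this happens on a cup, which carries either
    colour. *)
Lemma W_zip0 s : W 0 (sp s 2 1) 1 ** W 1 (sp (~~ s) 1 2) 0 ** cup =
  uscale N^-1 (W 0 (sp s 0 1) 1 ** sp (~~ s) 0 1).
Proof.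
have F1 : W 1 (sp (~~ s) 1 2) 0 ** cup = sp (~~ s) 0 3.
  by rewrite -(sp02 (~~ s)) -[sp _ 0 2]W00; exact: (W_fr _ 1 0 2 0 (ltn0Sn 0)).
have F2 : W 0 (sp (~~ s) 1 2) 1 ** cup = sp (~~ s) 0 3.
  by rewrite -(sp02 (~~ s)) -[sp _ 0 2]W00; exact: (W_fl _ 0 2 0 1 (ltn0Sn 0)).
have F3 : W 0 (sp (~~ s) 1 0) 1 ** cup = sp (~~ s) 0 1.
  by rewrite -(sp02 (~~ s)) -[sp _ 0 2]W00; exact: (W_fl _ 0 0 0 1 (ltn0Sn 0)).
by rewrite F1 -F2 ucompA W_comp // sp_bw WZ ucompZl -W_comp // -ucompA F3.
Qed.

Lemma W_zip s : W 0 (sp s 2 1) 1 ** W 1 (sp (~~ s) 1 2) 0 ** sp s 1 2 =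
  uscale N^-1 (W 1 (sp (~~ s) 0 1) 0).
Proof.
have -> : sp s 1 2 = W 0 (sp s 2 1) 1 ** W 1 cup 0.
  by rewrite -(sp02 s); apply/esym; exact: (W_fl _ 1 1 0 1 (ltn0Sn 0)).
have -> : W 1 (sp (~~ s) 1 2) 0 ** W 0 (sp s 2 1) 1 ** W 1 cup 0 =
   W 0 (sp s 2 1) 2 ** W 2 (sp (~~ s) 1 2) 0 ** W 1 cup 0.
  by rewrite ucompA -(W_comm 0 (sp s 2 1) (sp (~~ s) 1 2) 0 0) -ucompA.
have -> : W 0 (sp s 2 1) 2 = W 0 (W 0 (sp s 2 1) 1) 1 by rewrite WW.
rewrite ucompA W_comp ?W_cod //.
have -> : sp s 2 1 ** W 0 (sp s 2 1) 1 = sp s 2 1 ** W 1 (sp s 2 1) 0.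
  transitivity (sp s 3 1); rewrite -[X in X ** _]W00.
    exact: (W_fr s 0 2 1 1 (ltn0Sn 0)).
  by apply/esym; exact: (W_fl s 1 1 2 0 (ltn0Sn 0)).
rewrite -W_comp ?W_cod // -ucompA.
have -> : W 0 (W 1 (sp s 2 1) 0) 1 = W 1 (W 0 (sp s 2 1) 1) 0 by rewrite !WW.
have -> : W 2 (sp (~~ s) 1 2) 0 = W 1 (W 1 (sp (~~ s) 1 2) 0) 0 by rewrite WW.
rewrite !W_comp ?W_cod ?W_dom //=; last by rewrite ucod_comp W_cod.
rewrite W_zip0 WZ ucompZr -W_comp ?W_cod // ucompA WW.
rewrite -[W (1 + 0) _ _](WW 0 1 (sp s 0 1) 0 1) W_comp ?W_cod //.
have -> : sp s 2 1 ** W 1 (sp s 0 1) 0 = uid 1.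
  by rewrite -[sp s 2 1]W00 (W_fl s 1 1 0 0 (ltn0Sn 0)) sp11.
by rewrite W_id ucomp1l ?W_cod.
Qed.

(** The proof uses only formal properties of adding strands on both sides, so
    that it applies to the operation [wh] and to its mirror image. *)
Lemma W_tl s :
  W 0 (S s) 1 ** W 1 (S (~~ s)) 0 ** W 0 (S s) 1 = uscale N^-1 (W 0 (S s) 1).
Proof.
have SE : S s = sp s 1 2 ** sp s 2 1.
  rewrite -[sp s 1 2]W00 -[sp s 2 1]W00.
  by apply/esym; exact: (W_fl s 0 2 2 0 (ltn0Sn 0)).
have Q : W 0 (sp s 2 1) 1 ** W 1 (S (~~ s)) 0 ** W 0 (sp s 1 2) 1 =
  uscale N^-1 (uid 2).
  have -> : S (~~ s) = W 1 (sp (~~ s) 2 1) 0 ** W 0 (sp (~~ s) 1 2) 1.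
    by apply/esym; exact: (W_fr (~~ s) 1 1 1 1 (ltn0Sn 0)).
  rewrite -(W_comp 1 (g := W 1 (sp (~~ s) 2 1) 0)) ?W_cod ?W_dom //.
  rewrite !WW -!ucompA ucompA.
  have -> : W 0 (sp s 2 1) 1 ** W (1 + 1) (sp (~~ s) 2 1) (0 + 0) =
            W 1 (sp (~~ s) 2 1) 0 ** W 0 (sp s 2 1) 2.
    exact: (W_comm 0 (sp s 2 1) (sp (~~ s) 2 1) 0 0).
  rewrite -ucompA.
  have -> : W 0 (sp s 2 1) 2 = W 0 (W 0 (sp s 2 1) 1) 1 by rewrite WW.
  have -> : W (1 + 0) (sp (~~ s) 1 2) (1 + 0) = W 0 (W 1 (sp (~~ s) 1 2) 0) 1.
    by rewrite WW.
  rewrite !W_comp ?W_cod ?W_dom //=; last by rewrite ucod_comp W_cod.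
  rewrite W_zip WZ ucompZr.
  have -> : W 0 (W 1 (sp (~~ s) 0 1) 0) 1 = W 1 (W 0 (sp (~~ s) 0 1) 1) 0.
    by rewrite !WW.
  rewrite W_comp ?W_cod // -[sp (~~ s) 2 1]W00.
  by rewrite (W_fr (~~ s) 0 0 1 1 (ltn0Sn 0)) sp11 W_id.
rewrite {1 2}SE -!(W_comp 0 (g := sp s 1 2)) // -!ucompA.
rewrite [W 0 (sp s 2 1) 1 ** _ ** _ ** _]ucompA [(_ ** _) ** _ ** _]ucompA.
rewrite -[(W 0 (sp s 2 1) 1 ** _) ** _]ucompA Q ucompZl ucomp1l ?W_cod //.
by rewrite ucompZr W_comp // -SE.
Qed.
End Whiskering.


(** Reflection of diagrams in a vertical line. *)
Definition whm i (f : um) j : um := wh j f i.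

(** This makes [d] times the spiders Temperley-Lieb generators. *)
Lemma wh_tl s : wh 0 (S s) 1 ** wh 1 (S (~~ s)) 0 ** wh 0 (S s) 1 =
  uscale N^-1 (wh 0 (S s) 1).
Proof.
apply: W_tl => *; rewrite ?wh00 ?wh_comp ?whZ ?wh_wh ?wh_id //.
- exact: wh_comm.
- exact: fuse_l.
- exact: fuse_r.
Qed.

Lemma wh_tl' s : wh 1 (S s) 0 ** wh 0 (S (~~ s)) 1 ** wh 1 (S s) 0 =
  uscale N^-1 (wh 1 (S s) 0).
Proof.
have := @W_tl whm; rewrite /whm; apply.
- by move=> f; rewrite wh00.
- by move=> i g f j e; rewrite wh_comp.
- by move=> a i f j; rewrite whZ.
- by move=> i p f q j; rewrite wh_wh addnC [(p + i)%N]addnC.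
- by move=> i k j; rewrite wh_id; congr uid; lia.
- by move=> i f j; rewrite udom_wh; lia.
- by move=> i f j; rewrite ucod_wh; lia.
- move=> i f g p j; have := @wh_comm _ _ _ j g f p i.
  rewrite (_ : (j + (udom g + p) = p + (udom g + j))%N); last by lia.
  rewrite (_ : (j + (ucod g + p) = p + (ucod g + j))%N); last by lia.
  rewrite (_ : (p + (ucod f + i) = i + (ucod f + p))%N); last by lia.
  by rewrite (_ : (p + (udom f + i) = i + (udom f + p))%N) //; lia.
- move=> t k1 l1 k2 l2 n n0.
  rewrite [(k1 + n)%N]addnC [(n + l2)%N]addnC fuse_r //.
  by rewrite addnC [(l2 + _)%N]addnC.
- move=> t k1 l1 k2 l2 n n0.
  rewrite [(k1 + n)%N]addnC [(n + l2)%N]addnC fuse_l //.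
  by rewrite addnC [(k2 + _)%N]addnC.
Qed.

Lemma S_factor s : S s = sp s 1 2 ** sp s 2 1.
Proof.
have := fuse_l s 0 2 2 0 (ltn0Sn 0); rewrite !wh00 //.
Qed.

Lemma SS s : S s ** S s = S s.
Proof. by have := fuse_l s 0 2 2 0 (ltn0Sn 1); rewrite !wh00. Qed.

(** Each spider factors through one strand, where the relation between the two
    colours applies. *)
Lemma SSn s : S s ** S (~~ s) = uscale N^-1 (cup ** cap).
Proof.
rewrite (S_factor s) (S_factor (~~ s)) -!ucompA.
rewrite [sp s 2 1 ** _]ucompA sp_bw ucompZl ucompZr -ucompA.
have F1 : sp (~~ s) 1 0 ** sp (~~ s) 2 1 = cap.
  by have := fuse_l (~~ s) 0 0 2 0 (ltn0Sn 0); rewrite !wh00 sp20.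
have F2 : sp s 1 2 ** sp s 0 1 = cup.
  by have := fuse_l s 0 2 0 0 (ltn0Sn 0); rewrite !wh00 sp02.
by rewrite F1 ucompA F2.
Qed.

Lemma S_shift s : wh 0 (S s) 1 ** wh 1 (S s) 0 = wh 1 (S s) 0 ** wh 0 (S s) 1.
Proof.
rewrite (fuse_l s 1 2 2 1 (ltn0Sn 0)).
by rewrite (fuse_r s 1 2 2 1 (ltn0Sn 0)).
Qed.

Lemma capS s : cap ** S s = cap.
Proof.
by rewrite -(sp20 s); have := fuse_l s 0 0 2 0 (ltn0Sn 1); rewrite !wh00.
Qed.

Lemma snake_l : wh 0 cap 1 ** wh 1 cup 0 = uid 1.
Proof. by rewrite (fuse_l false 1 0 0 1 (ltn0Sn 0)) sp11. Qed.

Lemma snake_r : wh 1 cap 0 ** wh 0 cup 1 = uid 1.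
Proof. by rewrite (fuse_r false 1 0 0 1 (ltn0Sn 0)) sp11. Qed.

Lemma capcup : cap ** cup = uscale N (uid 0).
Proof.
have := fuse_l false 0 0 0 0 (ltn0Sn 1).
by rewrite !wh00 sp00.
Qed.

Lemma S_shift_cap s : wh 0 cap 1 ** wh 1 (S s) 0 = wh 1 cap 0 ** wh 0 (S s) 1.
Proof.
rewrite -(sp20 s) (fuse_l s 1 0 2 1 (ltn0Sn 0)).
by rewrite (fuse_r s 1 2 0 1 (ltn0Sn 0)).
Qed.

(** With a cup inserted between its two upper legs, a spider becomes a word in
    spiders on neighbouring strands. The dagger of this identity moves a cap
    out from between the legs of a spider. *)
Lemma S_cup_split s : wh 1 (S (~~ s)) 1 ** wh 0 (S s) 2 ** wh 2 (S s) 0 ** wh 1 cup 1 =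
  uscale N^-1 (wh 1 cup 1 ** S s).
Proof.
rewrite -(sp02 s).
have F1 : wh 2 (S s) 0 ** wh 1 (sp s 0 2) 1 = wh 1 (sp s 1 3) 0.
  have := fuse_r s 1 0 2 1 (ltn0Sn 0) => /= E.
  rewrite -[wh 2 (S s) 0](wh_wh 1 1 (S s) 0 0) -[wh 1 (sp s 0 2) 1](wh_wh 1 0 (sp s 0 2) 1 0).
  by rewrite wh_comp // E.
have F2 : wh 0 (S s) 2 ** wh 1 (sp s 1 3) 0 = sp s 2 4.
  exact: (fuse_l s 1 2 1 2 (ltn0Sn 0)).
have F3 : sp s 2 4 = wh 1 (sp s 1 2) 1 ** sp s 2 3.
  have G : wh 0 (sp s 1 2) 1 ** sp s 1 2 = sp s 1 3.
    by rewrite -[sp s 1 2 in X in _ ** X]wh00; exact: (fuse_l s 0 2 1 1 (ltn0Sn 0)).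
  have G' : sp s 2 3 = wh 0 (sp s 2 2) 1 ** wh 1 (sp s 1 2) 0.
    by apply/esym; exact: (fuse_l s 1 2 1 1 (ltn0Sn 0)).
  have G2 : sp s 2 3 = wh 1 (sp s 1 2) 0 ** S s.
    by rewrite -[S s]wh00; apply/esym; exact: (fuse_r s 1 2 2 0 (ltn0Sn 0)).
  have G3 : wh 1 (sp s 1 3) 0 ** S s = sp s 2 4.
    by rewrite -[S s]wh00; exact: (fuse_r s 1 2 3 0 (ltn0Sn 0)).
  rewrite -G3 -G -wh_comp // wh_wh G2 ucompA //.
have F4 : S (~~ s) ** sp s 1 2 = uscale N^-1 (cup ** sp s 1 0).
  rewrite (S_factor (~~ s)) -ucompA.
  have := sp_bw (~~ s); rewrite negbK => ->.
  rewrite ucompZr ucompA; congr (uscale _ (_ ** _)).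
  by have := fuse_l (~~ s) 0 2 0 0 (ltn0Sn 0); rewrite !wh00 sp02.
rewrite F1 F2 F3 ucompA wh_comp // F4 whZ ucompZl; congr uscale.
rewrite (sp02 s) -wh_comp // -ucompA; congr (_ ** _).
have G2 : sp s 2 3 = wh 1 (sp s 1 2) 0 ** S s.
  by rewrite -[S s]wh00; apply/esym; exact: (fuse_r s 1 2 2 0 (ltn0Sn 0)).
rewrite G2 ucompA -[wh 1 (sp s 1 0) 1](wh_wh 1 0 (sp s 1 0) 1 0) wh_comp //.
have -> : wh 0 (sp s 1 0) 1 ** sp s 1 2 = uid 1.
  rewrite -[sp s 1 2]wh00 -(sp11 s); exact: (fuse_l s 0 0 1 1 (ltn0Sn 0)).
by rewrite wh_id ucomp1l.
Qed.

Lemma S_cap_split s : wh 1 cap 1 ** wh 2 (S s) 0 ** wh 0 (S s) 2 ** wh 1 (S (~~ s)) 1 =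
  uscale N^-1 (S s ** wh 1 cap 1).
Proof.
have := congr1 (@udag _ _ _) (S_cup_split s).
rewrite udag_scale !udag_comp ?udag_wh ?sp_dag //.
rewrite -!ucompA => ->; congr uscale.
by move: starN; rewrite /star; case: (anti) => //; rewrite fmorphV /= => ->.
Qed.

(** The two spiders disconnect the middle strands, and the snake identity
    straightens what is left. *)
Lemma nested_cap s : cap ** wh 1 cap 1 =
  uscale N (cap ** wh 0 cap 2 ** wh 1 (S s) 1 ** wh 1 (S (~~ s)) 1).
Proof.
rewrite wh_comp // SSn whZ !ucompZr uscaleA divff // uscale1 -wh_comp //.
rewrite [wh 0 cap 2 ** _]ucompA.
have -> : wh 0 cap 2 ** wh 1 cup 1 = uid 2.
  rewrite -[wh 0 cap 2](wh_wh 0 0 cap 1 1) -[wh 1 cup 1](wh_wh 0 1 cup 0 1).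
  by rewrite wh_comp // snake_l wh_id.
by rewrite ucomp1l.
Qed.

Lemma S_ann s : wh 2 cap 0 ** wh 1 (S s) 1 ** wh 2 cup 0 = uid 2.
Proof.
rewrite -(sp02 s) -(sp20 s).
have F1 : wh 2 (sp s 2 0) 0 ** wh 1 (S s) 1 = wh 1 (sp s 3 1) 0.
  have := fuse_r s 1 2 0 1 (ltn0Sn 0) => /= E.
  rewrite -[wh 2 _ 0](wh_wh 1 1 (sp s 2 0) 0 0).
  by rewrite -[wh 1 (S s) 1](wh_wh 1 0 (S s) 1 0) wh_comp // E.
rewrite ucompA F1 -[wh 2 _ 0](wh_wh 1 1 (sp s 0 2) 0 0) wh_comp //.
have -> : sp s 3 1 ** wh 1 (sp s 0 2) 0 = uid 1.
  by rewrite -[sp s 3 1]wh00 -(sp11 s); exact: (fuse_l s 1 1 0 0 (ltn0Sn 1)).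
by rewrite wh_id.
Qed.

End Spiders.

(** * Temperley-Lieb actions on functionals *)

Section Span.
Variables (C : numClosedFieldType) (anti : bool) (N d : C).
Hypothesis N0 : N != 0.
Hypothesis starN : star anti N = N.
Hypothesis d2 : d ^+ 2 = N.
Local Notation um := (um anti N).
Local Notation uid := (uid anti N).
Local Notation H := (bhom anti N).
Local Notation sp := (sp anti N).
Local Notation "g '**' f" := (ucomp g f) (at level 45, right associativity).
Local Notation S s := (sp s 2 2).
Local Notation cup := (sp false 0 2).
Local Notation cap := (sp false 2 0).

Lemma d_neq0 : d != 0.
Proof. by move: N0; rewrite -d2 sqrf_eq0. Qed.

Lemma ddN : d * d * N^-1 = 1.
Proof. by rewrite -expr2 d2 divff. Qed.

Definition act n n' (u : um) (x : H n 0) : H n' 0 := typed n' 0 (Um x ** u).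

Lemma Um_act n n' u (x : H n 0) : udom u = n' -> Um (act n' u x) = Um x ** u.
Proof. by move=> e; rewrite Um_typed. Qed.

Lemma actD n n' u (x y : H n 0) : act n' u (x + y) = act n' u x + act n' u y.
Proof.
rewrite /act; case: (eqVneq (udom u) n') => [<-|ne]; last first.
  by rewrite !typed0 ?addr0 //= udim (negPf ne).
case: (eqVneq (ucod u) n) => [e|ne]; last first.
  by rewrite !ucomp_mis // !typedK addr0.
case: u e => -[k l] f /= e; have {e} : l = n by [].
move=> e; subst l; rewrite -[existT _ _ _]/(Um f).
by rewrite -!Um_comp !typedK bcompDl.
Qed.

Lemma actZ n n' u a (x : H n 0) : act n' u (a *: x) = a *: act n' u x.
Proof.
rewrite /act; case: (eqVneq (udom u) n') => [<-|ne]; last first.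
  by rewrite !typed0 ?scaler0 //= udim (negPf ne).
by rewrite Um_scale ucompZl /uscale /ucomp !typedK.
Qed.

(** The spider [s] on the strands [i] and [i.+1], normalized to a
    Temperley-Lieb generator. *)
Definition gen s n i (x : H n 0) : H n 0 := d *: act n (wh i (S s) (n - i - 2)) x.

Lemma wh_off i p (f : um) q j i' j' : (i + p = i')%N -> (q + j = j')%N ->
  wh i (wh p f q) j = wh i' f j'.
Proof. by move=> <- <-; rewrite wh_wh. Qed.

Lemma Um_gen s n i (x : H n 0) : (i.+1 < n)%N ->
  Um (gen s i x) = uscale d (Um x ** wh i (S s) (n - i - 2)).
Proof. by move=> hi; rewrite Um_scale Um_act // udom_wh udom_sp; lia. Qed.

Lemma genZ s n i a (x : H n 0) : gen s i (a *: x) = a *: gen s i x.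
Proof. by rewrite /gen actZ !scalerA mulrC. Qed.
Lemma genD s n i (x y : H n 0) : gen s i (x + y) = gen s i x + gen s i y.
Proof. by rewrite /gen actD scalerDr. Qed.

Lemma gen_gen s t n i j (x : H n 0) : (i.+1 < n)%N -> (j.+1 < n)%N ->
  Um (gen s i (gen t j x)) =
  uscale (d * d) (Um x ** wh j (S t) (n - j - 2) ** wh i (S s) (n - i - 2)).
Proof. by move=> hi hj; rewrite !Um_gen // ucompZl uscaleA -ucompA. Qed.

Lemma gen_idem s n i (x : H n 0) : (i.+1 < n)%N ->
  gen s i (gen s i x) = d *: gen s i x.
Proof.
move=> hi; apply: Um_inj; rewrite gen_gen // wh_comp // SS Um_scale Um_gen //.
by rewrite uscaleA.
Qed.

Lemma wh_far i j n (f g : um) : udom f = 2%N -> ucod f = 2%N ->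
  udom g = 2%N -> ucod g = 2%N -> (i.+1 < j)%N -> (j.+1 < n)%N ->
  wh i f (n - i - 2) ** wh j g (n - j - 2) =
  wh j g (n - j - 2) ** wh i f (n - i - 2).
Proof.
move=> df cf dg cg ij jn.
have := wh_comm i f g (j - i - 2) (n - j - 2); rewrite df cf dg cg.
have -> : (i + (2 + (j - i - 2)) = j)%N by lia.
by have -> : (j - i - 2 + (2 + (n - j - 2)) = n - i - 2)%N by lia.
Qed.

Lemma gen_far s t n i j (x : H n 0) : (i.+1 < j)%N -> (j.+1 < n)%N ->
  gen s i (gen t j x) = gen t j (gen s i x).
Proof.
move=> ij jn; apply: Um_inj; rewrite !gen_gen //; try lia.
by rewrite (@wh_far i j n).
Qed.

Lemma wh3l i n (f : um) : (i.+2 < n)%N ->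
  wh i f (n - i - 2) = wh i (wh 0 f 1) (n - i - 3).
Proof. by move=> h; apply/esym/wh_off; lia. Qed.
Lemma wh3r i n (f : um) : (i.+2 < n)%N ->
  wh i.+1 f (n - i.+1 - 2) = wh i (wh 1 f 0) (n - i - 3).
Proof. by move=> h; apply/esym/wh_off; lia. Qed.

Lemma gen_tl s n i (x : H n 0) : (i.+2 < n)%N ->
  gen s i (gen (~~ s) i.+1 (gen s i x)) = gen s i x.
Proof.
move=> hi; apply: Um_inj; rewrite Um_gen ?gen_gen ?Um_gen //; try lia.
rewrite !ucompZl uscaleA -!ucompA wh3r // wh3l // !wh_comp //.
rewrite wh_tl // whZ ucompZr uscaleA; congr (uscale _ _).
by rewrite -mulrA ddN mulr1.
Qed.

Lemma gen_tl' s n i (x : H n 0) : (i.+2 < n)%N ->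
  gen s i.+1 (gen (~~ s) i (gen s i.+1 x)) = gen s i.+1 x.
Proof.
move=> hi; apply: Um_inj; rewrite Um_gen ?gen_gen ?Um_gen //; try lia.
rewrite !ucompZl uscaleA -!ucompA wh3r // wh3l // !wh_comp //.
rewrite wh_tl' // whZ ucompZr uscaleA; congr (uscale _ _).
by rewrite -mulrA ddN mulr1.
Qed.

Lemma gen_shift s n i (x : H n 0) : (i.+2 < n)%N ->
  gen s i (gen s i.+1 x) = gen s i.+1 (gen s i x).
Proof.
move=> hi; apply: Um_inj; rewrite !gen_gen //; try lia.
by rewrite wh3r // wh3l // !wh_comp // S_shift.
Qed.

(** Both colours on the same two strands give a cup and a cap, without a
    scalar. *)
Lemma gen_same s n i (x : H n 0) : (i.+1 < n)%N ->
  Um (gen s i (gen (~~ s) i x)) = Um x ** wh i (cup ** cap) (n - i - 2).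
Proof.
move=> hi; rewrite gen_gen // wh_comp //.
have := SSn starN (~~ s); rewrite negbK => ->.
by rewrite whZ ucompZr uscaleA ddN uscale1.
Qed.

Lemma gen_comm_same s n i (x : H n 0) : (i.+1 < n)%N ->
  gen s i (gen (~~ s) i x) = gen (~~ s) i (gen s i x).
Proof.
move=> hi; apply: Um_inj; rewrite gen_same //.
by rewrite -{2}(negbK s) gen_same.
Qed.

(** The colour of the spider alternates with the position, so that
    neighbouring generators of one family have different colours and satisfy
    the Temperley-Lieb relation, while neighbouring generators of different
    families have equal colours and commute. *)
Definition tl c n i (x : H n 0) := gen (c (+) odd i) i x.

Lemma tlE c n i (x : H n 0) : tl c i x = gen (c (+) odd i) i x.
Proof. by []. Qed.
Lemma tlZ c n i a (x : H n 0) : tl c i (a *: x) = a *: tl c i x.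
Proof. exact: genZ. Qed.
Lemma tl_idem c n i (x : H n 0) : (i.+1 < n)%N ->
  tl c i (tl c i x) = d *: tl c i x.
Proof. exact: gen_idem. Qed.
Lemma tl_tl c n i (x : H n 0) : (i.+2 < n)%N ->
  tl c i (tl c i.+1 (tl c i x)) = tl c i x.
Proof. by rewrite /tl /= addbN; exact: gen_tl. Qed.
Lemma tl_tl' c n i (x : H n 0) : (i.+2 < n)%N ->
  tl c i.+1 (tl c i (tl c i.+1 x)) = tl c i.+1 x.
Proof.
by rewrite /tl /= addbN -{2}[c (+) odd i]negbK; exact: gen_tl'.
Qed.
Lemma tl_far c c' n i j (x : H n 0) : (i.+1 < j)%N -> (j.+1 < n)%N ->
  tl c i (tl c' j x) = tl c' j (tl c i x).
Proof. exact: gen_far. Qed.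
(** Neighbouring spiders of equal colour commute by fusion; on the same two
    strands both orders disconnect the strands. *)
Lemma tl_comm c n i j (x : H n 0) : (i.+1 < n)%N -> (j.+1 < n)%N ->
  tl c i (tl (~~ c) j x) = tl (~~ c) j (tl c i x).
Proof.
move=> hi hj; case: (ltngtP i j) => [ij|ji|->].
- have [ij1|ij1] := eqVneq j i.+1; last by rewrite tl_far //; lia.
  by subst j; rewrite /tl /= addbN addNb negbK gen_shift.
- have [ij1|ij1] := eqVneq i j.+1; last by rewrite (tl_far (~~ c)) //; lia.
  by subst i; rewrite /tl /= addbN addNb gen_shift.
- by rewrite /tl addNb gen_comm_same.
Qed.

(** The caps that join the strands [2 i] and [2 i + 1]. *)
Fixpoint ucaps m : um := if m is m'.+1 then ucaps m' ** wh 0 cap m'.*2 else uid 0.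

Lemma udom_ucaps m : udom (ucaps m) = m.*2.
Proof. by case: m. Qed.
Lemma ucod_ucaps m : ucod (ucaps m) = 0%N.
Proof. by elim: m => //= m IH; rewrite udim. Qed.

Definition caps n : H n 0 := typed n 0 (ucaps n./2).

Lemma Um_caps n : ~~ odd n -> Um (caps n) = ucaps n./2.
Proof.
by move=> on; rewrite Um_typed ?ucod_ucaps // udom_ucaps even_halfK.
Qed.

Lemma ucaps_S s i j m : ~~ odd i -> (i + (2 + j) = m.*2)%N ->
  ucaps m ** wh i (S s) j = ucaps m.
Proof.
elim: m i j => [|m IH] i j; first by lia.
case: i => [_ e|[//|i]] /=; last first.
  rewrite negbK => oi e; rewrite -ucompA.
  have := wh_comm 0 cap (S s) i j.
  rewrite !(udom_sp, ucod_sp) !add0n !addSn add0n.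
  have -> : (i + (2 + j) = m.*2)%N by lia.
  by move=> ->; rewrite ucompA IH //; lia.
have <- : j = m.*2 by lia.
by rewrite -ucompA wh_comp // capS.
Qed.

Lemma ucapsSr m : ucaps m.+1 = ucaps m ** wh m.*2 cap 0.
Proof.
elim: m => [|m IH]; first by [].
rewrite /= -/ucaps in IH *; rewrite {1}IH -!ucompA; congr (_ ** _).
have := wh_comm 0 cap cap m.*2 0.
by rewrite !(udom_sp, ucod_sp) !add0n !addn0 addnC /= addn2 => <-; rewrite doubleS.
Qed.

Lemma tl_caps c n i : ~~ odd n -> (i.+1 < n)%N -> ~~ odd i ->
  tl c i (caps n) = d *: caps n.
Proof.
move=> on hi oi; apply: Um_inj; rewrite Um_gen // Um_caps //.
rewrite ucaps_S //; last by rewrite even_halfK //; lia.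
by rewrite Um_scale Um_caps.
Qed.

Definition wvec c n w (x : H n 0) := eword (fun i => tl c i) w x.

(** The two words act by commuting generators, so their order does not
    matter. *)
Definition dd n (h1 h2 : seq bool) : H n 0 :=
  wvec false (dyckword 0 0 h1) (wvec true (dyckword 0 0 h2) (caps n)).

Lemma ddE n h1 h2 : dd n h1 h2 =
  wvec false (dyckword 0 0 h1) (wvec true (dyckword 0 0 h2) (caps n)).
Proof. by []. Qed.

Definition below n (w : seq nat) := all (fun k => k.+1 < n)%N w.

Lemma dyck_below n h : dyck 0 h -> size h = n -> below n (dyckword 0 0 h).
Proof.
by move=> dh sh; apply/allP => k /(dyckword_bound dh); lia.
Qed.

Lemma wvec_comm1 c n w i (x : H n 0) : below n w -> (i.+1 < n)%N ->
  tl c i (wvec (~~ c) w x) = wvec (~~ c) w (tl c i x).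
Proof.
by move=> hw hi; elim: w hw => //= k w IH /andP[hk hw]; rewrite tl_comm // IH.
Qed.

Lemma wvec_comm c n w w' (x : H n 0) : below n w -> below n w' ->
  wvec c w (wvec (~~ c) w' x) = wvec (~~ c) w' (wvec c w x).
Proof.
move=> + hw'; elim: w => //= i w IH /andP[hi hw].
by rewrite -wvec_comm1 // IH.
Qed.

Lemma wvecZ c n w a (x : H n 0) : wvec c w (a *: x) = a *: wvec c w x.
Proof. by rewrite /wvec ewordZ // => *; exact: tlZ. Qed.

Lemma tl_nf c n v h i : ~~ odd n ->
  (forall k, (k.+1 < n)%N -> ~~ odd k -> tl c k v = d *: v) ->
  dyck 0 h -> size h = n -> (i.+1 < n)%N ->
  exists a h', [/\ dyck 0 h', size h' = n &
    tl c i (wvec c (dyckword 0 0 h) v) = a *: wvec c (dyckword 0 0 h') v :> H n 0].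
Proof.
move=> on hv dh sh hi; have en := even_halfK on.
have := @nf_step _ _ d n./2 (fun i => tl c (n := n) i) d_neq0.
rewrite en => T; case: (T _ _ _ _ _ v _ h i) => // [*|*|*|*|*|a [h' [? ? ?]]].
- exact: tlZ.
- exact: tl_idem.
- exact: tl_tl.
- exact: tl_tl'.
- exact: tl_far.
- by exists a, h'.
Qed.

(** A generator of either family changes only the path of that family. *)
Lemma dd_stable c n h1 h2 i : ~~ odd n ->
  dyck 0 h1 -> size h1 = n -> dyck 0 h2 -> size h2 = n -> (i.+1 < n)%N ->
  exists a g1 g2, [/\ dyck 0 g1 /\ size g1 = n, dyck 0 g2 /\ size g2 = n &
    tl c i (dd n h1 h2) = a *: dd n g1 g2].
Proof.
move=> on dh1 sh1 dh2 sh2 hi.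
have b1 := dyck_below dh1 sh1; have b2 := dyck_below dh2 sh2.
case: c.
  rewrite /dd (@wvec_comm1 true) //.
  have [k *|a [h' [dh' sh' ->]]] := tl_nf (c := true) (v := caps n) on _ dh2 sh2 hi.
    exact: tl_caps.
  by exists a, h1, h'; split=> //; rewrite wvecZ.
have [k *|a [h' [dh' sh' E]]] := tl_nf (c := false)
    (v := wvec true (dyckword 0 0 h2) (caps n)) on _ dh1 sh1 hi.
  by rewrite (@wvec_comm1 false) // tl_caps // wvecZ.
by exists a, h', h2; split.
Qed.

Lemma caps_dd n : ~~ odd n -> caps n = dd n (zigzag n./2) (zigzag n./2).
Proof. by rewrite /dd dyckword_zigzag. Qed.

(** Words in the even spiders applied to the non-nested caps. *)
Inductive umono : um -> Prop :=
| umono_caps m : umono (ucaps m)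
| umono_S s i j u : umono u -> udom u = (i + (2 + j))%N ->
    umono (u ** wh i (S s) j)
| umono_scale a u : umono u -> umono (uscale a u).

Lemma umono_dim u : umono u -> ucod u = 0%N /\ ~~ odd (udom u).
Proof.
elim=> [m|s i j {}u _ [cu ou] du|a {}u _ []] //.
- by rewrite ucod_ucaps udom_ucaps odd_double.
- by rewrite udom_comp udom_wh udom_sp -du.
Qed.

(** Each generator that is applied to a functional of two Dyck paths gives a
    multiple of such a functional. *)
Lemma umono_nf u : umono u -> exists a h1 h2,
  [/\ dyck 0 h1 /\ size h1 = udom u, dyck 0 h2 /\ size h2 = udom u &
    u = uscale a (Um (dd (udom u) h1 h2))].
Proof.
elim=> [m|s i j {}u mu [a [h1 [h2 [[dh1 sh1] [dh2 sh2] E]]]] du|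
        b {}u _ [a [h1 [h2 [[dh1 sh1] [dh2 sh2] E]]]]].
- exists 1, (zigzag m), (zigzag m).
  rewrite dyck_zigzag size_zigzag udom_ucaps; split=> //.
  have -> : dd m.*2 (zigzag m) (zigzag m) = caps m.*2.
    by rewrite caps_dd ?odd_double // doubleK.
  by rewrite uscale1 Um_caps ?odd_double // doubleK.
- have [_ ou] := umono_dim mu.
  have hi : (i.+1 < udom u)%N by lia.
  have [b [g1 [g2 [hg1 hg2 Eg]]]] :=
    dd_stable (s (+) odd i) ou dh1 sh1 dh2 sh2 hi.
  have dv : udom (u ** wh i (S s) j) = udom u by rewrite udom_comp udom_wh udom_sp -du.
  exists (a * d^-1 * b), g1, g2; rewrite dv; split=> //.
  rewrite -uscaleA -Um_scale -Eg /tl -addbA addbb addbF Um_gen //.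
  rewrite uscaleA -mulrA mulVf ?d_neq0 // mulr1.
  have -> : (udom u - i - 2 = j)%N by lia.
  by rewrite {1}E ucompZl.
- by exists (b * a), h1, h2; rewrite -uscaleA -E.
Qed.

End Span.

(** * The even functionals are spanned by Dyck paths *)

Section Spanning.
Variables (C : numClosedFieldType) (anti : bool) (N d : C).
Hypothesis N0 : N != 0.
Hypothesis starN : star anti N = N.
Hypothesis d2 : d ^+ 2 = N.
Local Notation um := (um anti N).
Local Notation uid := (uid anti N).
Local Notation H := (bhom anti N).
Local Notation sp := (sp anti N).
Local Notation "g '**' f" := (ucomp g f) (at level 45, right associativity).
Local Notation S s := (sp s 2 2).
Local Notation cup := (sp false 0 2).
Local Notation cap := (sp false 2 0).
Local Notation ucaps := (ucaps anti N).
Local Notation umono := (@umono C anti N).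

Lemma umono_cap0 u : umono u -> umono (u ** wh 0 cap (udom u)).
Proof.
elim=> [m|s i j {}u mu IH du|a {}u mu IH].
- by rewrite udom_ucaps; exact: (umono_caps _ _ m.+1).
- rewrite udom_comp udom_wh udom_sp -ucompA.
  have := wh_comm 0 cap (S s) i j; rewrite !(udom_sp, ucod_sp) !add0n => <-.
  by rewrite ucompA -du; apply: umono_S => //; rewrite udom_comp udom_wh du udom_sp.
- by rewrite ucompZl; apply: umono_scale.
Qed.

(** By induction on the word, a new cap is moved past the spiders until it
    stands next to the caps or between the legs of a spider; nested caps and
    split spiders are again words. *)
Lemma umono_cap u i j : umono u -> udom u = (i + j)%N ->
  umono (u ** wh i cap j).
Proof.
move=> mu; elim: mu i j => [m|s i j {}u mu IH du|a {}u mu IH] p q.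
- elim: m p q => [|m IH] [|[|p]] q; rewrite udom_ucaps ?doubleS => e.
  + by case: q e => // _; exact: (umono_caps _ _ 1).
  + by [].
  + by [].
  + have -> : q = m.+1.*2 by lia.
    by exact: (umono_caps _ _ m.+2).
  + have -> : q = (1 + m.*2)%N by lia.
    rewrite /= -ucompA -[wh 1 cap _](wh_wh 0 1 cap 1 m.*2) wh_comp //.
    rewrite (nested_cap N0 starN false) whZ ucompZr; apply: umono_scale.
    rewrite -!wh_comp // !wh_wh !ucompA.
    have M : umono (ucaps m.+2) by exact: umono_caps.
    apply: umono_S; last by rewrite udom_comp udom_wh udom_sp.
    apply: umono_S; last by rewrite udom_comp udom_wh udom_sp; lia.
    by exact: M.
  + have := wh_comm 0 cap cap p q; rewrite !(udom_sp, ucod_sp) !add0n => E.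
    have e' : (m.*2 = p + q)%N by lia.
    rewrite /= -ucompA e' E ucompA.
    have := IH p q; rewrite udom_ucaps e' => /(_ erefl) /umono_cap0.
    by rewrite udom_comp udom_wh udom_sp.
- rewrite udom_comp udom_wh udom_sp => e; rewrite -ucompA.
  case: (leqP p i) => pi.
    have := wh_comm p cap (S s) (i - p) j; rewrite !(udom_sp, ucod_sp) !add0n.
    rewrite subnKC //.
    have -> : (i - p + (2 + j) = q)%N by lia.
    move=> <-; rewrite ucompA; apply: umono_S; last first.
      by rewrite udom_comp udom_wh udom_sp; lia.
    by apply: IH; lia.
  have [Ep|np] := eqVneq p i.+1.
    have -> : q = (1 + j)%N by lia.
    have -> : wh p cap (1 + j) = wh i (wh 1 cap 1) j by rewrite wh_wh addn1 Ep.
    rewrite wh_comp //.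
    have -> : S s ** wh 1 cap 1 = uscale N (wh 1 cap 1 ** wh 2 (S s) 0 **
        wh 0 (S s) 2 ** wh 1 (S (~~ s)) 1).
      by rewrite (S_cap_split starN) uscaleA divff // uscale1.
    rewrite whZ ucompZr; apply: umono_scale.
    rewrite -!wh_comp // !wh_wh !ucompA.
    apply: umono_S; last by rewrite !udom_comp udom_wh udom_sp; lia.
    apply: umono_S; last by rewrite !udom_comp udom_wh udom_sp; lia.
    apply: umono_S; last by rewrite !udom_comp udom_wh udom_sp; lia.
    by apply: IH; lia.
  have := wh_comm i (S s) cap (p - i - 2) q; rewrite !(udom_sp, ucod_sp) !add0n.
  have -> : (i + (2 + (p - i - 2)) = p)%N by lia.
  have -> : (p - i - 2 + q = j)%N by lia.
  move=> ->; rewrite ucompA; apply: umono_S.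
    by apply: IH; lia.
  by rewrite udom_comp udom_wh udom_sp; lia.
- by move=> e; rewrite ucompZl; apply: umono_scale; apply: IH.
Qed.


Section Annihilation.
Variable n : nat.
Hypothesis on : ~~ odd n.

Definition annop (x : H n.+2 0) : H n 0 := act n (wh n cup 0) x.

Lemma annop_gen s k (x : H n.+2 0) : (k.+1 < n)%N ->
  annop (gen d s k x) = gen d s k (annop x).
Proof.
move=> hk; apply: Um_inj; rewrite Um_act ?udom_wh ?udom_sp ?Um_gen //; try lia.
rewrite ?Um_act ?udom_wh ?udom_sp ?ucompZl //; try lia.
have := wh_comm k (S s) cup (n - k - 2) 0; rewrite !(udom_sp, ucod_sp) !add0n.
have -> : (k + (2 + (n - k - 2)) = n)%N by lia.
have -> : (n - k - 2 + (2 + 0) = n.+2 - k - 2)%N by lia.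
by rewrite addn0 -!ucompA => ->.
Qed.

Lemma annop_wvec c w (x : H n.+2 0) : below n w ->
  annop (wvec d c w x) = wvec d c w (annop x).
Proof. by elim: w => //= k w IH /andP[hk hw]; rewrite annop_gen // IH. Qed.

Lemma umono_gen s k (x : H n 0) : (k.+1 < n)%N -> umono (Um x) ->
  umono (Um (gen d s k x)).
Proof.
move=> hk mx; rewrite Um_gen //; apply/umono_scale/umono_S => //.
by rewrite /udom /=; lia.
Qed.

Lemma umono_wvec c w (x : H n 0) : below n w -> umono (Um x) ->
  umono (Um (wvec d c w x)).
Proof. by elim: w => //= k w IH /andP[hk hw] mx; apply: umono_gen => //; exact: IH. Qed.

Lemma ucapsSr2 m : ucaps m.+2 = ucaps m ** wh m.*2 (cap ** wh 2 cap 0) 0.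
Proof.
rewrite ucapsSr ucapsSr -ucompA -wh_comp // wh_wh.
by rewrite doubleS addn2.
Qed.

(** What remains of the words is at most one letter of each family, which
    touches the annihilated strands. In each of the four cases the result is a
    multiple of the remaining caps. *)
Lemma annop_base (b b' : bool) : (b || b' -> 0 < n)%N ->
  umono (Um (annop (wvec d false (nseq b n.-1)
                    (wvec d true (nseq b' n.-1) (caps anti N n.+2))))).
Proof.
have en := even_halfK on.
have on2 : ~~ odd n.+2 by rewrite /= negbK.
have dw : udom (wh n cup 0) = n by rewrite udom_wh udom_sp !addn0.
have M : umono (ucaps n./2) by exact: umono_caps.
case: (posnP n) => [n0|npos].
  move=> h; have [-> ->] : b = false /\ b' = false.
    by case: b b' h => [] [] // /(_ isT).
  rewrite Um_act // Um_caps // -[n.+2./2]/(n./2.+1) ucapsSr en -ucompA wh_comp // capcup whZ.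
  rewrite ucompZr wh_id ucomp1r; first exact: umono_scale.
  by rewrite udom_ucaps en.
move=> _.
have [m En] : exists m, n./2 = m.+1 by exists n./2.-1; lia.
have en1 : n.-1 = (m.*2 + 1)%N by rewrite -en En; lia.
have en2 : n = (m.*2 + 2)%N by rewrite -en En; lia.
have uc : Um (caps anti N n.+2) = ucaps m ** wh m.*2 (cap ** wh 2 cap 0) 0.
  by rewrite Um_caps // -ucapsSr2 -En.
have wc : wh n cup 0 = wh m.*2 (wh 2 cup 0) 0 by rewrite en2 wh_wh.
have capE : ucaps m ** wh m.*2 cap 0 = ucaps n./2 by rewrite En -ucapsSr.
have n1 : (n.-1.+1 < n.+2)%N by lia.
have E1 : (n.+2 - n.-1 - 2 = 1)%N by lia.
have one s : umono (Um (annop (gen d s n.-1 (caps anti N n.+2)))).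
  rewrite Um_act // Um_gen // ucompZl; apply: umono_scale.
  rewrite uc wc E1 en1 -(wh_wh m.*2 1 (S s) 1 0) -!ucompA !wh_comp //.
  by rewrite -!ucompA S_ann ucomp1r // capE.
case: b; case: b' => /=.
- rewrite Um_act // /tl /= (gen_same N0 starN d2) //.
  rewrite uc wc E1 en1 -(wh_wh m.*2 1 (cup ** cap) 1 0) -!ucompA !wh_comp //.
  rewrite -(@wh_comp _ _ _ 1 cup cap 1) // -!ucompA.
  have -> : wh 1 cap 1 ** wh 2 cup 0 = uid 2.
    rewrite -[wh 1 cap 1](wh_wh 1 0 cap 1 0) -[wh 2 cup 0](wh_wh 1 1 cup 0 0).
    by rewrite wh_comp // snake_l wh_id.
  have -> : wh 2 cap 0 ** wh 1 cup 1 ** uid 2 = uid 2.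
    rewrite -[wh 2 cap 0](wh_wh 1 1 cap 0 0) -[wh 1 cup 1](wh_wh 1 0 cup 1 0).
    by rewrite ucompA wh_comp // snake_r wh_id ucomp1l.
  by rewrite ucomp1r // capE.
- exact: one.
- exact: one.
- rewrite Um_act // Um_caps // -[n.+2./2]/(n./2.+1) ucapsSr en -ucompA wh_comp // capcup whZ.
  rewrite ucompZr wh_id ucomp1r; first exact: umono_scale.
  by rewrite udom_ucaps en.
Qed.

Lemma wvec_cat c k w1 w2 (x : H k 0) :
  wvec d c (w1 ++ w2) x = wvec d c w1 (wvec d c w2 x).
Proof. exact: eword_cat. Qed.

Lemma wvec_same_comm c w (b : bool) (x : H n.+2 0) :
  all (fun k => k.+2 < n)%N w -> (b -> 0 < n)%N ->
  wvec d c (nseq b n.-1) (wvec d c w x) = wvec d c w (wvec d c (nseq b n.-1) x).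
Proof.
case: b => // + /(_ isT) n0; elim: w => //= k w IH /andP[hk hw].
by rewrite -IH //= [RHS](tl_far d N0 c c) //; lia.
Qed.

(** Only the largest letter of each word, which occurs at most once, touches
    the last two strands; all others commute with their annihilation. *)
Lemma umono_annop h1 h2 :
  dyck 0 h1 -> size h1 = n.+2 -> dyck 0 h2 -> size h2 = n.+2 ->
  umono (Um (annop (dd anti N d n.+2 h1 h2))).
Proof.
move=> dh1 sh1 dh2 sh2.
have [w [b [w' [E1 bw bw' bn]]]] := dyckword_last dh1 sh1.
have [v [b' [v' [E2 bv bv' bn']]]] := dyckword_last dh2 sh2.
have weak u : all (fun k => k.+2 < n)%N u -> below n u.
  by move=> /allP h; apply/allP => k /h/ltnW.
have weak2 u : below n u -> below n.+2 u.
  by move=> /allP h; apply/allP => k /h/leqW/leqW.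
have bnseq (e : bool) : (e -> 0 < n)%N -> below n.+2 (nseq e n.-1).
  by case: e => // /(_ isT) n0; rewrite /below /= andbT prednK.
rewrite /dd E1 E2 !wvec_cat.
rewrite annop_wvec //; apply: umono_wvec => //.
rewrite (@wvec_same_comm false w' b) // annop_wvec ?weak //; apply: umono_wvec; first exact: weak.
rewrite (wvec_comm N0 starN d2 false) ?bnseq ?weak2 //.
rewrite annop_wvec //; apply: umono_wvec => //.
rewrite (@wvec_same_comm true v' b') //.
rewrite (wvec_comm N0 starN d2 false) ?bnseq ?weak2 ?weak //.
rewrite annop_wvec ?weak //; apply: umono_wvec; first exact: weak.
by apply: annop_base; case/orP.
Qed.
End Annihilation.

Lemma umono_cup_last u n : umono u -> udom u = n.+2 -> umono (u ** wh n cup 0).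
Proof.
move=> mu du; have [_ ou] := umono_dim mu.
have [a [h1 [h2 [[dh1 sh1] [dh2 sh2] E]]]] := umono_nf N0 starN d2 mu.
move: du ou dh1 sh1 dh2 sh2 E; move: (udom u) => k -> ou dh1 sh1 dh2 sh2 ->.
rewrite ucompZl -(@Um_act _ _ _ _ n) ?udom_wh ?udom_sp ?addn0 ?addn0 //.
apply: umono_scale.
by apply: umono_annop => //; move: ou; rewrite /= negbK.
Qed.

(** A cup that is not in the last position is moved to the right, at the price
    of a cup-cap, which is a product of the two spiders. *)
Lemma umono_cup u i j : umono u -> udom u = (i + (2 + j))%N ->
  umono (u ** wh i cup j).
Proof.
elim: j u i => [|j IH] u i mu du.
  by apply: umono_cup_last; rewrite // du; lia.
have E : wh i cup j.+1 = wh i (cup ** cap) j.+1 ** wh i.+1 cup j.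
  have e2 : wh i.+1 cup j = wh i (wh 1 cup 0) j by rewrite wh_wh addn1.
  have e3 f : wh i f j.+1 = wh i (wh 0 f 1) j by rewrite wh_wh addn0.
  rewrite e2 !e3 wh_comp // -(@wh_comp _ _ _ 0 cup cap 1) // -ucompA.
  by rewrite snake_l ucomp1r.
rewrite E ucompA; apply: IH; last by rewrite !(udom_comp, udom_wh) udom_sp; lia.
have -> : cup ** cap = uscale N (S false ** S true).
  by rewrite (SSn starN false) uscaleA divff // uscale1.
rewrite whZ ucompZr -wh_comp // ucompA; apply: umono_scale.
apply: umono_S; last by rewrite udom_comp udom_wh udom_sp.
by apply: umono_S.
Qed.


(** Linear combinations of words in the even spiders on the non-nested caps. *)
Inductive spanned n : H n 0 -> Prop :=
| spanned0 : spanned 0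
| spannedD x y : umono (Um x) -> spanned y -> spanned (x + y).

Lemma spanned_um n n' (x : H n 0) (y : H n' 0) : Um x = Um y -> spanned x -> spanned y.
Proof.
move=> E; have en : n = n' by have := congr1 (@udom _ _ _) E.
by case: _ / en y E => y /Um_inj ->.
Qed.

Definition bwh p k l q (f : H k l) : H (p + (k + q)) (p + (l + q)) :=
  btens (bid anti N p) (btens f (bid anti N q)).

Lemma Um_bwh p k l q (f : H k l) : Um (bwh p q f) = wh p (Um f) q.
Proof. by []. Qed.

(** Whiskering is built in so that stability passes to tensor products. *)
Definition stable k l (f : H k l) := forall p q (x : H (p + (l + q)) 0),
  spanned x -> spanned (bcomp x (bwh p q f)).

Lemma spanned_add n (x y : H n 0) : spanned x -> spanned y -> spanned (x + y).
Proof.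
elim=> [|x1 y1 m1 s1 IH] sy; first by rewrite add0r.
by rewrite -addrA; apply: spannedD => //; apply: IH.
Qed.

Lemma spanned_scale n a (x : H n 0) : spanned x -> spanned (a *: x).
Proof.
elim=> [|x1 y1 m1 s1 IH]; first by rewrite scaler0; exact: spanned0.
by rewrite scalerDr; apply: spannedD => //; rewrite Um_scale; apply: umono_scale.
Qed.

Lemma stable_umono k l (f : H k l) :
  (forall p q u, umono u -> udom u = (p + (l + q))%N -> umono (u ** wh p (Um f) q)) ->
  stable f.
Proof.
move=> hf p q x; elim=> [|x1 y1 m1 s1 IH]; first by rewrite bcomp0l; exact: spanned0.
rewrite bcompDl; apply: spannedD => //; rewrite Um_comp Um_bwh.
exact: hf.
Qed.

Lemma stable_id k : stable (bid anti N k).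
Proof.
move=> p q x; apply: spanned_um; rewrite Um_comp Um_bwh wh_id ucomp1r //.
Qed.

Lemma stable_comp k l m (g : H l m) (f : H k l) :
  stable g -> stable f -> stable (bcomp g f).
Proof.
move=> sg sf p q x sx; have := sf p q _ (sg p q x sx); apply: spanned_um.
by rewrite !Um_comp !Um_bwh -ucompA wh_comp // -Um_comp.
Qed.

Lemma stable_tens k l k' l' (f : H k l) (g : H k' l') :
  stable f -> stable g -> stable (btens f g).
Proof.
move=> sf sg p q x sx.
have e1 : (p + (l + l' + q) = p + (l + (l' + q)))%N by rewrite !addnA.
have e2 : (p + (k + (l' + q)) = (p + k) + (l' + q))%N by rewrite !addnA.
have s1 : spanned (hcast H e1 erefl x) by apply: spanned_um sx; rewrite Um_hcast.
have s2 := sf _ _ _ s1.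
have s3 : spanned (hcast H e2 erefl (bcomp (hcast H e1 erefl x) (bwh p (l' + q) f))).
  by apply: spanned_um s2; rewrite Um_hcast.
have := sg _ _ _ s3; apply: spanned_um.
rewrite !Um_comp !Um_hcast !Um_comp !Um_hcast !Um_bwh -ucompA; congr (_ ** _).
have -> : Um (btens f g) = wh 0 (Um f) l' ** wh k (Um g) 0.
  by rewrite /wh utens1l utens1r utens_comp ?udim // ucomp1l ?ucomp1r.
by rewrite -wh_comp ?ucod_wh ?udom_wh ?addn0 // !wh_wh addn0.
Qed.

Lemma stable0 k l : stable (0 : H k l).
Proof. by move=> p q x sx; rewrite /bwh btens0l btens0r bcomp0r; exact: spanned0. Qed.

Lemma stable_lin k l a (f g : H k l) : stable f -> stable g -> stable (a *: f + g).
Proof.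
move=> sf sg p q x sx.
have -> : bwh p q (a *: f + g) = a *: bwh p q f + bwh p q g.
  by rewrite /bwh btensDl btensZl btensDr btensZr.
rewrite bcompDr bcompZr; apply: spanned_add; last exact: sg.
by apply: spanned_scale; exact: sf.
Qed.

(** Both a morphism and its dagger are treated at once, since the even
    morphisms are closed under the dagger. *)
Lemma even_stable k l (f : H k l) : even_mor f -> stable f /\ stable (bdag f).
Proof.
elim=> {k l f}.
- by move=> k; split; rewrite ?bdag_id; exact: stable_id.
- split; first by apply: stable_umono => *; exact: umono_S.
  rewrite bdag_pi; apply: stable_umono => *; exact: umono_S.
- split; first by apply: stable_umono => *; exact: umono_S.
  rewrite bdag_pi; apply: stable_umono => *; exact: umono_S.
- split; first by apply: stable_umono => *; exact: umono_cap.
  rewrite bdag_pi; apply: stable_umono => *; exact: umono_cup.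
- move=> k l m g f _ [sg sg'] _ [sf sf']; split; first exact: stable_comp.
  by rewrite bdag_comp; exact: stable_comp.
- move=> k l k' l' f g _ [sf sf'] _ [sg sg']; split; first exact: stable_tens.
  by rewrite bdag_tens; exact: stable_tens.
- by move=> k l; rewrite bdag0; split; exact: stable0.
- move=> k l a f g _ [sf sf'] _ [sg sg']; split; first exact: stable_lin.
  by rewrite bdagD bdagZ; exact: stable_lin.
- by move=> k l f _ [sf sf']; split; rewrite ?bdagK.
Qed.

Lemma even_spanned n (f : H n 0) : even_mor f -> spanned f.
Proof.
move=> /even_stable [sf _].
have s0 : spanned (bid anti N (0 + (0 + 0))).
  rewrite -[bid _ _ _]addr0; apply: spannedD; last exact: spanned0.
  exact: (umono_caps _ _ 0).
have := sf 0 0 _ s0; apply: spanned_um.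
by rewrite Um_comp Um_bwh wh00 ucomp1l.
Qed.

(** Words in spiders on non-nested caps are multiples of the functionals of
    Dyck paths, and even morphisms preserve combinations of such words. *)
Lemma even_expand n (f : H n 0) : even_mor f ->
  exists c : n.-tuple bool * n.-tuple bool -> C,
    f = \sum_(p : n.-tuple bool * n.-tuple bool | dyck 0 p.1 && dyck 0 p.2) c p *: dd anti N d n p.1 p.2.
Proof.
move=> /even_spanned; elim=> [|x y mx _ [c ->]].
  by exists (fun=> 0); rewrite big1 // => p _; rewrite scale0r.
have [a [h1 [h2 [[dh1 s1] [dh2 s2] E]]]] := umono_nf N0 starN d2 mx.
have {}E : x = a *: dd anti N d n h1 h2 by apply: Um_inj; rewrite Um_scale -E.
have /eqP s1' := s1; have /eqP s2' := s2.
exists (fun p => c p + (p == (Tuple s1', Tuple s2'))%:R * a).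
under [RHS]eq_bigr do rewrite scalerDl.
rewrite big_split /= addrC; congr (_ + _).
rewrite (bigD1 (Tuple s1', Tuple s2')) /=; last by rewrite dh1 dh2.
rewrite eqxx mul1r big1 ?addr0 // => p /andP[_ /negPf ->].
by rewrite mul0r scale0r.
Qed.

End Spanning.

(** * Bending strands *)

Section Bend.
Variables (C : numClosedFieldType) (anti : bool) (N : C).
Local Notation um := (um anti N).
Local Notation uid := (uid anti N).
Local Notation H := (bhom anti N).
Local Notation sp := (sp anti N).
Local Notation "g '**' f" := (ucomp g f) (at level 45, right associativity).
Local Notation S s := (sp s 2 2).
Local Notation cup := (sp false 0 2).
Local Notation cap := (sp false 2 0).

Definition ueven (u : um) := even_mor (umor u).

Lemma even_hcast k l k' l' (ek : k = k') (el : l = l') (f : H k l) :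
  even_mor f -> even_mor (hcast H ek el f).
Proof. by case: _ / ek; case: _ / el. Qed.

Lemma even_typed k l u : ueven u -> even_mor (typed k l u).
Proof.
move=> eu; rewrite /typed; case: eqVneq => [e1|_]; last exact: even_zero.
by case: eqVneq => [e2|_]; [exact: even_hcast|exact: even_zero].
Qed.

Lemma ueven_comp g f : ueven g -> ueven f -> ueven (g ** f).
Proof. by move=> eg ef; apply: even_comp => //; exact: even_typed. Qed.
Lemma ueven_tens g f : ueven g -> ueven f -> ueven (utens g f).
Proof. exact: even_tens. Qed.
Lemma ueven_id k : ueven (uid k). Proof. exact: even_id. Qed.
Lemma ueven_wh i f j : ueven f -> ueven (wh i f j).
Proof. by move=> ef; do !apply: ueven_tens => //; exact: ueven_id. Qed.
Lemma ueven_S s : ueven (S s).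
Proof. by case: s; [exact: even_w22|exact: even_b22]. Qed.
Lemma ueven_cap : ueven cap. Proof. exact: even_b20. Qed.
Lemma ueven_cup : ueven cup.
Proof. by rewrite -(sp_dag _ _ false 2 0); apply: even_dag; exact: even_b20. Qed.
Lemma even_scale k l a (f : H k l) : even_mor f -> even_mor (a *: f).
Proof. by move=> ef; rewrite -[_ *: _]addr0; apply: even_lin => //; exact: even_zero. Qed.
Lemma even_add k l (f g : H k l) : even_mor f -> even_mor g -> even_mor (f + g).
Proof. by move=> ef eg; rewrite -[f]scale1r; apply: even_lin. Qed.

Lemma even_tl d c n i (x : H n 0) : even_mor x -> even_mor (tl d c i x).
Proof.
move=> ex; apply: even_scale; apply: even_typed; apply: ueven_comp => //.
by apply: ueven_wh; exact: ueven_S.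
Qed.

Lemma even_dd d n h1 h2 : even_mor (dd anti N d n h1 h2).
Proof.
have ec m : ueven (ucaps anti N m).
  elim: m => [|m IH] /=; first exact: ueven_id.
  by apply: ueven_comp => //; apply: ueven_wh; exact: ueven_cap.
have ew c w x : even_mor x -> even_mor (wvec d c w x : H n 0).
  by move=> ex; elim: w => //= k w IH; exact: even_tl.
by apply/ew/ew/even_typed.
Qed.

Definition bend k l (f : H k l.+1) : H k.+1 l :=
  typed k.+1 l (wh l cap 0 ** wh 0 (Um f) 1).
Definition unbend k l (g : H k.+1 l) : H k l.+1 :=
  typed k l.+1 (wh 0 (Um g) 1 ** wh k cup 0).

Lemma even_bend k l (f : H k l.+1) : even_mor f -> even_mor (bend f).
Proof.
move=> ef; apply: even_typed; apply: ueven_comp; first exact/ueven_wh/ueven_cap.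
exact: ueven_wh.
Qed.
Lemma even_unbend k l (f : H k.+1 l) : even_mor f -> even_mor (unbend f).
Proof.
move=> ef; apply: even_typed; apply: ueven_comp; last exact/ueven_wh/ueven_cup.
exact: ueven_wh.
Qed.

Lemma Um_bend k l (f : H k l.+1) : Um (bend f) = wh l cap 0 ** wh 0 (Um f) 1.
Proof.
rewrite Um_typed // ?udom_comp ?ucod_comp ?udom_wh ?ucod_wh ?udom_sp ?ucod_sp.
  by rewrite add0n addn1.
by rewrite !addn0.
Qed.
Lemma Um_unbend k l (g : H k.+1 l) : Um (unbend g) = wh 0 (Um g) 1 ** wh k cup 0.
Proof.
rewrite Um_typed // ?udom_comp ?ucod_comp ?udom_wh ?ucod_wh ?udom_sp ?ucod_sp.
  by rewrite !addn0.
by rewrite add0n addn1.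
Qed.

(** This is the snake identity. *)
Lemma bendK k l (f : H k l.+1) : unbend (bend f) = f.
Proof.
apply: Um_inj; rewrite Um_unbend Um_bend.
rewrite -wh_comp ?ucod_wh ?udom_wh ?udom_sp ?add0n ?addn2 ?addn1 //.
rewrite !wh_wh -ucompA !addn0 /=.
have := wh_comm 0 (Um f) cup 0 0; rewrite !(udom_sp, ucod_sp) !add0n !addn0.
have -> : udom (Um f) = k by [].
have -> : ucod (Um f) = l.+1 by [].
move=> ->; rewrite ucompA.
have -> : wh l.+1 cup 0 = wh l (wh 1 cup 0) 0 by rewrite wh_wh addn1.
have -> : wh l cap 1 = wh l (wh 0 cap 1) 0 by rewrite wh_wh addn0.
by rewrite wh_comp // snake_l wh_id wh00 ucomp1l //= addn0 addn1.
Qed.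

Lemma typed_compD k l a b (x y : H a b) (u : um) :
  typed k l (Um (x + y) ** u) = typed k l (Um x ** u) + typed k l (Um y ** u).
Proof.
case: (eqVneq (udom u) k) => [<-|ne]; last first.
  by rewrite !typed0 ?addr0 //= udim (negPf ne).
case: (eqVneq b l) => [<-|ne]; last first.
  by rewrite !typed0 ?addr0 //= !udim (negPf ne) andbF.
case: (eqVneq (ucod u) a) => [e|ne]; last first.
  by rewrite !ucomp_mis // !typedK addr0.
case: u e => -[k1 l1] f /= e; have {e} : l1 = a by [].
move=> e; subst l1; rewrite -[existT _ _ _]/(Um f).
by rewrite -!Um_comp !typedK bcompDl.
Qed.

Lemma typedZ k l a (u : um) : typed k l (uscale a u) = a *: typed k l u.
Proof.
case: u => -[k' l'] f; rewrite -[existT _ _ _]/(Um f) -Um_scale.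
case: (eqVneq k' k) => [<-|ne]; last by rewrite !typed0 ?scaler0 //= (negPf ne).
case: (eqVneq l' l) => [<-|ne]; last by rewrite !typed0 ?scaler0 //= (negPf ne) andbF.
by rewrite !typedK.
Qed.

Lemma unbendD k l (f g : H k.+1 l) : unbend (f + g) = unbend f + unbend g :> H k l.+1.
Proof.
have E (h : H k.+1 l) : wh 0 (Um h) 1 = Um (bwh 0 1 h) by [].
rewrite /unbend !E -typed_compD; congr (typed _ _ (Um _ ** _)).
by rewrite /bwh btensDl btensDr.
Qed.

Lemma unbendZ k l a (f : H k.+1 l) : unbend (a *: f) = a *: unbend f.
Proof. by rewrite /unbend Um_scale whZ ucompZl typedZ. Qed.

Lemma unbend0 k l : unbend (0 : H k.+1 l) = 0 :> H k l.+1.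
Proof. by rewrite -(scale0r (0 : H k.+1 l)) unbendZ scale0r. Qed.
End Bend.

(** * Sums over words *)

Section SumLists.
Variable T : finType.
Implicit Types (n : nat) (F G : seq T -> nat).

Fixpoint sumL n F : nat :=
  if n is n'.+1 then (\sum_(x : T) sumL n' (fun s => F (x :: s)))%N else F [::].

Lemma sumLS n F :
  sumL n.+1 F = (\sum_(x : T) sumL n (fun s => F (x :: s)))%N.
Proof. by []. Qed.

Lemma sumL_ext n F G : (forall s, size s = n -> F s = G s) -> sumL n F = sumL n G.
Proof.
elim: n F G => [|n IH] F G E /=; first exact: E.
by apply: eq_bigr => x _; apply: IH => s sn; apply: E; rewrite /= sn.
Qed.

Lemma sumL_cat m n F :
  sumL (m + n) F = sumL m (fun a => sumL n (fun b => F (a ++ b))).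
Proof. by elim: m F => //= m IH F; apply: eq_bigr => x _; rewrite IH. Qed.

Lemma sumL_big (J : finType) n (F : J -> seq T -> nat) :
  sumL n (fun s => \sum_j F j s)%N = (\sum_j sumL n (F j))%N.
Proof.
elim: n F => //= n IH F; rewrite exchange_big; apply: eq_bigr => x _.
by rewrite IH.
Qed.

Lemma sumL_mull c n F : (c * sumL n F)%N = sumL n (fun s => c * F s)%N.
Proof.
by elim: n F => //= n IH F; rewrite big_distrr; apply: eq_bigr => x _ /=; rewrite IH.
Qed.

Lemma sumL_mulr c n F : (sumL n F * c)%N = sumL n (fun s => F s * c)%N.
Proof. by rewrite mulnC sumL_mull; apply: sumL_ext => s _; rewrite mulnC. Qed.

Lemma sumL_gt0 n F : (0 < sumL n F)%N <-> exists s, size s = n /\ (0 < F s)%N.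
Proof.
elim: n F => [|n IH] F /=.
  by split=> [h|[[|x s] []]] //; exists [::].
rewrite lt0n sum_nat_eq0 negb_forall; split.
  case/existsP => x; rewrite -lt0n => /IH[s [sn sF]].
  by exists (x :: s); rewrite /= sn.
case=> -[|x s] [//= [sn] sF]; apply/existsP; exists x.
by rewrite -lt0n; apply/IH; exists s.
Qed.

Lemma sumL_delta n F a : size a = n -> sumL n (fun s => (s == a) * F s)%N = F a.
Proof.
elim: n F a => [|n IH] F [|x a] //= => [_|[sa]]; first by rewrite mul1n.
rewrite (bigD1 x) //= big1 ?addn0 => [|y /negPf yx].
  by rewrite -[RHS](IH (fun s => F (x :: s)) a sa); apply: sumL_ext => s _;
    rewrite eqseq_cons eqxx.
rewrite -[RHS](muln0 (sumL n (fun=> 0%N))) sumL_mulr; apply: sumL_ext => s _.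
by rewrite eqseq_cons yx muln0.
Qed.

Lemma sumL_tuple n F : sumL n F = (\sum_(s : n.-tuple T) F s)%N.
Proof.
elim: n F => [|n IH] F /=.
  by rewrite (big_pred1 [tuple]) // => s; apply/esym/eqP/val_inj; case: s => -[].
under eq_bigr do rewrite IH.
rewrite pair_big /=.
rewrite (reindex (fun p : T * n.-tuple T => [tuple of p.1 :: p.2])) //=.
exists (fun s => (thead s, [tuple of behead s])) => [[x s] _|s _] /=.
  by congr pair; apply: val_inj.
by rewrite -tuple_eta.
Qed.

End SumLists.

Lemma sumL_exch (T T' : finType) m n (F : seq T -> seq T' -> nat) :
  sumL m (fun a => sumL n (F a)) = sumL n (fun b => sumL m (F^~ b)).
Proof.
elim: m F => //= m IH F; rewrite sumL_big; apply: eq_bigr => x _; exact: IH.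
Qed.

(** * Linear relations over the field with two elements *)

(** A strand of the object [1] is doubled; a colouring assigns a bit to each
    half. *)
Definition colour := (bool * bool)%type.
Definition addc (p q : colour) : colour := (p.1 (+) q.1, p.2 (+) q.2).
Definition xorl (x y : seq colour) := [seq addc p.1 p.2 | p <- zip x y].
Definition zs k : seq colour := nseq k (false, false).
Definition swc (p : colour) : colour := (p.2, p.1).

Lemma addcC : commutative addc.
Proof. by case=> a b [c e]; rewrite /addc addbC [b (+) _]addbC. Qed.
Lemma addcA : associative addc.
Proof. by case=> a b [c e] [f g]; rewrite /addc /= !addbA. Qed.
Lemma addcc p : addc p p = (false, false).
Proof. by case: p => a b; rewrite /addc /= !addbb. Qed.
Lemma addc0 p : addc p (false, false) = p.
Proof. by case: p => a b; rewrite /addc /= !addbF. Qed.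
Lemma addcK p : involutive (addc p).
Proof. by move=> q; rewrite addcA addcc addcC addc0. Qed.

Lemma size_xorl k x y : size x = k -> size y = k -> size (xorl x y) = k.
Proof. by move=> sx sy; rewrite size_map size_zip sx sy minnn. Qed.
Lemma size_zs k : size (zs k) = k. Proof. exact: size_nseq. Qed.

Lemma xorl_cons p q x y : xorl (p :: x) (q :: y) = addc p q :: xorl x y.
Proof. by []. Qed.
Lemma xorlz k x : size x = k -> xorl x (zs k) = x.
Proof.
by elim: x k => [|p x IH] [|k] //= [sx]; rewrite xorl_cons addc0 IH.
Qed.
Lemma xorlK k x y : size x = k -> size y = k -> xorl x (xorl x y) = y.
Proof.
elim: x y k => [|p x IH] [|q y] [|k] //= [sx] [sy].
by rewrite !xorl_cons addcK (IH _ k).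
Qed.
Lemma take_xorl k x y : take k (xorl x y) = xorl (take k x) (take k y).
Proof.
elim: k x y => [|k IH] [|p x] [|q y] //=; rewrite ?xorl_cons /= ?IH //.
Qed.
Lemma drop_xorl k x y : size x = size y ->
  drop k (xorl x y) = xorl (drop k x) (drop k y).
Proof.
elim: k x y => [|k IH] [|p x] [|q y] //= [sxy]. by rewrite -IH.
Qed.
Lemma take_zs k l : take k (zs (k + l)) = zs k.
Proof. by rewrite /zs take_nseq ?leq_addr. Qed.
Lemma drop_zs k l : drop k (zs (k + l)) = zs l.
Proof. by rewrite /zs drop_nseq addKn. Qed.
Lemma map_swc_xorl x y : map swc (xorl x y) = xorl (map swc x) (map swc y).
Proof. by elim: x y => [|p x IH] [|q y] //=; rewrite !xorl_cons /= IH. Qed.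

Lemma sumL_xorl n F z : size z = n -> sumL n F = sumL n (fun s => F (xorl z s)).
Proof.
elim: n F z => [|n IH] F [|p z] //= [sz].
rewrite (reindex_inj (inv_inj (addcK p))) /=; apply: eq_bigr => x _.
exact: IH.
Qed.

Definition kern := seq colour -> seq colour -> nat.

Definition kcomp l (K2 K1 : kern) : kern :=
  fun x z => sumL l (fun y => K1 x y * K2 y z)%N.
Definition ktens k l (K K' : kern) : kern :=
  fun x y => (K (take k x) (take l y) * K' (drop k x) (drop l y))%N.
Definition kid : kern := fun x y => (x == y).
Definition ktr (K : kern) : kern := fun x y => K y x.

(** The colourings of a block whose outermost halves are [u] and [v], and
    whose adjacent inner halves agree. *)
Fixpoint chain (u : bool) (x : seq colour) (v : bool) : bool :=
  if x is p :: x' then (u == p.1) && chain p.2 x' v else u == v.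

(** The black spider is a block. Its outline consists of the outermost halves
    on the left and on the right, which join the lower to the upper side and
    are coloured by [u] and [v], and of arcs between adjacent inner halves.
    For the white spider the halves of each strand are exchanged. *)
Definition kspider (s : bool) : kern := fun x y =>
  let f := if s then map swc else id in
  (\sum_(u : bool) \sum_(v : bool) chain u (f x) v * chain u (f y) v)%N.

(** The kernel counts the colourings of the closed curves for each colouring
    of the boundary, so it is constant on its support, which is a linear
    relation. *)
Definition good k l (K : kern) : Prop :=
  [/\ (0 < K (zs k) (zs l))%N,
      forall x y, size x = k -> size y = l -> (0 < K x y)%N ->
        K x y = K (zs k) (zs l) &
      forall x y x' y', size x = k -> size y = l -> size x' = k -> size y' = l ->
        (0 < K x y)%N -> (0 < K x' y')%N -> (0 < K (xorl x x') (xorl y y'))%N].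

Lemma good_tr k l K : good k l K -> good l k (ktr K).
Proof.
case=> h1 h2 h3; split=> //; first by move=> x y sx sy h; exact: h2.
by move=> x y x' y' *; exact: h3.
Qed.

Lemma good_id k : good k k kid.
Proof.
split; rewrite /kid ?eqxx //; first by move=> x y _ _; case: eqP.
by move=> x y x' y' _ _ _ _; case: eqP => // -> _; case: eqP => // -> _; rewrite eqxx.
Qed.

(** Translating by an element of the support permutes the colourings. *)
Lemma good_shift k l K x y x0 y0 : good k l K -> size x = k -> size y = l ->
  size x0 = k -> size y0 = l -> (0 < K x0 y0)%N ->
  K (xorl x0 x) (xorl y0 y) = K x y.
Proof.
case=> h1 h2 h3 sx sy sx0 sy0 p0.
have sx' := size_xorl sx0 sx; have sy' := size_xorl sy0 sy.
case: (posnP (K x y)) => [E|p]; last first.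
  by rewrite (h2 x y) // (h2 _ _ sx' sy') //; exact: h3.
case: (posnP (K (xorl x0 x) (xorl y0 y))) => [->//|p].
have := h3 _ _ _ _ sx0 sy0 sx' sy' p0 p.
by rewrite (xorlK sx0 sx) (xorlK sy0 sy) E.
Qed.

Lemma good_comp k l m K2 K1 : good l m K2 -> good k l K1 ->
  good k m (kcomp l K2 K1).
Proof.
move=> g2 g1; have [a1 b1 c1] := g1; have [a2 b2 c2] := g2; split.
- by apply/sumL_gt0; exists (zs l); rewrite size_zs muln_gt0 a1 a2.
- move=> x z sx sz /sumL_gt0[y0 [sy0]]; rewrite muln_gt0 => /andP[p1 p2].
  rewrite /kcomp (sumL_xorl _ sy0); apply: sumL_ext => y sy.
  have -> : K1 x (xorl y0 y) = K1 (zs k) y.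
    by rewrite -{1}(xorlz sx) (good_shift g1) ?size_zs.
  by rewrite -{1}(xorlz sz) (good_shift g2) ?size_zs.
- move=> x z x' z' sx sz sx' sz' /sumL_gt0[y [sy]]; rewrite muln_gt0 => /andP[p1 p2].
  move=> /sumL_gt0[y' [sy']]; rewrite muln_gt0 => /andP[p1' p2'].
  apply/sumL_gt0; exists (xorl y y'); split; first exact: size_xorl.
  by rewrite muln_gt0 c1 ?c2.
Qed.

Lemma good_tens k l k' l' K K' : good k l K -> good k' l' K' ->
  good (k + k') (l + l') (ktens k l K K').
Proof.
case=> a b c [a' b' c']; split.
- by rewrite /ktens !take_zs !drop_zs muln_gt0 a a'.
- move=> x y sx sy; rewrite /ktens muln_gt0 => /andP[p p'].
  rewrite !take_zs !drop_zs (b (take k x)) // ?size_takel ?sx ?sy ?leq_addr //.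
  by rewrite (b' (drop k x)) // size_drop ?sx ?sy addKn.
- move=> x y x' y' sx sy sx' sy'; rewrite /ktens !muln_gt0.
  move=> /andP[p1 p2] /andP[q1 q2].
  rewrite !take_xorl !drop_xorl ?sx ?sy ?sx' ?sy' //.
  apply/andP; split; [apply: c|apply: c'] => //;
  rewrite ?size_takel ?size_drop ?sx ?sy ?sx' ?sy' ?leq_addr ?addKn //.
Qed.

Lemma chain_xorl k u x v u' x' v' : size x = k -> size x' = k ->
  chain u' x' v' -> chain (u' (+) u) (xorl x' x) (v' (+) v) = chain u x v.
Proof.
elim: x x' k u u' => [|p x IH] [|p' x'] [|k] u u' //=.
  by move=> _ _ /eqP ->; case: u u' v v' => [] [] [] [].
move=> [sx] [sx'] /andP[/eqP -> h]; rewrite (IH _ k) //.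
by case: (u) (p') (p) => [] [[] ?] [[] ?].
Qed.

Lemma chain_zs k : chain false (zs k) false.
Proof. by elim: k. Qed.

Lemma good_spider s k l : good k l (kspider s).
Proof.
pose f : seq colour -> seq colour := if s then map swc else id.
have sf x : size (f x) = size x by rewrite /f; case: (s); rewrite ?size_map.
have fz n : f (zs n) = zs n.
  by rewrite /f; case: (s) => //; elim: n => //= n ->.
have fa x y : f (xorl x y) = xorl (f x) (f y).
  by rewrite /f; case: (s) => //; exact: map_swc_xorl.
have pos x y : reflect (exists u v, chain u (f x) v && chain u (f y) v)
    (0 < kspider s x y)%N.
  rewrite /kspider -/f lt0n sum_nat_eq0 negb_forall; apply: (iffP existsP).
    case=> u; rewrite sum_nat_eq0 negb_forall => /existsP[v].
    by rewrite mulnb eqb0 negbK => h; exists u, v.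
  case=> u [v h]; exists u; rewrite sum_nat_eq0 negb_forall; apply/existsP.
  by exists v; rewrite mulnb h.
split.
- by apply/pos; exists false, false; rewrite !fz !chain_zs.
- move=> x y sx sy /pos[u [v /andP[hx hy]]]; rewrite /kspider -/f.
  rewrite (reindex_inj (inv_inj (addKb u))) /=; apply: eq_bigr => u' _.
  rewrite (reindex_inj (inv_inj (addKb v))) /=; apply: eq_bigr => v' _.
  rewrite -{1}(xorlz (k := k) (x := f x)) ?sf // -{1}(xorlz (k := l) (x := f y)) ?sf //.
  by rewrite !fz (chain_xorl (k := k)) ?(chain_xorl (k := l)) ?sf ?size_zs.
- move=> x y x' y' sx sy sx' sy' /pos[u [v /andP[hx hy]]] /pos[u' [v' /andP[hx' hy']]].
  apply/pos; exists (u (+) u'), (v (+) v'); rewrite !fa.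
  by rewrite (chain_xorl (k := k)) ?(chain_xorl (k := l)) ?sf ?hx' ?hy'.
Qed.

Definition crel k l := {set k.-tuple colour * l.-tuple colour}.
Definition supp k l (K : kern) : crel k l := [set p : k.-tuple colour * l.-tuple colour | (0 < K p.1 p.2)%N].

Lemma zsP k : size (zs k) == k. Proof. by rewrite size_zs. Qed.
Definition zt k : k.-tuple colour := Tuple (zsP k).

Definition rcomp k l m (R2 : crel l m) (R1 : crel k l) : crel k m :=
  [set p : k.-tuple colour * m.-tuple colour |
    [exists y, ((p.1, y) \in R1) && ((y, p.2) \in R2)]].
Definition rcount k l m (R2 : crel l m) (R1 : crel k l) : nat :=
  #|[set y | ((zt k, y) \in R1) && ((y, zt m) \in R2)]|.

Lemma supp_comp k l m K2 K1 :
  supp k m (kcomp l K2 K1) = rcomp (supp l m K2) (supp k l K1).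
Proof.
apply/setP => -[x z]; rewrite !inE /= /kcomp; apply/idP/existsP.
  case/sumL_gt0 => y [/eqP sy]; rewrite muln_gt0 => h.
  by exists (Tuple sy); rewrite !inE.
case=> y; rewrite !inE /= => h; apply/sumL_gt0; exists y.
by rewrite size_tuple muln_gt0.
Qed.

(** Over each pair of boundary colourings in the composed relation there are
    equally many colourings of the middle. *)
Lemma comp_zs k l m K2 K1 : good l m K2 -> good k l K1 ->
  kcomp l K2 K1 (zs k) (zs m) =
  (K2 (zs l) (zs m) * (K1 (zs k) (zs l) *
     rcount (supp l m K2) (supp k l K1)))%N.
Proof.
move=> g2 g1; have [a1 b1 c1] := g1; have [a2 b2 c2] := g2.
rewrite /kcomp sumL_tuple mulnA.
rewrite (bigID (fun y => (y \in [set y | ((zt k, y) \in supp k l K1) &&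
                            ((y, zt m) \in supp l m K2)]))) /=.
rewrite [X in (_ + X)%N]big1 ?addn0; last first.
  move=> y; rewrite !inE /= negb_and -!leqNgt !leqn0 => /orP[]/eqP-> //.
  by rewrite muln0.
rewrite (eq_bigr (fun=> (K1 (zs k) (zs l) * K2 (zs l) (zs m))%N)); last first.
  move=> y; rewrite !inE /= => /andP[p1 p2].
  congr (_ * _)%N.
    exact: (b1 _ _ (size_zs _) (size_tuple y) p1).
  exact: (b2 _ _ (size_tuple y) (size_zs _) p2).
by rewrite sum_nat_const mulnC [(K1 _ _ * _)%N]mulnC.
Qed.

Lemma rcount_gt0 k l m K2 K1 : good l m K2 -> good k l K1 ->
  (0 < rcount (supp l m K2) (supp k l K1))%N.
Proof.
case=> a2 _ _ [a1 _ _]; apply/card_gt0P; exists (zt l).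
by rewrite !inE /= a1 a2.
Qed.

(** * The interpretation respects the relations *)

Section Model.
Variables (C : numClosedFieldType) (anti : bool) (t : C).
Hypothesis t0 : t != 0.
Hypothesis star_t2 : star anti (t ^+ 2) = t ^+ 2.
Local Notation d := (t ^+ 2).
Local Notation N := (d ^+ 2).

(** A kernel value is a power of two with one factor for each closed curve;
    every curve is worth [d]. *)
Definition wt (n : nat) : C := d ^+ logn 2 n.

Lemma d0 : d != 0. Proof. by rewrite sqrf_eq0. Qed.

Lemma wtM m n : (0 < m)%N -> (0 < n)%N -> wt (m * n) = wt m * wt n.
Proof. by move=> m0 n0; rewrite /wt lognM // exprD. Qed.

(** With this normalization fusing spiders along several strands produces no
    scalar: each closed curve contributes [d], and each of the joined legs
    [t^-1] twice. *)
Definition scoef k l : C := d * t^-1 ^+ (k + l).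

(** The value of a linear functional on the formal combination of kernels
    denoted by a term. Passing the functional as an argument avoids the
    construction of the space of formal combinations. *)
Fixpoint ev k l (u : term C k l) : (kern -> C) -> C :=
  match u in term _ k l return (kern -> C) -> C with
  | TSpider s k l => fun phi => scoef k l * phi (kspider s)
  | TId k => fun phi => phi kid
  | TComp k l m g f => fun phi =>
      ev g (fun K2 => ev f (fun K1 => phi (kcomp l K2 K1)))
  | TTens k l k' l' f g => fun phi =>
      ev f (fun K => ev g (fun K' => phi (ktens k l K K')))
  | TZero k l => fun=> 0
  | TAdd k l f g => fun phi => ev f phi + ev g phi
  | TScale k l a f => fun phi => a * ev f phi
  end.

Lemma ev_add k l (u : term C k l) phi psi :
  ev u (fun K => phi K + psi K) = ev u phi + ev u psi.
Proof.
elim: u phi psi => {k l} //=.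
- by move=> s k l phi psi; rewrite mulrDr.
- move=> k l m g IHg f IHf phi psi; rewrite -IHg; congr ev; apply/funext => K.
  exact: IHf.
- move=> k l k' l' f IHf g IHg phi psi; rewrite -IHf; congr ev; apply/funext => K.
  exact: IHg.
- by move=> *; rewrite addr0.
- by move=> k l f IHf g IHg phi psi; rewrite IHf IHg addrACA.
- by move=> k l a f IHf phi psi; rewrite IHf mulrDr.
Qed.

Lemma ev_scale k l (u : term C k l) a phi :
  ev u (fun K => a * phi K) = a * ev u phi.
Proof.
elim: u phi => {k l} //=.
- by move=> s k l phi; rewrite mulrCA.
- move=> k l m g IHg f IHf phi; rewrite -IHg; congr ev; apply/funext => K.
  exact: IHf.
- move=> k l k' l' f IHf g IHg phi; rewrite -IHf; congr ev; apply/funext => K.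
  exact: IHg.
- by move=> *; rewrite mulr0.
- by move=> k l f IHf g IHg phi; rewrite IHf IHg mulrDr.
- by move=> k l b f IHf phi; rewrite IHf mulrCA.
Qed.

Lemma ev_zero k l (u : term C k l) : ev u (fun=> 0) = 0.
Proof.
rewrite -[RHS](mul0r (ev u (fun=> 0))) -ev_scale; congr ev.
by apply/funext => K; rewrite mul0r.
Qed.

Lemma ev_sum k l (u : term C k l) (J : finType) (phi : J -> kern -> C) :
  ev u (fun K => \sum_j phi j K) = \sum_j ev u (phi j).
Proof.
elim: (index_enum J) => [|j s IH].
  by rewrite big_nil -[RHS](ev_zero u); congr ev; apply/funext => K; rewrite big_nil.
rewrite big_cons -IH -ev_add; congr ev; apply/funext => K; by rewrite big_cons.
Qed.

Lemma ev_exch k l k' l' (u : term C k l) (u' : term C k' l') phi :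
  ev u (fun K => ev u' (fun K' => phi K K')) =
  ev u' (fun K' => ev u (fun K => phi K K')).
Proof.
elim: u phi => {k l} //=.
- by move=> s k l phi; rewrite ev_scale.
- move=> k l m g IHg f IHf phi; rewrite -IHg; congr ev; apply/funext => K.
  exact: IHf.
- move=> k l k1 l1 f IHf g IHg phi; rewrite -IHf; congr ev; apply/funext => K.
  exact: IHg.
- by move=> k l phi; rewrite ev_zero.
- by move=> k l f IHf g IHg phi; rewrite IHf IHg ev_add.
- by move=> k l b f IHf phi; rewrite IHf ev_scale.
Qed.

Lemma ev_good k l (u : term C k l) phi psi :
  (forall K, good k l K -> phi K = psi K) -> ev u phi = ev u psi.
Proof.
elim: u phi psi => {k l} //=.
- by move=> s k l phi psi E; rewrite E //; exact: good_spider.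
- by move=> k phi psi -> //; exact: good_id.
- move=> k l m g IHg f IHf phi psi E; apply: IHg => K2 g2; apply: IHf => K1 g1.
  by apply: E; exact: good_comp.
- move=> k l k' l' f IHf g IHg phi psi E; apply: IHf => K2 g2; apply: IHg => K1 g1.
  by apply: E; exact: good_tens.
- by move=> k l f IHf g IHg phi psi E; rewrite (IHf _ _ E) (IHg _ _ E).
- by move=> k l b f IHf phi psi E; rewrite (IHf _ _ E).
Qed.

Lemma ev_hcast k l k' l' (ek : k = k') (el : l = l') (u : term C k l) :
  ev (hcast (term C) ek el u) = ev u.
Proof. by case: _ / ek; case: _ / el. Qed.

(** These are the functionals on kernels that see only the support and take a
    kernel with [j] closed curves as [d ^ j] times its support. *)
Definition adm k l (phi : kern -> C) : Prop :=
  exists g : crel k l -> C,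
    forall K, good k l K -> phi K = wt (K (zs k) (zs l)) * g (supp k l K).

Lemma adm_comp k l m (phi : kern -> C) (K2 : kern) : adm k m phi -> good l m K2 ->
  adm k l (fun K1 => phi (kcomp l K2 K1)).
Proof.
case=> g E g2; exists (fun R => wt (K2 (zs l) (zs m)) *
  wt (rcount (supp l m K2) R) * g (rcomp (supp l m K2) R)) => K1 g1.
rewrite E; last exact: good_comp.
have rc := rcount_gt0 g2 g1; have [a1 _ _] := g1; have [a2 _ _] := g2.
rewrite comp_zs // !wtM ?muln_gt0 ?a1 // supp_comp !mulrA; congr (_ * _ * _).
by rewrite mulrC.
Qed.

(** The functional in the remaining variable is again admissible, because a
    choice of its values on relations commutes with the evaluation. *)
Lemma adm_ev k l k' l' (u : term C k l) (phi : kern -> kern -> C) :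
  (forall K, good k l K -> adm k' l' (phi K)) ->
  adm k' l' (fun K' => ev u (fun K => phi K K')).
Proof.
move=> h; have [G GE] : exists G : kern -> crel k' l' -> C, forall K, good k l K ->
   forall K', good k' l' K' ->
     phi K K' = wt (K' (zs k') (zs l')) * G K (supp k' l' K').
  have h' K : exists g : crel k' l' -> C, good k l K -> forall K', good k' l' K' ->
     phi K K' = wt (K' (zs k') (zs l')) * g (supp k' l' K').
    have [gK|ngK] := pselect (good k l K); last by exists (fun=> 0).
    by have [g E] := h _ gK; exists g.
  by exists (fun K => sval (cid (h' K))) => K; exact: (svalP (cid (h' K))).
exists (fun R => ev u (fun K => G K R)) => K' g'.
by rewrite -ev_scale; apply: ev_good => K gK; exact: GE.
Qed.

Lemma adm_comp2 k l m (phi : kern -> C) (K1 : kern) : adm k m phi -> good k l K1 ->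
  adm l m (fun K2 => phi (kcomp l K2 K1)).
Proof.
case=> g E g1; exists (fun R => wt (K1 (zs k) (zs l)) *
  wt (rcount R (supp k l K1)) * g (rcomp R (supp k l K1))) => K2 g2.
rewrite E; last exact: good_comp.
have rc := rcount_gt0 g2 g1; have [a1 _ _] := g1; have [a2 _ _] := g2.
by rewrite comp_zs // !wtM ?muln_gt0 ?a1 // supp_comp !mulrA.
Qed.

Definition ltuple k l (x : (k + l).-tuple colour) : k.-tuple colour :=
  [tuple of mkseq (fun i => nth (false, false) x i) k].
Definition rtuple k l (x : (k + l).-tuple colour) : l.-tuple colour :=
  [tuple of mkseq (fun i => nth (false, false) x (k + i)) l].

Lemma ltupleE k l (x : (k + l).-tuple colour) : ltuple x = take k x :> seq colour.
Proof.
apply: (@eq_from_nth _ (false, false)).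
  by rewrite size_tuple size_takel // size_tuple leq_addr.
by move=> i; rewrite size_tuple => hi; rewrite nth_mkseq // nth_take.
Qed.
Lemma rtupleE k l (x : (k + l).-tuple colour) : rtuple x = drop k x :> seq colour.
Proof.
apply: (@eq_from_nth _ (false, false)).
  by rewrite size_tuple size_drop size_tuple addKn.
by move=> i; rewrite size_tuple => hi; rewrite nth_mkseq // nth_drop.
Qed.

Definition rtens k l k' l' (R : crel k l) (R' : crel k' l') : crel (k + k') (l + l') :=
  [set p : (k + k').-tuple colour * (l + l').-tuple colour |
    ((ltuple p.1, ltuple p.2) \in R) && ((rtuple p.1, rtuple p.2) \in R')].

Lemma supp_tens k l k' l' K K' :
  supp (k + k') (l + l') (ktens k l K K') = rtens (supp k l K) (supp k' l' K').
Proof.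
by apply/setP => -[x y]; rewrite !inE !ltupleE !rtupleE /ktens muln_gt0.
Qed.

Lemma tens_zs k l k' l' K K' : ktens k l K K' (zs (k + k')) (zs (l + l')) =
  (K (zs k) (zs l) * K' (zs k') (zs l'))%N.
Proof. by rewrite /ktens !take_zs !drop_zs. Qed.

Lemma adm_tens k l k' l' (phi : kern -> C) (K : kern) :
  adm (k + k') (l + l') phi -> good k l K -> adm k' l' (fun K' => phi (ktens k l K K')).
Proof.
case=> g E gK; exists (fun R => wt (K (zs k) (zs l)) * g (rtens (supp k l K) R)) => K' gK'.
rewrite E; last exact: good_tens.
have [a _ _] := gK; have [a' _ _] := gK'.
by rewrite tens_zs wtM // supp_tens mulrCA mulrA.
Qed.
Lemma adm_tens2 k l k' l' (phi : kern -> C) (K' : kern) :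
  adm (k + k') (l + l') phi -> good k' l' K' -> adm k l (fun K => phi (ktens k l K K')).
Proof.
case=> g E gK; exists (fun R => wt (K' (zs k') (zs l')) * g (rtens R (supp k' l' K'))) => K gK'.
rewrite E; last exact: good_tens.
have [a _ _] := gK; have [a' _ _] := gK'.
by rewrite tens_zs wtM // supp_tens mulrA.
Qed.

Lemma adm_scale k l phi K K' j : adm k l phi -> good k l K' ->
  (forall x y, size x = k -> size y = l -> K x y = 2 ^ j * K' x y)%N ->
  phi K = d ^+ j * phi K'.
Proof.
case=> g E gK' EK; have [a b c] := gK'.
have p2 : (0 < 2 ^ j)%N by rewrite expn_gt0.
have gK : good k l K.
  split; first by rewrite EK ?size_zs // muln_gt0 p2.
    by move=> x y sx sy; rewrite !EK ?size_zs // muln_gt0 p2 => h; rewrite (b x y).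
  move=> x y x' y' sx sy sx' sy'.
  have sxx := size_xorl sx sx'; have syy := size_xorl sy sy'.
  rewrite (EK x y) // (EK x' y') // (EK _ _ sxx syy).
  by rewrite !muln_gt0 !p2; exact: c.
rewrite (E K gK) (E K' gK') EK ?size_zs // wtM // {1}/wt pfactorK // mulrA; congr (_ * g _).
by apply/setP => -[x y]; rewrite !inE /= EK ?size_tuple // muln_gt0 p2.
Qed.

Lemma adm_eq k l phi K K' : adm k l phi -> good k l K' ->
  (forall x y, size x = k -> size y = l -> K x y = K' x y) -> phi K = phi K'.
Proof.
move=> a g E; rewrite (@adm_scale k l phi K K' 0) ?mul1r // => x y sx sy.
by rewrite mul1n E.
Qed.

(** The sign by which the conjugation acts on [t]. It is [-1] for example when
    [d] is negative and the dagger is antilinear; it enters the dagger only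
    through even powers for even morphisms. *)
Definition eps : C := star anti t / t.

Lemma starM : {morph star (C := C) anti : x y / x * y}.
Proof. by move=> x y; rewrite /star; case: (anti); rewrite ?rmorphM. Qed.
Lemma starD : {morph star (C := C) anti : x y / x + y}.
Proof. by move=> x y; rewrite /star; case: (anti); rewrite ?rmorphD. Qed.
Lemma star0 : star anti (0 : C) = 0.
Proof. by rewrite /star; case: (anti); rewrite ?rmorph0. Qed.
Lemma star1 : star anti (1 : C) = 1.
Proof. by rewrite /star; case: (anti); rewrite ?rmorph1. Qed.
Lemma starX x n : star anti (x ^+ n) = star anti (x : C) ^+ n.
Proof. by rewrite /star; case: (anti); rewrite ?rmorphXn. Qed.
Lemma starV x : star anti (x^-1) = (star anti (x : C))^-1.
Proof. by rewrite /star; case: (anti); rewrite ?fmorphV. Qed.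
Lemma star_invol : involutive (star (C := C) anti).
Proof. by move=> a; rewrite /star; case: (anti) => //; rewrite conjCK. Qed.

Lemma star_neq0 : star anti t != 0.
Proof. by rewrite /star; case: (anti); rewrite ?conjC_eq0. Qed.
Lemma eps_neq0 : eps != 0.
Proof. by rewrite mulf_neq0 ?invr_eq0 // star_neq0. Qed.
Lemma star_t : star anti t = eps * t.
Proof. by rewrite /eps mulfVK. Qed.
Lemma eps2 : eps ^+ 2 = 1.
Proof. by rewrite /eps expr_div_n -starX star_t2 divff // d0. Qed.
Lemma eps_even n : ~~ odd n -> eps ^+ n = 1.
Proof. by move=> on; rewrite -(even_halfK on) -mul2n exprM eps2 expr1n. Qed.
Lemma star_eps : star anti eps = eps.
Proof.
rewrite /eps starM starV star_invol; apply/eqP; rewrite eqr_div ?star_neq0 //.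
by rewrite -!expr2 -starX star_t2.
Qed.
Lemma star_epsX n : star anti (eps ^+ n) = eps ^+ n.
Proof. by rewrite starX star_eps. Qed.
Lemma eps_add k l m : eps ^+ (k + l) * eps ^+ (l + m) = eps ^+ (k + m).
Proof.
rewrite -exprD; have -> : (k + l + (l + m) = k + m + 2 * l)%N by lia.
by rewrite exprD exprM eps2 expr1n mulr1.
Qed.
Lemma star_scoef k l : star anti (scoef k l) = eps ^+ (k + l) * scoef l k.
Proof.
have epsV : eps^-1 = eps.
  by apply: (mulfI eps_neq0); rewrite divff ?eps_neq0 // -expr2 eps2.
rewrite /scoef starM star_t2 starX starV star_t invfM exprMn [(l + k)%N]addnC.
by rewrite epsV mulrCA.
Qed.

Lemma ev_dag k l (u : term C k l) phi :
  ev (tdag anti u) phi =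
  eps ^+ (k + l) * star anti (ev u (fun K => star anti (phi (ktr K)))).
Proof.
elim: u phi => {k l} /=.
- move=> s k l phi; rewrite starM star_invol star_scoef mulrA.
  rewrite mulrA -expr2 -exprM mulnC exprM eps2 expr1n mul1r; congr (_ * phi _).
  by apply/funext => x; apply/funext => y; rewrite /kspider /ktr;
    apply: eq_bigr => u _; apply: eq_bigr => v _; rewrite mulnC.
- move=> k phi; rewrite star_invol addnn eps_even ?odd_double // mul1r; congr phi.
  by apply/funext => x; apply/funext => y; rewrite /ktr /kid eq_sym.
- move=> k l m g IHg f IHf phi; rewrite IHf.
  transitivity (eps ^+ (k + l) * star anti (ev f (fun K1 => star anti (
     eps ^+ (l + m) * star anti (ev g (fun K2 => star anti (phi (ktr (kcomp l K2 K1))))))))).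
    congr (_ * star anti (ev f _)); apply/funext => K1; rewrite IHg.
    congr (star anti (_ * star anti (ev g _))); apply/funext => K2; congr (star anti (phi _)).
    apply/funext => x; apply/funext => y; rewrite /kcomp /ktr.
    by apply: sumL_ext => s _; rewrite mulnC.
  transitivity (eps ^+ (k + l) * star anti (ev f (fun K1 =>
     eps ^+ (l + m) * ev g (fun K2 => star anti (phi (ktr (kcomp l K2 K1))))))).
    congr (_ * star anti (ev f _)); apply/funext => K1.
    by rewrite starM star_invol star_epsX.
  by rewrite ev_scale starM star_epsX mulrA eps_add ev_exch.
- move=> k l k' l' f IHf g IHg phi; rewrite IHf.
  transitivity (eps ^+ (k + l) * star anti (ev f (fun K1 =>
     eps ^+ (k' + l') * ev g (fun K2 => star anti (phi (ktr (ktens k l K1 K2))))))).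
    congr (_ * star anti (ev f _)); apply/funext => K1.
    by rewrite IHg starM star_invol star_epsX.
  by rewrite ev_scale starM star_epsX mulrA -exprD addnACA.
- by move=> k l phi; rewrite star0 mulr0.
- by move=> k l f IHf g IHg phi; rewrite IHf IHg starD mulrDr.
- by move=> k l a f IHf phi; rewrite IHf starM mulrCA.
Qed.

Lemma star_wt n : star anti (wt n) = wt n.
Proof. by rewrite /wt starX star_t2. Qed.

Definition rtr k l (R : crel k l) : crel l k :=
  [set p : l.-tuple colour * k.-tuple colour | (p.2, p.1) \in R].

Lemma supp_tr k l K : supp l k (ktr K) = rtr (supp k l K).
Proof. by apply/setP => -[x y]; rewrite !inE. Qed.

Lemma adm_star k l phi : adm l k phi -> adm k l (fun K => star anti (phi (ktr K))).
Proof.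
case=> g E; exists (fun R => star anti (g (rtr R))) => K gK.
rewrite E; last exact: good_tr.
by rewrite starM star_wt supp_tr.
Qed.

Lemma chain_cat u x y v : chain u (x ++ y) v =
  (\sum_(w : bool) chain u x w * chain w y v)%N :> nat.
Proof.
elim: x u => [|p x IH] u /=.
  by rewrite big_bool /=; case: u; rewrite /= ?mul1n ?mul0n ?addn0.
rewrite -mulnb IH big_distrr /=; apply: eq_bigr => w _.
by rewrite -mulnb mulnA.
Qed.

(** Fusing along [m + 1] strands closes [m] curves, each of which has two
    colourings. *)
Lemma sum_chain m b c b' c' :
  sumL m.+1 (fun z => chain b z c * chain b' z c')%N =
  (2 ^ m * ((b == b') && (c == c')))%N.
Proof.
have big_colour (F : colour -> nat) :
    (\sum_(p : colour) F p = \sum_(u : bool) \sum_(v : bool) F (u, v))%N.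
  by rewrite pair_big; apply: eq_bigr => -[].
elim: m b b' => [|m IH] b b'.
  rewrite /= big_colour !big_bool /=.
  by case: b b' c c' => [] [] [] [].
transitivity (\sum_(p : colour) ((b == p.1) && (b' == p.1)) *
    (2 ^ m * (c == c')))%N; last first.
  rewrite big_colour !big_bool expnS /=.
  by case: b b' (c == c') => [] [] []; rewrite /= ?muln0 ?mul0n //; lia.
rewrite sumLS; apply: eq_bigr => p _.
have := IH p.2 p.2; rewrite eqxx andTb => <-; rewrite sumL_mull.
by apply: sumL_ext => z _ /=; rewrite -!mulnb; lia.
Qed.

Lemma kspider_map s x y : kspider s x y =
  kspider false (if s then map swc x else x) (if s then map swc y else y).
Proof. by rewrite /kspider; case: s. Qed.

Lemma kspiderE x y : kspider false x y =
  (\sum_(u : bool) \sum_(v : bool) chain u x v * chain u y v)%N.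
Proof. by []. Qed.

Lemma spider_fuse_false k1 l1 k2 l2 m x1 x2 y1 y2 : size x1 = k1 -> size x2 = k2 ->
  size y1 = l1 -> size y2 = l2 ->
  sumL m.+1 (fun z => kspider false (x1 ++ z) y1 * kspider false x2 (z ++ y2))%N =
  (2 ^ m * kspider false (x1 ++ x2) (y1 ++ y2))%N.
Proof.
move=> s1 s2 s3 s4.
transitivity (\sum_a \sum_c \sum_b \sum_b' \sum_e \sum_c'
  chain a x1 b * chain a y1 c * chain b' x2 e * chain c' y2 e *
  sumL m.+1 (fun z => chain b z c * chain b' z c'))%N.
  rewrite -[RHS]/(\sum_a _)%N.
  under [RHS]eq_bigr => a _ do under eq_bigr => c _ do under eq_bigr => b _ do
    under eq_bigr => b' _ do under eq_bigr => e _ do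
    (under eq_bigr => c' _ do rewrite sumL_mull; rewrite -sumL_big).
  under [RHS]eq_bigr => a _ do under eq_bigr => c _ do under eq_bigr => b _ do
    (under eq_bigr => b' _ do rewrite -sumL_big; rewrite -sumL_big).
  under [RHS]eq_bigr => a _ do (under eq_bigr => c _ do rewrite -sumL_big; rewrite -sumL_big).
  rewrite -sumL_big; apply: sumL_ext => z _.
  rewrite !kspiderE big_distrl; apply: eq_bigr => a _.
  rewrite big_distrl; apply: eq_bigr => c _ /=.
  rewrite chain_cat -mulnA big_distrl; apply: eq_bigr => b _ /=.
  rewrite !big_distrr; apply: eq_bigr => b' _ /=.
  rewrite !big_distrr; apply: eq_bigr => e _ /=.
  rewrite chain_cat !big_distrr; apply: eq_bigr => c' _ /=.
  lia.
under eq_bigr => a _ do under eq_bigr => c _ do under eq_bigr => b _ do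
    under eq_bigr => b' _ do under eq_bigr => e _ do
    under eq_bigr => c' _ do rewrite sum_chain.
rewrite kspiderE big_distrr; apply: eq_bigr => a _.
transitivity (\sum_c \sum_b \sum_e
  chain a x1 b * chain a y1 c * chain b x2 e * chain c y2 e * 2 ^ m)%N.
  apply: eq_bigr => c _; apply: eq_bigr => b _.
  rewrite (bigD1 b) //= [X in (_ + X)%N]big1 ?addn0; last first.
    move=> b' /negPf nb; apply: big1 => e _; apply: big1 => c' _.
    by rewrite eq_sym nb !muln0.
  apply: eq_bigr => e _.
  rewrite (bigD1 c) //= [X in (_ + X)%N]big1 ?addn0; last first.
    by move=> c' /negPf nc; rewrite [c == c']eq_sym nc andbF !muln0.
  by rewrite !eqxx muln1.
under eq_bigr => c _ do rewrite exchange_big.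
rewrite exchange_big big_distrr; apply: eq_bigr => e _ /=.
rewrite !chain_cat big_distrl exchange_big /= mulnC big_distrl /=.
apply: eq_bigr => b _; rewrite big_distrr big_distrl /=.
by apply: eq_bigr => c _; lia.
Qed.

Lemma spider_fuse s k1 l1 k2 l2 m x1 x2 y1 y2 : size x1 = k1 -> size x2 = k2 ->
  size y1 = l1 -> size y2 = l2 ->
  sumL m.+1 (fun z => kspider s (x1 ++ z) y1 * kspider s x2 (z ++ y2))%N =
  (2 ^ m * kspider s (x1 ++ x2) (y1 ++ y2))%N.
Proof.
case: s; last exact: spider_fuse_false.
move=> s1 s2 s3 s4; rewrite [in RHS]kspider_map !map_cat.
rewrite -(@spider_fuse_false k1 l1 k2 l2) ?size_map //.
have swcK : involutive swc by case.
have E F : sumL m.+1 F = sumL m.+1 (fun z => F (map swc z)).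
  elim: (m.+1) F => //= n IH F; rewrite (reindex_inj (inv_inj swcK)) /=.
  by apply: eq_bigr => p _; rewrite IH.
rewrite [RHS]E; apply: sumL_ext => z _.
by rewrite !(kspider_map true) !map_cat.
Qed.

Lemma scoef_fuse k1 l1 k2 l2 m :
  scoef (k1 + m.+1) l1 * scoef k2 (m.+1 + l2) * d ^+ m = scoef (k1 + k2) (l1 + l2).
Proof.
rewrite /scoef.
have -> : (k1 + m.+1 + l1 = (k1 + l1) + m.+1)%N by lia.
have -> : (k2 + (m.+1 + l2) = (k2 + l2) + m.+1)%N by lia.
have -> : (k1 + k2 + (l1 + l2) = (k1 + l1) + (k2 + l2))%N by lia.
move: (k1 + l1)%N (k2 + l2)%N => a b.
rewrite !exprD; move: (t^-1 ^+ a) (t^-1 ^+ b) => A B.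
have gen (u e : C) : e * (A * u ^+ m.+1) * (e * (B * u ^+ m.+1)) * e ^+ m =
    e * (A * B) * ((u * u * e) ^+ m.+1).
  by rewrite !exprMn !exprS; ring.
rewrite gen.
by rewrite -expr2 exprVn mulVf ?d0 // expr1n mulr1.
Qed.

Lemma spider00 s phi : adm 0 0 phi -> scoef 0 0 * phi (kspider s) = N * phi kid.
Proof.
move=> a; rewrite (@adm_scale 0 0 phi (kspider s) kid 1 a (good_id 0)).
  by rewrite /scoef addn0 expr0 mulr1 expr1 mulrA -expr2.
case=> // [] // [] // _ _; rewrite /kspider !big_bool /=.
by case: (s); rewrite /= /kid eqxx.
Qed.

Lemma spider11 s phi : adm 1 1 phi -> scoef 1 1 * phi (kspider s) = phi kid.
Proof.
move=> a; rewrite (@adm_eq 1 1 phi (kspider s) kid a (good_id 1)).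
  by rewrite /scoef exprVn divff ?mul1r // d0.
case=> // -[p1 p2] [] // [] // [q1 q2] [] // _ _; rewrite /kspider !big_bool /kid /=.
by case: s; case: p1; case: p2; case: q1; case: q2.
Qed.

Lemma spider02 phi : adm 0 2 phi ->
  scoef 0 2 * phi (kspider false) = scoef 0 2 * phi (kspider true).
Proof.
move=> a; congr (_ * _); apply: (adm_eq a (good_spider true 0 2)).
case=> // -[//|[p1 p2] [//|[q1 q2] [] //]] _ _; rewrite /kspider !big_bool /=.
by case: p1; case: p2; case: q1; case: q2.
Qed.

(** Both composites have the same kernel, and the scalars agree. *)
Lemma spider_bw phi : adm 1 1 phi ->
  scoef 2 1 * (scoef 1 2 * phi (kcomp 2 (kspider false) (kspider true))) =
  N^-1 * (scoef 0 1 * (scoef 1 0 * phi (kcomp 0 (kspider false) (kspider true)))).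
Proof.
move=> a.
have -> : phi (kcomp 2 (kspider false) (kspider true)) =
          phi (kcomp 0 (kspider false) (kspider true)).
  apply: (adm_eq a).
    by apply: (good_comp (good_spider _ _ _) (good_spider _ _ _)).
  case=> // -[p1 p2] [] // [] // [q1 q2] [] // _ _.
  have big_colour (F : colour -> nat) :
    (\sum_(p : colour) F p = \sum_(u : bool) \sum_(v : bool) F (u, v))%N.
    by rewrite pair_big; apply: eq_bigr => -[].
  rewrite /kcomp !sumLS big_colour !big_bool !sumLS !big_colour !big_bool /=.
  rewrite /kspider !big_bool /=.
  by case: p1; case: p2; case: q1; case: q2.
have t2 : t^-1 ^+ 2 * d = 1 by rewrite exprVn mulVf // d0.
have E : scoef 2 1 * scoef 1 2 = N^-1 * (scoef 0 1 * scoef 1 0).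
  apply: (mulfI (expf_neq0 2 d0)); rewrite [RHS]mulrA divff ?expf_neq0 ?d0 // mul1r.
  rewrite /scoef.
  have gen (u e : C) : e ^+ 2 * (e * u ^+ (2 + 1) * (e * u ^+ (1 + 2))) =
    e * u ^+ (0 + 1) * (e * u ^+ (1 + 0)) * (u ^+ 2 * e) ^+ 2 by ring.
  by rewrite gen t2 expr1n mulr1.
by rewrite mulrA E -!mulrA.
Qed.

Lemma ev_fuse s k1 l1 k2 l2 m phi : (0 < m)%N -> adm (k1 + k2) (l1 + l2) phi ->
  ev (TComp (TTens (TSpider s (k1 + m) l1) (TId l2))
        (hcast (term C) erefl (addnA k1 m l2)
           (TTens (TId k1) (TSpider s k2 (m + l2))))) phi =
  ev (TSpider s (k1 + k2) (l1 + l2)) phi.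
Proof.
case: m => // m _ a.
transitivity (ev (TTens (TSpider s (k1 + m.+1) l1) (TId l2)) (fun K2 =>
   ev (TTens (TId k1) (TSpider s k2 (m.+1 + l2))) (fun K1 =>
     phi (kcomp (k1 + m.+1 + l2) K2 K1)))).
  by rewrite -[in RHS](ev_hcast erefl (addnA k1 m.+1 l2)).
rewrite /= mulrA; set K := kcomp _ _ _.
rewrite (@adm_scale _ _ phi K (kspider s) m a (good_spider _ _ _)).
  by rewrite mulrA scoef_fuse.
move=> x y sx sy.
rewrite -(cat_take_drop k1 x) -(cat_take_drop l1 y).
have s1 : size (take k1 x) = k1 by rewrite size_takel // sx leq_addr.
have s2 : size (take l1 y) = l1 by rewrite size_takel // sy leq_addr.
have s3 : size (drop k1 x) = k2 by rewrite size_drop sx addKn.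
have s4 : size (drop l1 y) = l2 by rewrite size_drop sy addKn.
move: (take k1 x) (drop k1 x) (take l1 y) (drop l1 y) s1 s2 s3 s4.
move=> x1 x2 y1 y2 s1 s2 s3 s4.
rewrite -(spider_fuse s m s1 s3 s2 s4) /K /kcomp -addnA sumL_cat.
rewrite -(sumL_delta (fun z => sumL m.+1 (fun z' =>
   kspider s (z ++ z') y1 * kspider s x2 (z' ++ y2))%N) s1).
apply: sumL_ext => z sz; rewrite sumL_mull sumL_cat; apply: sumL_ext => z' sz'.
transitivity (sumL l2 (fun z2 => (z2 == y2) * ((z == x1) *
   (kspider s (z ++ z') y1 * kspider s x2 (z' ++ z2))))%N).
  apply: sumL_ext => z2 sz2; rewrite /ktens !catA.
  have E1 (p q r : seq colour) n : size p = n -> take n (p ++ q) = p.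
    by move=> <-; rewrite take_size_cat.
  have E2 (p q r : seq colour) n : size p = n -> drop n (p ++ q) = q.
    by move=> <-; rewrite drop_size_cat.
  rewrite -[in take k1 (_ ++ z2)]catA -[in drop k1 (_ ++ z2)]catA.
  rewrite !(E1 z) // !(E2 z) // !(E1 x1) // !(E2 x1) // !(E1 y1) // !(E2 y1) //.
  rewrite (E1 (z ++ z')) ?(E2 (z ++ z')) ?size_cat ?sz ?sz' // /kid.
  by rewrite [x1 == z]eq_sym mulnA [RHS]mulnC [(kspider s (z ++ z') y1 * _)%N]mulnC !mulnA.
by rewrite sumL_delta.
Qed.

(** By induction on the derivation. Categorical laws hold since composing and
    juxtaposing kernels is associative up to reindexing of sums, and the
    spider relations are counts of closed curves. The dagger transposes
    kernels. *)
Theorem ev_sound k l (u v : term C k l) : teq anti N u v ->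
  forall phi, adm k l phi -> ev u phi = ev v phi.
Proof.
elim=> {k l u v} /=.
- by [].
- by move=> k l f g _ IH phi a; rewrite IH.
- by move=> k l f g h _ IH1 _ IH2 phi a; rewrite IH1 // IH2.
- move=> k l m g g' f f' _ IHg _ IHf phi a.
  transitivity (ev g (fun K2 => ev f' (fun K1 => phi (kcomp l K2 K1)))).
    by apply: ev_good => K2 g2; apply: IHf; exact: (adm_comp a g2).
  by apply: IHg; apply: adm_ev => K1 g1; exact: (adm_comp2 a g1).
- move=> k l k' l' f f' g g' _ IHf _ IHg phi a.
  transitivity (ev f (fun K => ev g' (fun K' => phi (ktens k l K K')))).
    by apply: ev_good => K gK; apply: IHg; exact: (adm_tens a gK).
  by apply: IHf; apply: adm_ev => K1 g1; exact: (adm_tens2 a g1).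
- by move=> k l f f' g g' _ IHf _ IHg phi a; rewrite IHf // IHg.
- by move=> k l a f f' _ IH phi ad; rewrite IH.
- move=> k l f f' _ IH phi a; rewrite !ev_dag IH //; exact: adm_star.
- by move=> *; rewrite addrA.
- by move=> *; rewrite addrC.
- by move=> *; rewrite add0r.
- by move=> *; rewrite mulN1r addNr.
- by move=> *; rewrite mulrA.
- by move=> *; rewrite mul1r.
- by move=> *; rewrite mulrDr.
- by move=> *; rewrite mulrDl.
- move=> k l m n h g f phi a; congr (ev h _); apply/funext => K3.
  congr (ev g _); apply/funext => K2; congr (ev f _); apply/funext => K1.
  congr phi; apply/funext => x; apply/funext => z; rewrite /kcomp.
  transitivity (sumL m (fun y => sumL l (fun y' => K1 x y' * K2 y' y * K3 y z)))%N.
    by apply: sumL_ext => y _; rewrite sumL_mulr.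
  rewrite sumL_exch; apply: sumL_ext => y _; rewrite sumL_mull.
  by apply: sumL_ext => y' _; rewrite mulnA.
- move=> k l f phi a; apply: ev_good => K gK; apply: (adm_eq a gK) => x y sx sy.
  rewrite /kcomp /kid -[RHS](sumL_delta (K x) sy).
  by apply: sumL_ext => s _; rewrite mulnC.
- move=> k l f phi a; apply: ev_good => K gK; apply: (adm_eq a gK) => x y sx sy.
  rewrite /kcomp /kid -[RHS](sumL_delta (K^~ y) sx).
  by apply: sumL_ext => s _; rewrite eq_sym.
- by [].
- by move=> k l m g f f' phi a; rewrite -ev_add.
- by [].
- by move=> k l m a g f phi _; rewrite -ev_scale.
- move=> k l k' l' k'' l'' f g h phi a; rewrite ev_hcast /=.
  congr (ev f _); apply/funext => K3.
  congr (ev g _); apply/funext => K2; congr (ev h _); apply/funext => K1.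
  congr phi; apply/funext => x; apply/funext => y; rewrite /ktens.
  rewrite !take_takel ?leq_addr // !take_drop !drop_drop mulnA.
  by rewrite [(k' + k)%N]addnC [(l' + l)%N]addnC.
- move=> k l f phi a; rewrite ev_hcast /=; congr (ev f _); apply/funext => K.
  congr phi; apply/funext => x; apply/funext => y.
  by rewrite /ktens !take0 !drop0 /kid eqxx mul1n.
- move=> k l f phi a; rewrite ev_hcast /=; apply: ev_good => K gK.
  apply: (adm_eq a gK) => x y sx sy.
  by rewrite /ktens -sx -sy !take_size !drop_size /kid eqxx muln1.
- move=> k l phi a; congr phi; apply/funext => x; apply/funext => y.
  rewrite /ktens /kid mulnb; congr nat_of_bool; apply/andP/eqP.
    by case=> /eqP h1 /eqP h2; rewrite -(cat_take_drop k x) h1 h2 cat_take_drop.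
  by move=> ->.
- move=> k l m k' l' m' g f g' f' phi a.
  congr (ev g _); apply/funext => K2; rewrite ev_exch.
  congr (ev g' _); apply/funext => K2'; congr (ev f _); apply/funext => K1.
  congr (ev f' _); apply/funext => K1'; congr phi.
  apply/funext => x; apply/funext => z; rewrite /ktens /kcomp sumL_cat sumL_mulr.
  apply: sumL_ext => y sy; rewrite sumL_mull; apply: sumL_ext => y' sy'.
  by rewrite take_cat drop_cat sy ltnn subnn take0 drop0 cats0 mulnACA.
- by [].
- by move=> k l k' l' f g g' phi a; rewrite -ev_add.
- by [].
- by move=> k l k' l' a f g phi _; rewrite -ev_scale.
- by move=> s phi a; exact: spider11.
- by move=> s phi a; exact: spider00.
- by move=> s k1 l1 k2 l2 m m0 phi a; exact: (@ev_fuse s k1 l1 k2 l2 m phi m0 a).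
- by move=> phi a; exact: spider02.
- by move=> phi a; exact: spider_bw.
Qed.
End Model.

(** * Coefficients and kernels of morphisms *)

Section Phi.
Variables (C : numClosedFieldType) (anti : bool) (t : C).
Hypothesis t0 : t != 0.
Hypothesis star_t2 : star anti (t ^+ 2) = t ^+ 2.
Local Notation d := (t ^+ 2).
Local Notation N := (d ^+ 2).
Local Notation um := (um anti N).
Local Notation uid := (uid anti N).
Local Notation H := (bhom anti N).
Local Notation sp := (sp anti N).
Local Notation "g '**' f" := (ucomp g f) (at level 45, right associativity).
Local Notation S s := (sp s 2 2).
Local Notation cup := (sp false 0 2).
Local Notation cap := (sp false 2 0).
Local Notation adm := (adm t).
Local Notation wt := (wt t).

Definition mev k l (f : H k l) (phi : kern -> C) : C := ev t (brepr f) phi.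

Lemma mev_pi k l (u : term C k l) phi : adm k l phi ->
  mev (bpi anti N u) phi = ev t u phi.
Proof. by move=> a; apply: (ev_sound t0 star_t2 _ a); exact: brepr_pi. Qed.

Definition phiR k l (R : crel k l) (K : kern) : C :=
  wt (K (zs k) (zs l)) * (supp k l K == R)%:R.

Lemma adm_phiR k l (R : crel k l) : adm k l (phiR R).
Proof. by exists (fun R' => (R' == R)%:R). Qed.

(** The coefficient of a relation in a morphism. Kernels with closed curves
    contribute through their weight. *)
Definition Phi k l (f : H k l) (R : crel k l) : C := mev f (phiR R).

(** The evaluation is linear in the functional, which is a combination of the
    [phiR R]. *)
Lemma mev_Phi k l (f : H k l) (phi : kern -> C) g :
  (forall K, good k l K -> phi K = wt (K (zs k) (zs l)) * g (supp k l K)) ->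
  mev f phi = \sum_R Phi f R * g R.
Proof.
move=> E; rewrite /mev.
transitivity (ev t (brepr f) (fun K => \sum_R g R * phiR R K)).
  apply: ev_good => K gK; rewrite E // (bigD1 (supp k l K)) //= big1 ?addr0.
    by rewrite /phiR eqxx mulr1 mulrC.
  by move=> R /negPf nR; rewrite /phiR eq_sym nR !mulr0.
rewrite ev_sum; apply: eq_bigr => R _.
by rewrite ev_scale mulrC.
Qed.

Lemma Phi_add k l (f g : H k l) R : Phi (f + g) R = Phi f R + Phi g R.
Proof.
rewrite /Phi -{1}(breprK f) -{1}(breprK g) add_pi mev_pi //; exact: adm_phiR.
Qed.
Lemma Phi_scale k l a (f : H k l) R : Phi (a *: f) R = a * Phi f R.
Proof.
rewrite /Phi -{1}(breprK f) scale_pi mev_pi //; exact: adm_phiR.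
Qed.
Lemma Phi0 k l R : Phi (0 : H k l) R = 0.
Proof. by rewrite -(scale0r (0 : H k l)) Phi_scale mul0r. Qed.
Lemma Phi_sum k l (J : Type) (r : seq J) (P : pred J) (F : J -> H k l) R :
  Phi (\sum_(j <- r | P j) F j) R = \sum_(j <- r | P j) Phi (F j) R.
Proof.
elim: r => [|j r IH]; first by rewrite !big_nil Phi0.
by rewrite !big_cons; case: (P j); rewrite ?Phi_add IH.
Qed.

Lemma mev_comp k l m (g : H l m) (f : H k l) phi : adm k m phi ->
  mev (bcomp g f) phi = mev g (fun K2 => mev f (fun K1 => phi (kcomp l K2 K1))).
Proof. by move=> a; rewrite -[bcomp g f]/(bpi anti N (TComp (brepr g) (brepr f))) mev_pi. Qed.

Lemma mev_tens k l k' l' (f : H k l) (g : H k' l') phi : adm (k + k') (l + l') phi ->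
  mev (btens f g) phi = mev f (fun K => mev g (fun K' => phi (ktens k l K K'))).
Proof. by move=> a; rewrite -[btens f g]/(bpi anti N (TTens (brepr f) (brepr g))) mev_pi. Qed.

(** The middle colourings counted by [rcount] are the closed curves that arise
    when two relations are composed. *)
Lemma Phi_comp k l m (g : H l m) (f : H k l) R :
  Phi (bcomp g f) R = \sum_R2 \sum_R1
    Phi g R2 * Phi f R1 * (wt (rcount R2 R1) * (rcomp R2 R1 == R)%:R).
Proof.
rewrite {1}/Phi mev_comp; last exact: adm_phiR.
transitivity (mev g (fun K2 => \sum_R1 Phi f R1 * (wt (K2 (zs l) (zs m)) *
   (wt (rcount (supp l m K2) R1) * (rcomp (supp l m K2) R1 == R)%:R)))).
  apply: ev_good => K2 g2; apply: mev_Phi => K1 g1.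
  have rc := rcount_gt0 g2 g1; have [a1 _ _] := g1; have [a2 _ _] := g2.
  by rewrite /phiR comp_zs // !wtM ?muln_gt0 ?a1 // supp_comp mulrCA !mulrA.
rewrite (@mev_Phi _ _ _ _ (fun R2 => \sum_R1 Phi f R1 *
   (wt (rcount R2 R1) * (rcomp R2 R1 == R)%:R))) //.
  by apply: eq_bigr => R2 _; rewrite big_distrr; apply: eq_bigr => R1 _ /=; rewrite mulrA.
by move=> K _; rewrite big_distrr; apply: eq_bigr => R1 _ /=; rewrite mulrCA.
Qed.

Lemma Phi_tens k l k' l' (f : H k l) (g : H k' l') R :
  Phi (btens f g) R = \sum_R1 \sum_R2
    Phi f R1 * Phi g R2 * (rtens R1 R2 == R)%:R.
Proof.
rewrite {1}/Phi mev_tens; last exact: adm_phiR.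
transitivity (mev f (fun K => \sum_R2 Phi g R2 * (wt (K (zs k) (zs l)) *
   (rtens (supp k l K) R2 == R)%:R))).
  apply: ev_good => K gK; apply: mev_Phi => K' gK'.
  have [a _ _] := gK; have [a' _ _] := gK'.
  by rewrite /phiR tens_zs wtM // supp_tens mulrCA !mulrA.
rewrite (@mev_Phi _ _ _ _ (fun R1 => \sum_R2 Phi g R2 * (rtens R1 R2 == R)%:R)) //.
  by apply: eq_bigr => R2 _; rewrite big_distrr; apply: eq_bigr => R1 _ /=; rewrite mulrA.
by move=> K _; rewrite big_distrr; apply: eq_bigr => R1 _ /=; rewrite mulrCA.
Qed.

Lemma Phi_dag k l (f : H k l) R :
  Phi (bdag f) R = eps anti t ^+ (k + l) * star anti (Phi f (rtr R)).
Proof.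
rewrite /Phi -{1}(breprK f) bdag_pi mev_pi; last exact: adm_phiR.
rewrite (ev_dag t0 star_t2); congr (_ * star anti _); apply: ev_good => K gK.
rewrite /phiR starM (star_wt star_t2) supp_tr; congr (_ * _).
have -> : (rtr (supp k l K) == R) = (supp k l K == rtr R).
  have rtrK a b (R' : crel a b) : rtr (rtr R') = R'.
    by apply/setP => -[x y]; rewrite !inE.
  by apply/eqP/eqP => [<-|->]; rewrite rtrK.
by case: eqP; rewrite ?star1 ?star0.
Qed.

Definition is_kern k l (f : H k l) (c : C) (K : kern) : Prop :=
  good k l K /\ forall phi, adm k l phi -> mev f phi = c * phi K.

Lemma is_kern_comp k l m (g : H l m) (f : H k l) c2 K2 c1 K1 :
  is_kern g c2 K2 -> is_kern f c1 K1 ->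
  is_kern (bcomp g f) (c2 * c1) (kcomp l K2 K1).
Proof.
move=> [g2 E2] [g1 E1]; split; first exact: good_comp.
move=> phi a; rewrite mev_comp // -mulrA.
transitivity (mev g (fun K2 => c1 * phi (kcomp l K2 K1))).
  apply: ev_good => K gK; rewrite E1 //; exact: (adm_comp a gK).
rewrite /mev ev_scale -/(mev _ _) E2; first by rewrite mulrCA.
exact: (adm_comp2 a g1).
Qed.

Lemma is_kern_tens k l k' l' (f : H k l) (g : H k' l') c K c' K' :
  is_kern f c K -> is_kern g c' K' -> is_kern (btens f g) (c * c') (ktens k l K K').
Proof.
move=> [g1 E1] [g2 E2]; split; first exact: good_tens.
move=> phi a; rewrite mev_tens // -mulrA.
transitivity (mev f (fun K => c' * phi (ktens k l K K'))).
  by apply: ev_good => K1 gK; rewrite E2 //; exact: (adm_tens a gK).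
rewrite /mev ev_scale -/(mev _ _) E1; first by rewrite mulrCA.
exact: (adm_tens2 a g2).
Qed.

Lemma is_kern_id k : is_kern (bid anti N k) 1 kid.
Proof. by split=> [|phi a]; [exact: good_id|rewrite mev_pi // mul1r]. Qed.

Lemma is_kern_sp s k l :
  is_kern (bpi anti N (TSpider s k l)) (scoef t k l) (kspider s).
Proof. by split=> [|phi a]; [exact: good_spider|rewrite mev_pi]. Qed.

Lemma is_kern_scale k l (f : H k l) c K a :
  is_kern f c K -> is_kern (a *: f) (a * c) K.
Proof.
move=> [g E]; split=> // phi ad; rewrite -(breprK f) scale_pi mev_pi //=.
by rewrite -/(mev f phi) E // mulrA.
Qed.

Lemma is_kern_eq k l (f : H k l) c c' K K' : c = c' -> is_kern f c K ->
  (forall x y, size x = k -> size y = l -> K x y = K' x y) ->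
  is_kern f c' K'.
Proof.
move=> <- [g E] EK.
have g' : good k l K'.
  have [a b e] := g; split; first by rewrite -EK ?size_zs.
    by move=> x y sx sy; rewrite -!EK ?size_zs //; exact: b.
  move=> x y x' y' sx sy sx' sy'.
  have sxx := size_xorl sx sx'; have syy := size_xorl sy sy'.
  by rewrite -(EK x y) // -(EK x' y') // -(EK _ _ sxx syy); exact: e.
split=> // phi ad; rewrite E //; congr (_ * _).
exact: (adm_eq ad g').
Qed.

Definition ukern (u : um) c K := is_kern (umor u) c K.

Lemma ukern_comp g f c2 K2 c1 K1 : ucod f = udom g ->
  ukern g c2 K2 -> ukern f c1 K1 -> ukern (g ** f) (c2 * c1) (kcomp (ucod f) K2 K1).
Proof.
move=> /eqP e.
case: (um_case g f) => [|[k [l [m [g1 [f1 [-> ->]]]]]]]; first by rewrite e.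
by rewrite -Um_comp; exact: is_kern_comp.
Qed.
Lemma ukern_wh i f j c K : ukern f c K ->
  ukern (wh i f j) c (ktens i i kid (ktens (udom f) (ucod f) K kid)).
Proof.
move=> kf; have -> : c = 1 * (c * 1) by rewrite mulr1 mul1r.
exact: (is_kern_tens (is_kern_id i) (is_kern_tens kf (is_kern_id j))).
Qed.
Lemma is_kern_typed k l u c K : udom u = k -> ucod u = l -> ukern u c K ->
  is_kern (typed k l u) c K.
Proof.
move=> <- <-; case: u => -[a b] f; rewrite -[existT _ _ _]/(Um f) /ukern.
by rewrite [typed _ _ _]typedK.
Qed.
Lemma ukern_sp s k l : ukern (sp s k l) (scoef t k l) (kspider s).
Proof. exact: is_kern_sp. Qed.

Lemma is_kern_Phi k l (f : H k l) c K : is_kern f c K ->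
  K (zs k) (zs l) = 1%N -> forall R, Phi f R = c * (supp k l K == R)%:R.
Proof.
move=> [g E] K1 R; rewrite /Phi E; last exact: adm_phiR.
by rewrite /phiR K1 /wt logn1 mul1r.
Qed.

End Phi.

(** * Kernels of the functionals of Dyck paths *)

(** The halves of one of the two Temperley-Lieb strands, read along a list of
    doubled strands. *)
Fixpoint alt (b : bool) (z : seq colour) : seq bool :=
  if z is p :: z' then (if b then p.2 else p.1) :: alt (~~ b) z' else [::].

Lemma alt_cat b x y : alt b (x ++ y) = alt b x ++ alt (b (+) odd (size x)) y.
Proof.
by elim: x b => [|p x IH] b /=; rewrite ?addbF // IH addNb addbN.
Qed.
Lemma size_alt b x : size (alt b x) = size x.
Proof. by elim: x b => //= p x IH b; rewrite IH. Qed.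

(** [respects h u st] holds when the colouring [u] is constant on the arcs of the
    pairing of the Dyck path [h]; the colours of the pending arcs are in the
    stack [st]. *)
Fixpoint respects (h u st : seq bool) : bool :=
  match h, u with
  | [::], [::] => nilp st
  | true :: h', a :: u' => respects h' u' (a :: st)
  | false :: h', a :: u' =>
      if st is s :: st' then (a == s) && respects h' u' st' else false
  | _, _ => false
  end.

(** At the new peak the two colours agree, and the arcs that met in the valley
    are joined, so that the colour [y] at the valley is summed over. *)
Lemma respects_raise c p q u a a' v st : dyck c (p ++ [:: D, U & q]) ->
  size st = c -> size u = size p ->
  respects (p ++ [:: U, D & q]) (u ++ [:: a, a' & v]) st =
  ((a == a') * \sum_(y : bool) respects (p ++ [:: D, U & q]) (u ++ [:: y, y & v]) st)%N
  :> nat.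
Proof.
elim: p c u st => [|b p IH] c [|x u] st //=.
- case: st => [|s st] /=; first by move=> + sc; rewrite -sc.
  move=> _ _ _; rewrite big_bool /= eq_sym.
  by case: eqP; case: s; case: (respects _ _ _).
- case: b => /=.
    by move=> dp sc [su]; rewrite (IH c.+1) //= sc.
  case/andP=> c0 dp sc [su]; case: st sc => [|s st] /= sc; first by rewrite -sc in c0.
  case: eqP => _ /=; last by rewrite big1 ?muln0.
  by rewrite (IH c.-1) // -sc.
Qed.

(** The first path is read on one family of halves and the second one on the
    other. *)
Definition kdd (h1 h2 : seq bool) : kern := fun z _ =>
  (respects h1 (alt true z) [::] * respects h2 (alt false z) [::])%N.

Lemma kcomp_wh i a b j (K Kx : kern) x1 x2 x3 z :
  size x1 = i -> size x2 = a -> size x3 = j ->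
  kcomp (i + (b + j)) Kx (ktens i i kid (ktens a b K kid)) (x1 ++ x2 ++ x3) z =
  sumL b (fun y => K x2 y * Kx (x1 ++ y ++ x3) z)%N.
Proof.
move=> s1 s2 s3; rewrite /kcomp sumL_cat.
rewrite -(sumL_delta (fun y1 => sumL b (fun y => K x2 y * Kx (y1 ++ y ++ x3) z)%N) s1).
apply: sumL_ext => y1 sy1; rewrite sumL_mull sumL_cat; apply: sumL_ext => y sy.
rewrite -(sumL_delta (fun y3 => (y1 == x1) * (K x2 y * Kx (y1 ++ y ++ y3) z))%N s3).
apply: sumL_ext => y3 sy3; rewrite /ktens.
rewrite !(take_size_cat _ s1) !(drop_size_cat _ s1) !(take_size_cat _ sy1).
rewrite !(drop_size_cat _ sy1) !(take_size_cat _ s2) !(drop_size_cat _ s2).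
rewrite !(take_size_cat _ sy) !(drop_size_cat _ sy) /kid [x1 == y1]eq_sym [x3 == y3]eq_sym.
by rewrite [RHS]mulnC !mulnA mulnAC.
Qed.

Lemma sumL2 (F : seq colour -> nat) :
  sumL 2 F = (\sum_(p : colour) \sum_(q : colour) F [:: p; q])%N.
Proof. by []. Qed.

Lemma big_colour (F : colour -> nat) :
  (\sum_(p : colour) F p = \sum_(u : bool) \sum_(v : bool) F (u, v))%N.
Proof. by rewrite pair_big; apply: eq_bigr => -[]. Qed.

Lemma dyck_ind_even n (P : seq bool -> Prop) : ~~ odd n ->
  P (zigzag n./2) ->
  (forall p q, dyck 0 (p ++ [:: D, U & q]) -> (size p + (size q).+2 = n)%N ->
     P (p ++ [:: D, U & q]) -> P (p ++ [:: U, D & q])) ->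
  forall h, dyck 0 h -> size h = n -> P h.
Proof. by move=> on; have := @dyck_ind n./2 P; rewrite even_halfK. Qed.

Section Kernels.
Variables (C : numClosedFieldType) (anti : bool) (t : C).
Hypothesis t0 : t != 0.
Hypothesis star_t2 : star anti (t ^+ 2) = t ^+ 2.
Local Notation d := (t ^+ 2).
Local Notation N := (d ^+ 2).
Local Notation um := (um anti N).
Local Notation uid := (uid anti N).
Local Notation H := (bhom anti N).
Local Notation sp := (sp anti N).
Local Notation "g '**' f" := (ucomp g f) (at level 45, right associativity).
Local Notation S s := (sp s 2 2).
Local Notation cup := (sp false 0 2).
Local Notation cap := (sp false 2 0).

Lemma d_n0 : d != 0. Proof. by rewrite sqrf_eq0. Qed.

Lemma ukern_caps m : ukern (ucaps anti N m) 1 (kdd (zigzag m) (zigzag m)).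
Proof.
elim: m => [|m IH].
  apply: (is_kern_eq (erefl 1) (is_kern_id t0 star_t2 0)) => x y.
  by move=> /size0nil -> /size0nil ->.
have kc : ukern cap 1 (kspider false).
  have -> : 1 = scoef t 2 0 by rewrite /scoef exprVn divff // d_n0.
  exact: ukern_sp.
have kw := ukern_wh t0 star_t2 0 m.*2 kc.
have := ukern_comp t0 star_t2 _ IH kw; rewrite ucod_wh udom_ucaps => /(_ erefl).
rewrite mulr1 => kk; apply: (is_kern_eq (erefl 1) kk) => x y.
rewrite udom_comp udom_wh udom_sp ucod_comp ucod_ucaps add0n.
case: x => [|p [|q x]] //= [sx] /size0nil ->.
rewrite -[p :: q :: x]/([::] ++ [:: p; q] ++ x).
rewrite ucod_sp (@kcomp_wh 0 2 0 m.*2 _ _ [::] [:: p; q] x) //=.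
rewrite /kspider !big_bool /kdd /=.
by case: p {kk} => [] [] []; case: q => [] [] [] /=; case: (respects _ (alt true x) _);
  case: (respects _ (alt false x) _).
Qed.

Lemma kspiderE2 e p q p' q' : kspider (~~ e) [:: p; q] [:: p'; q'] =
  (((if e then p.2 else p.1) == (if e then q.1 else q.2)) *
  (((if e then p'.2 else p'.1) == (if e then q'.1 else q'.2)) *
  (((if e then p.1 else p.2) == (if e then p'.1 else p'.2)) *
  ((if e then q.2 else q.1) == (if e then q'.2 else q'.1)))))%N.
Proof.
rewrite /kspider !big_bool.
by case: e; case: p => [] [] []; case: q => [] [] []; case: p' => [] [] [];
  case: q' => [] [] [].
Qed.

(** A generator cuts the curves of its own family at two neighbouring strands
    and rejoins them by a cup and a cap; the curves of the other family pass
    through the spider unchanged. *)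
Lemma tl_kern n b i (x : H n 0) (P Q : seq bool -> nat) : (i.+1 < n)%N ->
  is_kern x 1 (fun z _ => P (alt b z) * Q (alt (~~ b) z))%N ->
  is_kern (tl d (~~ b) i x) 1 (fun z _ =>
    let u := alt b z in
    (nth false u i == nth false u i.+1) *
    (\sum_(y : bool) P (take i u ++ [:: y, y & drop i.+2 u])) *
    Q (alt (~~ b) z))%N.
Proof.
move=> hi kx.
pose s := ~~ b (+) odd i.
have kS : ukern (S s) (scoef t 2 2) (kspider s) by exact: ukern_sp.
have kw := ukern_wh t0 star_t2 i (n - i - 2) kS.
have kx' : ukern (Um x) 1 (fun z _ => P (alt b z) * Q (alt (~~ b) z))%N by [].
have en : (i + (2 + (n - i - 2)) = n)%N by lia.
have := ukern_comp t0 star_t2 _ kx' kw; rewrite ucod_wh ucod_sp en.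
move=> /(_ erefl) kk.
have := is_kern_typed (k := n) (l := 0) _ _ kk.
rewrite udom_comp udom_wh udom_sp ucod_comp => /(_ en erefl).
move=> /(is_kern_scale t0 star_t2 d) k2.
apply: (is_kern_eq _ k2).
  rewrite mul1r /scoef exprVn mulrA -expr2 -[X in X / _]exprM.
  by rewrite divff // expf_neq0.
move=> z y sz _.
rewrite -(cat_take_drop i z) -[drop i z](cat_take_drop 2).
have sz1 : size (take i z) = i by rewrite size_takel // sz; lia.
have sz2 : size (take 2 (drop i z)) = 2%N by rewrite size_takel // size_drop sz; lia.
have sz3 : size (drop 2 (drop i z)) = (n - i - 2)%N by rewrite !size_drop sz.
move: (take i z) (take 2 (drop i z)) (drop 2 (drop i z)) sz1 sz2 sz3.
move=> z1 [|p [|q []]] // z3 sz1 _ sz3.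
have := @kcomp_wh i 2 2 (n - i - 2) (kspider s) (fun z _ => P (alt b z) * Q (alt (~~ b) z))%N
   z1 [:: p; q] z3 y sz1 erefl sz3.
rewrite en => ->; rewrite sumL2.
have E b' p' q' : alt b' (z1 ++ [:: p'; q'] ++ z3) = alt b' z1 ++
   [:: (if b' (+) odd i then p'.2 else p'.1), (if b' (+) odd i then q'.1 else q'.2)
     & alt (b' (+) odd i) z3].
  rewrite alt_cat sz1 /=; congr (_ ++ [:: _, _ & _]); last by rewrite negbK.
  by case: (b' (+) odd i).
rewrite !E /s addNb.
under eq_bigr => p' _ do under eq_bigr => q' _ do rewrite !E.
rewrite !nth_cat size_alt sz1 ltnn subnn /= ltnNge leqnSn /= subSnn /=.
have sa : size (alt b z1) = i by rewrite size_alt.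
rewrite take_size_cat // drop_cat sa ltnNge leqW //= subSn // subSnn /= drop0.
rewrite addNb; move: (b (+) odd i) => e.
under eq_bigr => p' _ do under eq_bigr => q' _ do rewrite kspiderE2.
rewrite !big_colour !big_bool !big_colour !big_bool.
by case: e; case: p => [] [] []; case: q => [] [] [] /=;
  rewrite ?mul0n ?mul1n ?muln0 ?addn0 ?add0n // mulnDl.
Qed.


Lemma wvec_raise n c (v : H n 0) p q : ~~ odd n -> dyck 0 (p ++ [:: D, U & q]) ->
  (size p + (size q).+2 = n)%N ->
  wvec d c (dyckword 0 0 (p ++ [:: U, D & q])) v =
  tl d c (size p) (wvec d c (dyckword 0 0 (p ++ [:: D, U & q])) v).
Proof.
move=> on dp sz.
apply: (@dvec_raise _ _ d n./2 (fun i => tl d c (n := n) i) d_n0) => //.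
  rewrite even_halfK // => i j x ij jn.
  by apply: tl_far => //; rewrite expf_neq0 // d_n0.
by rewrite even_halfK.
Qed.

(** Raising a path acts on colourings as a generator does, by
    [respects_raise], so the claim follows by raising both paths from the
    zigzag. *)
Lemma is_kern_dd n h1 h2 : ~~ odd n -> dyck 0 h1 -> size h1 = n ->
  dyck 0 h2 -> size h2 = n -> is_kern (dd anti N d n h1 h2) 1 (kdd h1 h2).
Proof.
move=> on dh1 sh1 dh2 sh2; have en := even_halfK on.
have step (c : bool) (x : H n 0) p q (Q : seq bool -> nat) : dyck 0 (p ++ [:: D, U & q]) ->
  (size p + (size q).+2 = n)%N ->
  is_kern x 1 (fun z _ => respects (p ++ [:: D, U & q]) (alt (~~ c) z) [::] *
                          Q (alt c z))%N ->
  is_kern (tl d c (size p) x) 1 (fun z _ =>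
     respects (p ++ [:: U, D & q]) (alt (~~ c) z) [::] * Q (alt c z))%N.
  move=> dp sz kx.
  have hi : ((size p).+1 < n)%N by lia.
  have := @tl_kern n (~~ c) (size p) x
    (fun u => respects (p ++ [:: D, U & q]) u [::] : nat) Q hi.
  rewrite negbK => /(_ kx) k2; apply: (is_kern_eq (erefl 1) k2) => z y sz' _ /=.
  congr (_ * _)%N; set u := alt _ z.
  have su : size u = n by rewrite size_alt.
  have Eu : u = take (size p) u ++
     [:: nth false u (size p), nth false u (size p).+1 & drop (size p).+2 u].
    rewrite -{1}(cat_take_drop (size p) u) (drop_nth false); last by lia.
    by rewrite (drop_nth false) //; lia.
  rewrite [in RHS]Eu (respects_raise (c := 0)) // size_takel //; lia.
rewrite /dd; pose v := wvec d true (dyckword 0 0 h2) (caps anti N n).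
apply: (dyck_ind_even (P := fun h => is_kern (wvec d false (dyckword 0 0 h) v) 1
  (kdd h h2)) on) => //; last first.
  move=> p q dp sz IH.
  by rewrite wvec_raise //; exact: (step false _ p q (fun u => respects h2 u [::] : nat)).
rewrite dyckword_zigzag /=.
apply: (is_kern_eq (K := fun z _ => (respects h2 (alt false z) [::] *
   respects (zigzag n./2) (alt true z) [::])%N) (erefl 1)); last first.
  by move=> x y _ _; rewrite /kdd mulnC.
rewrite /v; apply: (dyck_ind_even (P := fun h => is_kern
  (wvec d true (dyckword 0 0 h) (caps anti N n)) 1 (fun z _ =>
   (respects h (alt false z) [::] * respects (zigzag n./2) (alt true z) [::])%N)) on) => //; last first.
  move=> p q dp sz IH.
  rewrite wvec_raise //.
  exact: (step true _ p q (fun u => respects (zigzag n./2) u [::] : nat)).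
rewrite dyckword_zigzag /=.
have := ukern_caps n./2; rewrite -(@Um_caps _ anti N n on) /ukern /= => kc.
by apply: (is_kern_eq (erefl 1) kc) => x y _ _; rewrite /kdd mulnC.
Qed.

(** All points of a diagram, lower ones from left to right and then upper ones
    from right to left; the halves of a doubled strand are exchanged when it
    turns around. *)
Definition round (x y : seq colour) := x ++ rev (map swc y).

Definition kbas h1 h2 : kern := fun x y => kdd h1 h2 (round x y) [::].

(** Bending a strand up turns it over, which exchanges its halves. *)
Lemma unbend_kern k l (g : H k.+1 l) h1 h2 :
  is_kern g 1 (kbas h1 h2) -> is_kern (unbend g) 1 (kbas h1 h2).
Proof.
move=> kg.
have kc : ukern cup 1 (kspider false).
  have -> : 1 = scoef t 0 2 by rewrite /scoef exprVn divff // d_n0.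
  exact: ukern_sp.
have kw := ukern_wh t0 star_t2 k 0 kc.
have kg' : ukern (Um g) 1 (kbas h1 h2) by [].
have kw' := ukern_wh t0 star_t2 0 1 kg'.
have E : ucod (wh k cup 0) = udom (wh 0 (Um g) 1).
  by rewrite ucod_wh udom_wh ucod_sp addn0 add0n addn2 addn1.
have kk := ukern_comp t0 star_t2 E kw' kw.
have := is_kern_typed (k := k) (l := l.+1) _ _ kk.
rewrite udom_comp udom_wh udom_sp ucod_comp ucod_wh !addn0 add0n addn1 mulr1.
move=> /(_ erefl erefl) k2; apply: (is_kern_eq (erefl 1) k2) => x y sx sy.
rewrite ucod_wh ucod_sp.
case/lastP: y sy => [//|y q]; rewrite size_rcons => -[sy].
have := @kcomp_wh k 0 2 0 (kspider false)
  (ktens 0 0 kid (ktens k.+1 l (kbas h1 h2) kid)) x [::] [::] (rcons y q) sx erefl erefl.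
rewrite !cats0 => ->; rewrite sumL2.
have F (p q' : colour) : ktens 0 0 kid (ktens k.+1 l (kbas h1 h2) kid)
    (x ++ [:: p; q'] ++ [::]) (rcons y q) =
    (kbas h1 h2 (rcons x p) y * (q' == q))%N.
  rewrite /ktens !take0 !drop0 /kid mul1n cats0.
  have -> : x ++ [:: p; q'] = rcons x p ++ [:: q'] by rewrite cat_rcons.
  rewrite -[rcons y q]cats1 !take_size_cat ?drop_size_cat ?size_rcons ?sx ?sy //.
  by rewrite eqseq_cons eqxx andbT.
under eq_bigr => p _ do under eq_bigr => q' _ do rewrite F.
have R : kbas h1 h2 x (rcons y q) = kbas h1 h2 (rcons x (swc q)) y.
  by rewrite /kbas /round map_rcons rev_rcons cat_rcons.
rewrite R !big_colour !big_bool !big_colour !big_bool /kspider !big_bool.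
case: q {R F} => [] [] [] /=; rewrite ?mul0n ?muln0 ?mul1n ?muln1 ?addn0 ?add0n //.
Qed.

(** Even morphisms interpreted by a pair of Dyck paths. *)
Definition basic k l (f : H k l) := even_mor f /\ exists h1 h2,
  [/\ dyck 0 h1 /\ size h1 = (k + l)%N, dyck 0 h2 /\ size h2 = (k + l)%N &
      is_kern f 1 (kbas h1 h2)].

Inductive combo k l : H k l -> Prop :=
| combo0 : combo 0
| comboD a f g : basic f -> combo g -> combo (a *: f + g).

(** The functional of the two paths with strands bent up. *)
Lemma basic_exists k l h1 h2 : ~~ odd (k + l) ->
  dyck 0 h1 -> size h1 = (k + l)%N -> dyck 0 h2 -> size h2 = (k + l)%N ->
  exists f : H k l, even_mor f /\ is_kern f 1 (kbas h1 h2).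
Proof.
elim: l k => [|l IH] k; last first.
  rewrite addnS -addSn => ok d1 s1 d2 s2; have [f [ef kf]] := IH _ ok d1 s1 d2 s2.
  by exists (unbend f); split; [exact: even_unbend|exact: unbend_kern].
rewrite addn0 => ok d1 s1 d2 s2; exists (dd anti N d k h1 h2); split.
  exact: even_dd.
apply: (is_kern_eq (erefl 1) (is_kern_dd ok d1 s1 d2 s2)) => x y _ /size0nil ->.
by rewrite /kbas /round cats0.
Qed.

Hypothesis starN : star anti N = N.
Lemma N_n0 : N != 0. Proof. by rewrite expf_neq0 // d_n0. Qed.

(** Bend all strands down, expand, and bend them up again. *)
Lemma even_combo k l (f : H k l) : even_mor f -> combo f.
Proof.
elim: l k f => [|l IH] k f ef; last first.
  have := IH _ _ (even_bend ef); rewrite -[X in _ -> combo X]bendK.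
  elim=> [|a g g' [eg [h1 [h2 [hh1 hh2 kg]]]] _ IHg]; first by rewrite unbend0; exact: combo0.
  rewrite unbendD unbendZ; apply: comboD => //; split; first exact: even_unbend.
  by exists h1, h2; rewrite addnS -addSn; split=> //; exact: unbend_kern.
have [c ->] := even_expand N_n0 starN (erefl N) ef.
elim: (index_enum _) => [|p r IHr]; first by rewrite big_nil; exact: combo0.
rewrite big_cons; case: ifP => // /andP[d1 d2].
apply: comboD => //; split; first exact: even_dd.
exists p.1, p.2; rewrite !size_tuple addn0; split=> //.
have ok : ~~ odd k.
  by have := dyck_odd_height (c := 0) (p := p.1) (q := [::]);
     rewrite cats0 => /(_ d1); rewrite size_tuple addFb => <-;
     have := dyck_cat (c := 0) (p := p.1) (q := [::]);
     rewrite cats0 => /(_ d1) /= /eqP ->.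
have := is_kern_dd ok d1 (size_tuple _) d2 (size_tuple _).
move=> kk; apply: (is_kern_eq (erefl 1) kk) => x y _ /size0nil ->.
by rewrite /kbas /round cats0.
Qed.

Lemma even_odd0 k l (f : H k l) : even_mor f -> odd (k + l) -> f = 0.
Proof.
move=> /even_combo; elim=> // a g g' [_ [h1 [h2 [[d1 s1] _ _]]]] _ IH okl.
have := dyck_odd_height (c := 0) (p := h1) (q := [::]).
rewrite cats0 => /(_ d1); rewrite s1 okl.
by have := dyck_cat (c := 0) (p := h1) (q := [::]);
     rewrite cats0 => /(_ d1) /= /eqP ->.
Qed.

End Kernels.

Local Close Scope ring_scope.

(** * Non-crossing pairings and Dyck paths *)

(** Non-crossing pairings of the numbers below [n]. *)
Definition ncfun (n : nat) (f : nat -> nat) : Prop :=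
  (forall i, i < n -> [/\ f i < n, f (f i) = i & f i <> i]) /\
  (forall i j, j < n -> i < j -> j < f i -> f i < f j -> False).

Definition openers n (f : nat -> nat) : seq bool := mkseq (fun i => i < f i) n.

(** The openers of the arcs that are open when position [i] is reached, the
    innermost first; this is the stack of [respects]. *)
Definition pending (f : nat -> nat) i := rev [seq j <- iota 0 i | i <= f j].

Lemma pending_U n f i : ncfun n f -> i < n -> i < f i ->
  pending f i.+1 = i :: pending f i.
Proof.
move=> [h1 h2] hi hU; rewrite /pending -addn1 iotaD filter_cat /= add0n addn1 hU.
rewrite rev_cat /=; congr (_ :: rev _); apply: eq_in_filter => j.
rewrite mem_iota /= add0n => ji; have [fj ffj fn] := h1 j (ltn_trans ji hi).
have ne : f j <> i by move=> e; move: hU; rewrite -e ffj; lia.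
by apply/idP/idP; lia.
Qed.

Lemma pending_D n f i : ncfun n f -> i < n -> f i < i ->
  pending f i = f i :: pending f i.+1.
Proof.
move=> [h1 h2] hi hD; have [fi ffi fn] := h1 i hi.
have no j : f i < j -> j < i -> (i <= f j) = false.
  move=> a b; apply/negP => c; have [fj ffj fnj] := h1 j (ltn_trans b hi).
  have ne : f j <> i by move=> E; rewrite -E ffj in a; lia.
  by apply: (h2 (f i) j) => //; rewrite ?ffi; lia.
have E k : (forall j, j < f i -> (k <= f j) = (i <= f j)) -> i <= k -> forall n1,
   i <= n1 -> n1 <= k ->
   [seq j <- iota 0 n1 | k <= f j] =
   [seq j <- iota 0 (f i) | i <= f j] ++ (if k <= i then [:: f i] else [::]) ++
   [seq j <- iota i (n1 - i) | k <= f j].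
  move=> ek ik n1 in1 n1k.
  have -> : n1 = f i + (1 + (i - f i - 1 + (n1 - i))) by lia.
  rewrite iotaD filter_cat add0n; congr (_ ++ _).
    by apply: eq_in_filter => j; rewrite mem_iota add0n /= => /ek.
  rewrite iotaD filter_cat /= ffi; congr (_ ++ _).
  rewrite iotaD filter_cat.
  have -> : f i + 1 + (i - f i - 1) = i by lia.
  have -> : f i + (1 + (i - f i - 1 + (n1 - i))) - i = n1 - i by lia.
  rewrite -[RHS]cat0s; congr (_ ++ _); apply/eqP; rewrite -size_eq0 size_filter.
  rewrite -leqn0 leqNgt -has_count; apply/hasPn => j; rewrite mem_iota => hj.
  have := no j; lia.
have e1 j : j < f i -> (i.+1 <= f j) = (i <= f j).
  move=> jf; have [fj ffj fnj] := h1 j (ltn_trans jf fi).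
  have ne : f j <> i by move=> e; rewrite -e ffj in jf; lia.
  by apply/idP/idP; lia.
have E1 := E i (fun j _ => erefl) (leqnn i) i (leqnn i) (leqnn i).
have E2 := E i.+1 e1 (leqnSn i) i.+1 (leqnSn i) (leqnn _).
rewrite /pending E1 E2 subnn leqnn ltnn subSnn [iota i 0]/= [iota i 1]/=.
by rewrite [filter _ [:: i]]/= ltnNge (ltnW hD) !cats0 rev_cat.
Qed.

(** When position [i] is reached, the stack holds the colours of the pending
    openers. *)
Lemma openers_inv n f z i : ncfun n f -> size z = n -> i <= n ->
  dyck (size (pending f i)) (drop i (openers n f)) /\
  (respects (drop i (openers n f)) (drop i z) (map (nth false z) (pending f i)) <->
   forall j, i <= j -> j < n -> f j < j -> nth false z j = nth false z (f j)).
Proof.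
move=> nc sz; have [h1 h2] := nc; move Em : (n - i) => m.
elim: m i Em => [|m IH] i Em hi.
  have -> : i = n by lia.
  rewrite !drop_oversize ?size_mkseq ?sz //.
  have -> : pending f n = [::].
    apply/nilP; rewrite /nilp size_rev size_filter -leqn0 leqNgt -has_count.
    by apply/hasPn => j; rewrite mem_iota add0n /= => /h1[]; lia.
  by split=> //; split=> // _ j; lia.
have lt : i < n by lia.
have [dI iI] := IH i.+1 ltac:(lia) lt.
have [fi ffi fn] := h1 i lt.
rewrite (drop_nth false) ?size_mkseq // (drop_nth false (s := z)) ?sz // nth_mkseq //.
case: (ltnP i (f i)) => hU.
  move: dI iI; rewrite (pending_U nc) //= => dI iI; split=> //.
  rewrite iI; split=> h j; last by move=> a b; apply: h; lia.
  by move=> a b c; apply: h => //; rewrite ltn_neqAle a andbT; apply/eqP => e; subst j; lia.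
have hD : f i < i by lia.
rewrite (pending_D nc) //=; split=> //; split.
  case/andP=> /eqP e /iI h j ij jn fj.
  by have [<- //|ne] := eqVneq i j; apply: h => //; lia.
move=> h; rewrite h // eqxx /=; apply/iI => j a; apply: h; lia.
Qed.

Lemma dyck_openers n f : ncfun n f -> dyck 0 (openers n f).
Proof.
move=> nc; have [+ _] := @openers_inv n f (nseq n false) 0 nc (size_nseq _ _) (leq0n n).
by rewrite drop0.
Qed.

Lemma respects_openers n f z : ncfun n f -> size z = n ->
  respects (openers n f) z [::] <-> forall j, j < n -> nth false z j = nth false z (f j).
Proof.
move=> nc sz; have [_ E] := openers_inv nc sz (leq0n n).
rewrite !drop0 in E; rewrite E; split=> [h j jn|h j _ jn _]; last exact: h.
have [fj ffj fn] := nc.1 j jn.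
case: (ltnP (f j) j) => [|le]; first exact: h.
by rewrite (h (f j)) // ffj //; lia.
Qed.

(** The pairing of a Dyck path with a valley turned into a peak. *)
Definition join (f : nat -> nat) i : nat -> nat := fun x =>
  if x == i then i.+1 else if x == i.+1 then i
  else if x == f i then f i.+1 else if x == f i.+1 then f i else f x.

(** If the arcs [f i < i] and [i + 1 < f (i + 1)] are replaced by an arc
    between [i] and [i + 1] and an arc between the outer ends, then the latter
    encloses the former and no crossing arises. *)
Lemma ncfun_join n f i : ncfun n f -> i.+1 < n -> f i < i -> i.+1 < f i.+1 ->
  ncfun n (join f i).
Proof.
move=> [h1 h2] hi hD hU; have [fi ffi fni] := h1 i (ltnW hi).
have [fj ffj fnj] := h1 i.+1 hi.
have inj x : x < n -> f x = i -> x = f i by move=> xn <-; have [] := h1 x xn.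
have inj' x : x < n -> f x = i.+1 -> x = f i.+1 by move=> xn <-; have [] := h1 x xn.
have inj2 x : x < n -> f x = f i -> x = i.
  by move=> xn E; have [_ <- _] := h1 x xn; rewrite E ffi.
have inj2' x : x < n -> f x = f i.+1 -> x = i.+1.
  by move=> xn E; have [_ <- _] := h1 x xn; rewrite E ffj.
have ji : join f i i = i.+1 by rewrite /join eqxx.
have ji1 : join f i i.+1 = i by rewrite /join eqxx; case: eqP => //; lia.
have ja : join f i (f i) = f i.+1.
  by rewrite /join eqxx; do 2![case: eqP => [|_]; first by lia].
have jb : join f i (f i.+1) = f i.
  by rewrite /join eqxx; do 3![case: eqP => [|_]; first by lia].
have jo x : x <> i -> x <> i.+1 -> x <> f i -> x <> f i.+1 -> join f i x = f x.
  by move=> *; rewrite /join; do 4![case: eqP => // _].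
split=> [x xn|x y yn xy].
  have [fx ffx fnx] := h1 x xn.
  case: (x =P i) => [->|xi]; first by rewrite ji ji1; split; lia.
  case: (x =P i.+1) => [->|xi1]; first by rewrite ji1 ji; split; lia.
  case: (x =P f i) => [->|xf]; first by rewrite ja jb; split; lia.
  case: (x =P f i.+1) => [->|xf']; first by rewrite jb ja; split; lia.
  rewrite (jo x) // jo //; first by move=> /inj; auto.
  - by move=> /inj'; auto.
  - by move=> /inj2; auto.
  - by move=> /inj2'; auto.
have xn : x < n by lia.
have [fx ffx fnx] := h1 x xn; have [fy ffy fny] := h1 y yn.
case: (x =P i) => [E|xi]; first by rewrite E ji; lia.
case: (x =P i.+1) => [E|xi1]; first by rewrite E ji1; lia.
case: (y =P i) => [E|yi]; first by rewrite E ji; lia.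
case: (y =P i.+1) => [E|yi1]; first by rewrite E ji1; lia.
case: (x =P f i) => [xa|xa].
  rewrite xa ja => yb; case: (y =P f i.+1) => [E|nyb]; first by rewrite E jb; lia.
  rewrite jo //; last by lia.
  case: (ltnP y i) => yi'.
    move=> byf; apply: (h2 (f i) y) => //; rewrite ?ffi //; lia.
  move=> byf; apply: (h2 i.+1 y) => //; lia.
case: (x =P f i.+1) => [E|xb]; first by rewrite E jb; lia.
rewrite (jo x) //.
case: (y =P f i) => [yE|ya].
  rewrite yE ja => yfx fxb.
  have ne1 : f x <> i by move=> /(inj _ xn).
  have ne2 : f x <> i.+1 by move=> /(inj' _ xn).
  case: (ltnP (f x) i) => fxi; first by apply: (h2 x (f i)) => //; rewrite ?ffi //; lia.
  by apply: (h2 x i.+1) => //; lia.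
case: (y =P f i.+1) => [E|yb]; first by rewrite E jb; lia.
by rewrite jo //; exact: h2.
Qed.

Lemma nth_two (p q : seq bool) a b j :
  nth false (p ++ [:: a, b & q]) j = if j == size p then a
    else if j == (size p).+1 then b
    else nth false (p ++ [:: false, false & q]) j.
Proof.
rewrite !nth_cat; case: (ltngtP j (size p)) => [jp|pj|->]; last by rewrite subnn.
  by case: eqP => //; lia.
case: eqP => [->|ne]; first by rewrite subSnn.
by case E : (j - size p) => [|[|k]] //; lia.
Qed.

Lemma openers_join n f p q : ncfun n f -> (size p + (size q).+2 = n) ->
  openers n f = p ++ [:: D, U & q] ->
  [/\ f (size p) < size p, (size p).+1 < f (size p).+1 &
      openers n (join f (size p)) = p ++ [:: U, D & q]].
Proof.
move=> [h1 h2] sz E; set i := size p.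
have Eo j : j < n -> (j < f j) = nth false (p ++ [:: D, U & q]) j.
  by move=> jn; rewrite -E nth_mkseq.
have hi : i.+1 < n by rewrite /i; lia.
have [fi ffi fni] := h1 _ (ltnW hi); have [fj ffj fnj] := h1 _ hi.
have hD : f i < i by have := Eo _ (ltnW hi); rewrite nth_two eqxx; lia.
have hU : i.+1 < f i.+1.
  by have := Eo _ hi; rewrite nth_two eqxx; case: eqP; lia.
split=> //; apply: (@eq_from_nth _ false); first by rewrite size_mkseq size_cat /= sz.
move=> j; rewrite size_mkseq => jn; rewrite nth_mkseq // /join.
have := Eo j jn; rewrite (nth_two p q D U) => Ej; rewrite nth_two -/i.
case: eqP => [->|jp]; first by rewrite ltnSn.
case: eqP => [->|jp1]; first by lia.
move: Ej; rewrite -/i; case: eqP => // _; case: eqP => // _ <-.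
case: eqP => [->|_]; first by lia.
case: eqP => [->|_]; first by lia.
by [].
Qed.

(** A valley is turned into a peak by joining the two arcs that meet there. *)
Lemma openers_exists n h : ~~ odd n -> dyck 0 h -> size h = n ->
  exists f, ncfun n f /\ openers n f = h.
Proof.
move=> on dh sh; apply: (dyck_ind_even (P := fun h => exists f, ncfun n f /\
  openers n f = h) on) dh sh => [|p q dp sz [f [nf E]]].
  exists (fun i => if odd i then i.-1 else i.+1); split.
    split=> [i iN|i j jn ij].
      have oi1 : odd i.+1 = ~~ odd i by [].
      case: (boolP (odd i)) => oi; split; rewrite ?oi1 ?oi; by [lia|case: ifP; lia].
    by case: (boolP (odd i)) => oi; case: (boolP (odd j)) => oj; lia.
  rewrite -[in LHS](even_halfK on) /openers.
  elim: n./2 => [//|m IH]; rewrite doubleS.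
  have -> : m.*2.+2 = 2 + m.*2 by lia.
  rewrite /mkseq iotaD map_cat /= -IH; congr [:: _, _ & _].
  rewrite add0n (iotaDl 2 0) -map_comp; apply: eq_map => i /=.
  by rewrite negbK; case: (boolP (odd i)); lia.
have [hD hU E'] := openers_join nf sz E.
by exists (join f (size p)); split=> //; apply: ncfun_join => //; lia.
Qed.

(** * Diagrams as relations *)

Section Positions.
Variables k l : nat.
Implicit Types (e : pt k l) (p : ncpairing k l).

Lemma pos_lt e : pos e < k + l.
Proof.
case: e => [i|j] /=; first by rewrite ltn_addr.
by rewrite ltn_add2l; apply: (ltn_ord (rev_ord j)).
Qed.

(** The inverse of [pos]. *)
Definition atpos (i : 'I_(k + l)) : pt k l :=
  match fintype.split i with inl a => inl a | inr b => inr (rev_ord b) end.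

Lemma pos_atpos i : pos (atpos i) = i.
Proof.
rewrite /atpos; case: splitP => j ->; rewrite /pos //.
by rewrite rev_ordK.
Qed.

Lemma pos_inj : injective (@pos k l).
Proof.
case=> [i|i] [j|j]; rewrite /pos => h.
- by congr inl; apply: val_inj.
- by have := ltn_ord i; rewrite h ltnNge leq_addr.
- by have := ltn_ord j; rewrite -h ltnNge leq_addr.
- by congr inr; apply: (can_inj rev_ordK); apply: val_inj; apply: (addnI h).
Qed.

Lemma atposK e h : atpos (@Ordinal (k + l) (pos e) h) = e.
Proof. by apply: pos_inj; rewrite pos_atpos. Qed.

Definition pfun p (i : nat) : nat :=
  if insub i is Some j then pos (val p (atpos j)) else 0.

Lemma pfun_pos p e : pfun p (pos e) = pos (val p e).
Proof. by rewrite /pfun (insubT (fun i => i < k + l) (pos_lt e)) atposK. Qed.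

Lemma pos_surj i : i < k + l -> exists e, i = pos e.
Proof. by move=> h; exists (atpos (Ordinal h)); rewrite pos_atpos. Qed.

Lemma pairK p e : val p (val p e) = e.
Proof. by case: p => p /= /and3P[/forallP/(_ e)/eqP]. Qed.
Lemma pair_neq p e : val p e != e.
Proof. by case: p => p /= /and3P[_ /forallP/(_ e)]. Qed.

Lemma ncfun_pfun p : ncfun (k + l) (pfun p).
Proof.
split=> [i /pos_surj[e ->]|i j jn ij].
  rewrite !pfun_pos pairK pos_lt; split=> // /pos_inj E.
  by have := pair_neq p e; rewrite E eqxx.
have [e1 E1] := pos_surj (ltn_trans ij jn); have [e2 E2] := pos_surj jn.
rewrite {}E1 {}E2 in ij *; rewrite !pfun_pos => a b.
case: p a b => p /= /and3P[_ _ /forallP/(_ e1)/forallP/(_ e2)].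
by rewrite ij /= => + a b; rewrite a b.
Qed.

Definition opw p := openers (k + l) (pfun p).

Lemma ncpairing_of f : ncfun (k + l) f -> exists p, openers (k + l) f = opw p.
Proof.
move=> [h1 h2].
pose g : {ffun pt k l -> pt k l} := [ffun e =>
  odflt e (omap atpos (insub (f (pos e))))].
have gE e : pos (g e) = f (pos e).
  have [fi _ _] := h1 _ (pos_lt e).
  by rewrite ffunE (insubT (fun i => i < k + l) fi) /= pos_atpos.
have ng : is_ncpairing g.
  apply/and3P; split.
  - apply/forallP => e; apply/eqP/pos_inj; rewrite !gE.
    by have [] := h1 _ (pos_lt e).
  - apply/forallP => e; apply/eqP => E; have [_ _] := h1 _ (pos_lt e).
    by rewrite -gE E.
  - apply/forallP => e1; apply/forallP => e2; apply/negP => /and3P[].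
    by rewrite !gE => a b c; apply: (h2 (pos e1) (pos e2)) => //; exact: pos_lt.
exists (exist _ g ng); apply/eq_in_map => i; rewrite mem_iota add0n => /= hi.
by have [e ->] := pos_surj hi; rewrite pfun_pos /= gE.
Qed.

Lemma size_opw p : size (opw p) = k + l. Proof. exact: size_mkseq. Qed.
Lemma dyck_opw p : dyck 0 (opw p). Proof. exact/dyck_openers/ncfun_pfun. Qed.
Lemma opw_exists h : ~~ odd (k + l) -> dyck 0 h -> size h = k + l ->
  exists p, opw p = h.
Proof.
move=> o dh sh; have [f [nf <-]] := openers_exists o dh sh.
by have [p ->] := ncpairing_of nf; exists p.
Qed.

Lemma ncpairing_even p : ~~ odd (k + l).
Proof.
have := dyck_odd_height (c := 0) (p := opw p) (q := [::]).
rewrite cats0 size_opw => /(_ (dyck_opw p)) /= <-.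
have := dyck_cat (c := 0) (p := opw p) (q := [::]).
by rewrite cats0 => /(_ (dyck_opw p)) /= /eqP ->.
Qed.

Definition bicol (u : {ffun 'I_k -> bool}) (w : {ffun 'I_l -> bool}) e : bool :=
  match e with inl i => u i | inr j => w j end.
Definition monochrome p u w := [forall e, bicol u w (val p e) == bicol u w e].
Lemma monochromeP p u w : reflect (forall e, bicol u w (val p e) = bicol u w e) (monochrome p u w).
Proof. exact: eqfunP. Qed.

End Positions.

(** The halves seen by one of the two families of curves. The family uses the
    left and right halves alternately. *)
Definition hf b k (x : k.-tuple colour) : {ffun 'I_k -> bool} :=
  [ffun i : 'I_k => if b (+) odd i then (tnth x i).2 else (tnth x i).1].
Definition mix k (u w : {ffun 'I_k -> bool}) : k.-tuple colour :=
  [tuple (if odd i then (u i, w i) else (w i, u i)) | i < k].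

Lemma hf_mix b k (u w : {ffun 'I_k -> bool}) : hf b (mix u w) = if b then u else w.
Proof.
by apply/ffunP => i; rewrite ffunE tnth_mktuple; case: b; case: (odd i).
Qed.
Lemma mix_hf k (x : k.-tuple colour) : mix (hf true x) (hf false x) = x.
Proof.
apply: eq_from_tnth => i; rewrite tnth_mktuple !ffunE /=.
by case: (odd i); case: (tnth x i).
Qed.

Lemma nth_alt b z i : i < size z ->
  nth false (alt b z) i =
  let c := nth (false, false) z i in if b (+) odd i then c.2 else c.1.
Proof.
elim: z b i => //= p z IH b [|i]; first by rewrite addbF.
by rewrite ltnS => /IH E; rewrite /= E addNb addbN.
Qed.

(** Upper points are passed from right to left and upside down. As the number
    of points is even, the alternation of halves stays consistent. *)
Lemma alt_round k l b (x : k.-tuple colour) (y : l.-tuple colour) e : ~~ odd (k + l) ->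
  nth false (alt b (round x y)) (pos e) = bicol (hf b x) (hf b y) e.
Proof.
move=> o; have sz : size (round x y) = k + l.
  by rewrite size_cat size_rev size_map !size_tuple.
rewrite nth_alt ?sz ?pos_lt //= /round nth_cat size_tuple.
case: e => [i|j]; rewrite /pos /bicol ffunE.
  by rewrite ltn_ord (tnth_nth (false,false)).
rewrite ltnNge leq_addr /= addKn nth_rev size_map size_tuple; last exact: ltn_ord (rev_ord j).
have -> : l - (rev_ord j).+1 = j by have := ltn_ord j; rewrite /=; lia.
rewrite (nth_map (false, false)) ?size_tuple // (tnth_nth (false,false)).
have -> : odd (k + rev_ord j) = ~~ odd j.
  have := ltn_ord j; have -> : k + rev_ord j = k + l - j.+1 by rewrite /=; have := ltn_ord j; lia.
  by move=> h; rewrite oddB; [rewrite (negPf o)|lia].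
by rewrite addbN; case: (b (+) odd j).
Qed.

Lemma respects_opw k l (p : ncpairing k l) b (x : k.-tuple colour) (y : l.-tuple colour) :
  ~~ odd (k + l) ->
  respects (opw p) (alt b (round x y)) [::] = monochrome p (hf b x) (hf b y).
Proof.
move=> o; have sz : size (alt b (round x y)) = k + l.
  by rewrite size_alt size_cat size_rev size_map !size_tuple.
have E := respects_openers (ncfun_pfun p) sz.
apply/idP/monochromeP => [/E h e|h].
  by have := h _ (pos_lt e); rewrite pfun_pos !alt_round.
by apply/E => j /pos_surj[e ->]; rewrite pfun_pos !alt_round.
Qed.

(** Two pairings give one relation on doubled strands, the first acting on the
    family [true] and the second on the family [false]. *)
Definition Rel k l (p : ncpairing k l * ncpairing k l) : crel k l :=
  [set xy : k.-tuple colour * l.-tuple colour |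
    monochrome p.1 (hf true xy.1) (hf true xy.2) && monochrome p.2 (hf false xy.1) (hf false xy.2)].

Lemma supp_kbas k l (p : ncpairing k l * ncpairing k l) : ~~ odd (k + l) ->
  supp k l (kbas (opw p.1) (opw p.2)) = Rel p.
Proof.
move=> o; apply/setP => -[x y]; rewrite !inE /= /kbas /kdd.
by rewrite !respects_opw // muln_gt0 !lt0b.
Qed.

Lemma kbas_zs k l (p : ncpairing k l * ncpairing k l) : ~~ odd (k + l) ->
  kbas (opw p.1) (opw p.2) (zs k) (zs l) = 1.
Proof.
move=> o; rewrite /kbas /kdd.
have := respects_opw p.1 true (zt k) (zt l) o.
have := respects_opw p.2 false (zt k) (zt l) o.
have z b n : hf b (zt n) = [ffun=> false].
  apply/ffunP => i; rewrite !ffunE (tnth_nth (false,false)) nth_nseq ltn_ord.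
  by case: ifP.
have c0 e : bicol [ffun=> false] [ffun=> false] e = false :> bool.
  by case: e => j; rewrite /= ffunE.
have c1 (q : ncpairing k l) : monochrome q [ffun=> false] [ffun=> false] = true.
  by apply/monochromeP => e; rewrite !c0.
by rewrite !z !c1 => -> ->.
Qed.

(** * Stacking of pairings and composition of relations *)

Section Separation.
Variables k l : nat.
Implicit Types (r : ncpairing k l) (x y e : pt k l).

Lemma bicol_ffun (c : pt k l -> bool) e :
  bicol [ffun i => c (inl i)] [ffun j => c (inr j)] e = c e.
Proof. by case: e => j; rewrite /= ffunE. Qed.

(** The colouring that marks [x] and its partner separates them from all other
    points. *)
Lemma monochrome_sep r x y : (forall u w, monochrome r u w -> bicol u w x = bicol u w y) ->
  y = x \/ y = val r x.
Proof.
pose c e := (e == x) || (e == val r x).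
move=> h; have cx : c x by rewrite /c eqxx.
suff i : monochrome r [ffun i => c (inl i)] [ffun j => c (inr j)].
  by have := h _ _ i; rewrite !bicol_ffun cx => /esym/orP[/eqP|/eqP]; [left|right].
apply/monochromeP => e; rewrite !bicol_ffun /c orbC (can_eq (pairK r)); congr orb.
by rewrite -(can_eq (pairK r)) pairK.
Qed.

Lemma monochrome_inj r r' : (forall u w, monochrome r u w -> monochrome r' u w) -> r = r'.
Proof.
move=> h; apply/esym/val_inj/ffunP => e.
have [u w /h /monochromeP/(_ e)->|E|//] := @monochrome_sep r e (val r' e); first by [].
by have := pair_neq r' e; rewrite E eqxx.
Qed.

Definition c0 n : {ffun 'I_n -> bool} := [ffun=> false].

Lemma monochrome_0 r : monochrome r (c0 k) (c0 l).
Proof.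
have z e : bicol (c0 k) (c0 l) e = false by case: e => j; rewrite /= ffunE.
by apply/monochromeP => e; rewrite !z.
Qed.

End Separation.

Lemma hf_zt b n : hf b (zt n) = c0 n.
Proof.
apply/ffunP => i; rewrite !ffunE (tnth_nth (false,false)) nth_nseq ltn_ord.
by case: ifP.
Qed.

(** Each pairing is recovered from the relation by colouring the other family
    trivially. *)
Lemma Rel_inj k l : injective (@Rel k l).
Proof.
move=> p p' E; have h u w u' w' : monochrome p.1 u w && monochrome p.2 u' w' ->
    monochrome p'.1 u w && monochrome p'.2 u' w'.
  by have := congr1 (fun R : crel k l => (mix u u', mix w w') \in R) E; rewrite !inE /= !hf_mix => ->.
rewrite (surjective_pairing p) (surjective_pairing p'); congr pair; apply: monochrome_inj => u w.
  by have := h u w (c0 _) (c0 _); rewrite !monochrome_0 !andbT.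
by have := h (c0 _) (c0 _) u w; rewrite !monochrome_0.
Qed.

Section Stacking.
Variables (k l m : nat) (q : ncpairing l m) (p : ncpairing k l).
Local Notation st := (stack q p).

Definition tricol (u : {ffun 'I_k -> bool}) (v : {ffun 'I_l -> bool})
    (w : {ffun 'I_m -> bool}) (s : spt k l m) : bool :=
  match s with inl (inl i) => u i | inl (inr j) => v j | inr j => w j end.

Lemma tricol_below u v w x : tricol u v w (spt_below m x) = bicol u v x.
Proof. by case: x. Qed.
Lemma tricol_above u v w x : tricol u v w (spt_above k x) = bicol v w x.
Proof. by case: x. Qed.
Lemma tricol_outer u v w x : tricol u v w (spt_outer l x) = bicol u w x.
Proof. by case: x. Qed.
Lemma tricol_ffun (c : spt k l m -> bool) s :
  tricol [ffun i => c (inl (inl i))] [ffun j => c (inl (inr j))]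
    [ffun j => c (inr j)] s = c s.
Proof. by case: s => [[]|] j; rewrite /= ffunE. Qed.

Lemma stack_below x : st (spt_below m x) (spt_below m (val p x)).
Proof. by apply/orP; left; apply/existsP; exists x; rewrite !eqxx. Qed.
Lemma stack_above x : st (spt_above k x) (spt_above k (val q x)).
Proof. by apply/orP; right; apply/existsP; exists x; rewrite !eqxx. Qed.

Lemma stack_sym : symmetric st.
Proof.
suff h a b : st a b -> st b a by move=> a b; apply/idP/idP; exact: h.
case/orP => /existsP[x /andP[/eqP-> /eqP->]].
  by rewrite -{2}(pairK p x) stack_below.
by rewrite -{2}(pairK q x) stack_above.
Qed.

Lemma connect_stack_sym : connect_sym st.
Proof. exact/sym_connect_sym/stack_sym. Qed.

(** The colourings of a stacked diagram that are constant on both pairings are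
    those that are constant on its components. *)
Lemma tricol_inv u v w :
  (forall a b, connect st a b -> tricol u v w a = tricol u v w b) <->
  monochrome p u v && monochrome q v w.
Proof.
split=> [h|/andP[/monochromeP h1 /monochromeP h2] a b].
  apply/andP; split; apply/monochromeP => e.
    by rewrite -!(tricol_below u v w); apply/esym/h/connect1/stack_below.
  by rewrite -!(tricol_above u v w); apply/esym/h/connect1/stack_above.
move=> /(@closed_connect _ _ [pred s | tricol u v w s]); apply => {a b} a b /=.
case/orP => /existsP[x /andP[/eqP-> /eqP->]]; rewrite !inE.
  by rewrite !tricol_below h1.
by rewrite !tricol_above h2.
Qed.

(** In terms of relations, [r] is obtained by stacking; this form is provided
    by the composition of even morphisms, which is known to stay within the
    span of the relations of pairings. *)
Definition composes (r : ncpairing k m) : Prop := forall u w,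
  monochrome r u w = [exists v, monochrome p u v && monochrome q v w].

(** If [r] stacks [q] on [p] then every colouring invariant under the composed
    relation is invariant under [r], so [r] is [r0]. Conversely the indicator
    of the component of a point is an invariant colouring, and separates the
    point from whatever is not connected to it. *)
Lemma composes_stacking r0 r : composes r0 -> is_stacking q p r = (r == r0).
Proof.
move=> h; apply/forallP/eqP => [s|-> x].
  apply/esym/monochrome_inj => u w; rewrite h => /existsP[v /tricol_inv E].
  by apply/monochromeP => e; rewrite -!(tricol_outer u v w); apply/esym/E/s.
pose c s := connect st (spt_outer l x) s.
set u := [ffun i => c (inl (inl i))]; set v := [ffun j => c (inl (inr j))].
set w := [ffun j => c (inr j)].
have /tricol_inv E : forall a b, connect st a b -> tricol u v w a = tricol u v w b.
  by move=> a b ab; rewrite !tricol_ffun; exact: (same_connect_r connect_stack_sym ab).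
have /monochromeP/(_ x) : monochrome r0 u w by rewrite h; apply/existsP; exists v.
by rewrite -!(tricol_outer u v w) !tricol_ffun /c connect0.
Qed.

(** A colouring of the middle that extends the zero colouring of the outer
    points is a choice of a colour for each component without outer points. *)
Lemma card_loops :
  #|[set v | monochrome p (c0 k) v && monochrome q v (c0 m)]| = 2 ^ loops q p.
Proof.
set a := [pred v | [forall x, ~~ connect (stack q p) (spt_outer l x) v]].
set A := [set s | [predI roots st & a] s].
have inA s : (s \in A) = roots st s && [forall x, ~~ connect st (spt_outer l x) s].
  by rewrite inE.
have -> : loops q p = #|A| by rewrite cardsE; apply: eq_card => s; rewrite !inE.
rewrite -card_powerset; set Dv := [set v | _].
pose T v := tricol (c0 k) v (c0 m).
pose f v := [set s in A | T v s].
have Tout v x : T v (spt_outer l x) = false.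
  by rewrite /T tricol_outer; case: x => j; rewrite /= ffunE.
have rs s : connect st s (fingraph.root st s) by apply: connect_root.
have Dc v : v \in Dv -> forall s, T v s = (fingraph.root st s \in f v).
  rewrite inE => /tricol_inv h s; rewrite inE inA (roots_root connect_stack_sym).
  rewrite /T (h _ _ (rs s)) -/(T v _) andTb.
  case: forallP => // nx; apply/negbTE/negP => tr; apply: nx => x.
  by apply/negP => /h; rewrite -!/(T v _) Tout tr.
rewrite -(card_in_imset (f := f) (D := Dv)); last first.
  move=> v v' vD vD' E; apply/ffunP => j.
  by rewrite -[LHS]/(T v (inl (inr j))) -[RHS]/(T v' (inl (inr j))) !Dc // E.
apply: eq_card => S; rewrite powersetE; apply/imsetP/idP => [[v _ ->]|SA].
  by apply/subsetP => s; rewrite !inE => /andP[].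
pose v : {ffun 'I_l -> bool} := [ffun j => fingraph.root st (inl (inr j)) \in S].
have out x : (fingraph.root st (spt_outer l x) \in S) = false.
  apply/negP => /(subsetP SA); rewrite !inE => /andP[_ /forallP/(_ x)].
  by rewrite rs.
have Tv s : T v s = (fingraph.root st s \in S).
  by case: s => [[]|] j; rewrite /T /= !ffunE //; [rewrite (out (inl j))|rewrite (out (inr j))].
exists v.
  rewrite inE; apply/tricol_inv => x y /(fingraph.rootP connect_stack_sym) E.
  by rewrite -!/(T v _) !Tv E.
apply/setP => s; rewrite !inE Tv; apply/idP/idP => [sS|/andP[/andP[/eqP-> _]]] //.
have := subsetP SA _ sS; rewrite !inE => /andP[rs' ->]; rewrite rs' /=.
by rewrite (eqP rs').
Qed.

End Stacking.

Section RelComp.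
Variables (k l m : nat).
Implicit Types (q : ncpairing l m * ncpairing l m) (p : ncpairing k l * ncpairing k l).

(** The two families are coloured independently. *)
Lemma mem_rcomp q p x z : ((x, z) \in rcomp (Rel q) (Rel p)) =
  [exists v, monochrome p.1 (hf true x) v && monochrome q.1 v (hf true z)] &&
  [exists v, monochrome p.2 (hf false x) v && monochrome q.2 v (hf false z)].
Proof.
rewrite inE /=; apply/existsP/andP => [[y]|[/existsP[v1 h1] /existsP[v2 h2]]].
  rewrite !inE /= => /andP[/andP[a1 a2] /andP[b1 b2]].
  by split; apply/existsP; [exists (hf true y)|exists (hf false y)]; apply/andP.
exists (mix v1 v2); rewrite !inE /= !hf_mix.
by case/andP: h1 => -> ->; case/andP: h2 => -> ->.
Qed.

Lemma Rel_composes q p r : rcomp (Rel q) (Rel p) = Rel r ->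
  composes q.1 p.1 r.1 /\ composes q.2 p.2 r.2.
Proof.
move=> E.
have h u w u' w' := congr1 (fun R : crel k m => (mix u u', mix w w') \in R) E.
have z1 (q1 : ncpairing l m) (p1 : ncpairing k l) :
    [exists v, monochrome p1 (c0 k) v && monochrome q1 v (c0 m)] = true.
  by apply/existsP; exists (c0 l); rewrite !monochrome_0.
split=> u w.
  have := h u w (c0 _) (c0 _); rewrite mem_rcomp inE /= !hf_mix z1 monochrome_0 !andbT.
  by move=> ->.
have := h (c0 _) (c0 _) u w; rewrite mem_rcomp inE /= !hf_mix z1 monochrome_0 /=.
by move=> ->.
Qed.

Lemma Rel_stacking q p r0 r : rcomp (Rel q) (Rel p) = Rel r0 ->
  (rcomp (Rel q) (Rel p) == Rel r) = is_stacking q.1 p.1 r.1 && is_stacking q.2 p.2 r.2.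
Proof.
move=> E; have [h1 h2] := Rel_composes E.
rewrite E (inj_eq (@Rel_inj _ _)) (composes_stacking _ h1) (composes_stacking _ h2).
by rewrite eq_sym.
Qed.

Lemma rcount_Rel q p : rcount (Rel q) (Rel p) = 2 ^ (loops q.1 p.1 + loops q.2 p.2).
Proof.
pose X := setX [set v | monochrome p.1 (c0 k) v && monochrome q.1 v (c0 m)]
               [set v | monochrome p.2 (c0 k) v && monochrome q.2 v (c0 m)].
have <- : #|X| = 2 ^ (loops q.1 p.1 + loops q.2 p.2) by rewrite cardsX !card_loops expnD.
pose f (y : l.-tuple colour) := (hf true y, hf false y).
rewrite -[RHS](@on_card_preimset _ _ f); last first.
  apply: onW_bij; exists (fun u => mix u.1 u.2) => [y|[u w]]; first exact: mix_hf.
  by rewrite /f !hf_mix.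
apply: eq_card => y; rewrite !inE /= !hf_zt.
by rewrite -!andbA; do !bool_congr.
Qed.

End RelComp.

Local Open Scope ring_scope.

(** * The interpretation is faithful on even morphisms *)

Section BendZero.
Variables (C : numClosedFieldType) (anti : bool) (N : C).
Local Notation H := (bhom anti N).
Local Notation "g '**' f" := (ucomp g f) (at level 45, right associativity).
Local Notation cap := (sp anti N false 2 0).

(** A property that is preserved by composition with even morphisms and by
    adding a strand is preserved by bending, which is injective. *)
Lemma bend_zero (Q : forall k l, H k l -> Prop) :
  N != 0 -> star anti N = N ->
  (forall k l m (g : H l m) (f : H k l), even_mor g -> even_mor f -> Q _ _ f ->
     Q _ _ (bcomp g f)) ->
  (forall k l (f : H k l), even_mor f -> Q _ _ f -> Q _ _ (btens f (bid anti N 1))) ->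
  (forall n (x : H n 0), even_mor x -> Q _ _ x -> x = 0) ->
  forall k l (f : H k l), even_mor f -> Q _ _ f -> f = 0.
Proof.
move=> N0 starN Qc Qt Q0 k l; elim: l k => [|l IH] k f ef Qf; first exact: Q0.
rewrite -(bendK f) (IH _ (bend f)) ?unbend0 //; first exact: even_bend.
pose uQ (u : um anti N) := Q _ _ (umor u).
have Qtyped a b u : udom u = a -> ucod u = b -> uQ u -> Q _ _ (typed a b u).
  move=> <- <-; case: u => -[a' b'] g; rewrite -[existT _ _ _]/(Um g) /uQ.
  by rewrite [typed _ _ _]typedK.
have dc : ucod (wh 0 (Um f) 1) = udom (wh l cap 0) by rewrite ucod_wh udom_wh /= addn1 addn2.
apply: Qtyped.
- by rewrite udom_comp udom_wh /= add0n addn1.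
- by rewrite ucod_comp ucod_wh /= !addn0.
have E : wh 0 (Um f) 1 = Um (btens f (bid anti N 1)) by rewrite /wh utens1l -Um_tens.
rewrite E in dc *.
have e1 : even_mor (btens f (bid anti N 1)) by apply: even_tens => //; exact: even_id.
have := ueven_wh l 0 (ueven_cap anti N).
case: (um_case (wh l cap 0) (Um (btens f (bid anti N 1)))) => [|].
  by rewrite dc eqxx.
case=> a [b [c [g [f' [Eg Ef]]]]] eg; rewrite Eg Ef -Um_comp.
have uQf : uQ (Um f') by rewrite -Ef; exact: Qt.
have uef : ueven (Um f') by rewrite -Ef.
rewrite Eg in eg; exact: Qc.
Qed.

End BendZero.

Section Faithful.
Variables (C : numClosedFieldType) (anti : bool) (t : C).
Hypothesis t0 : t != 0.
Hypothesis star_t2 : star anti (t ^+ 2) = t ^+ 2.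
Local Notation d := (t ^+ 2).
Local Notation N := (d ^+ 2).
Local Notation H := (bhom anti N).
Local Notation Phi := (Phi (t := t)).

Lemma starN : star anti N = N. Proof. by rewrite starX star_t2. Qed.

(** An even morphism is a combination of morphisms interpreted by pairs of
    Dyck paths, whose relations are those of pairings. *)
Lemma Phi_even k l (f : H k l) R : even_mor f -> Phi f R != 0 ->
  exists p, R = Rel p.
Proof.
case: (boolP (odd (k + l))) => [o|e] ef.
  by rewrite (even_odd0 t0 star_t2 starN ef o) (Phi0 t0 star_t2) eqxx.
elim: (even_combo t0 star_t2 starN ef) => [|a g g' [_ [h1 [h2 [[d1 s1] [d2 s2] kg]]]] _ IH].
  by rewrite (Phi0 t0 star_t2) eqxx.
rewrite (Phi_add t0 star_t2) (Phi_scale t0 star_t2).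
have [p1 E1] := opw_exists e d1 s1; have [p2 E2] := opw_exists e d2 s2.
rewrite -{}E1 -{}E2 in kg; rewrite (is_kern_Phi kg) ?(kbas_zs (p1, p2)) //.
rewrite (supp_kbas (p1, p2)) // mul1r.
case: (eqVneq (Rel (p1, p2)) R) => [<-|_]; first by exists (p1, p2).
by rewrite mulr0 add0r => /IH.
Qed.

Lemma Rel_exists k l (p : ncpairing k l * ncpairing k l) :
  exists f : H k l, even_mor f /\ forall R, Phi f R = (Rel p == R)%:R.
Proof.
have e := ncpairing_even p.1.
have [f [ef kf]] := basic_exists (h1 := opw p.1) (h2 := opw p.2) t0 star_t2 e
  (dyck_opw _) (size_opw _) (dyck_opw _) (size_opw _).
exists f; split=> // R.
by rewrite (is_kern_Phi kf) ?kbas_zs // supp_kbas // mul1r.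
Qed.

Lemma supp_kdd n h1 h2 : supp n 0 (kdd h1 h2) = supp n 0 (kbas h1 h2).
Proof.
apply/setP => -[x y]; rewrite !inE /= /kbas /round.
by rewrite (tuple0 y) /= cats0.
Qed.

Lemma kdd_zs n h1 h2 : kdd h1 h2 (zs n) (zs 0) = kbas h1 h2 (zs n) (zs 0).
Proof. by rewrite /kbas /round /= cats0. Qed.

(** For functionals this is the linear independence of distinct relations;
    bending reduces the general case to it. *)
Lemma Phi_inj k l (f : H k l) : even_mor f -> (forall R, Phi f R = 0) -> f = 0.
Proof.
apply: (bend_zero (Q := fun k l (f : H k l) => forall R, Phi f R = 0)
  (N_n0 t0) starN) => [{}k {}l m g {}f _ _ z R|{}k {}l {}f _ z R|n x ex z].
- rewrite (Phi_comp t0 star_t2) big1 // => R2 _; rewrite big1 // => R1 _.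
  by rewrite z mulr0 mul0r.
- rewrite (Phi_tens t0 star_t2) big1 // => R1 _; rewrite big1 // => R2 _.
  by rewrite z !mul0r.
case: (boolP (odd n)) => [o|e].
  by rewrite (even_odd0 t0 star_t2 starN ex) // addn0.
have [c Ex] := even_expand (N_n0 t0) starN (erefl N) ex.
have e0 : ~~ odd (n + 0) by rewrite addn0.
have ow h : dyck 0 h -> size h = n -> exists p : ncpairing n 0, opw p = h.
  by move=> dh sh; apply: opw_exists; rewrite ?addn0.
have PhiR (p : n.-tuple bool * n.-tuple bool) R : dyck 0 p.1 && dyck 0 p.2 ->
    Phi (dd anti N d n p.1 p.2) R = (supp n 0 (kbas p.1 p.2) == R)%:R.
  case/andP=> d1 d2; have kp := is_kern_dd t0 star_t2 e d1 (size_tuple _) d2 (size_tuple _).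
  rewrite (is_kern_Phi kp) ?mul1r ?supp_kdd // kdd_zs.
  have [p1 E1] := ow _ d1 (size_tuple _); have [p2 E2] := ow _ d2 (size_tuple _).
  by rewrite -E1 -E2 (kbas_zs (p1, p2)).
rewrite Ex big1 // => p dp; move: (z (supp n 0 (kbas p.1 p.2))).
rewrite Ex (Phi_sum t0 star_t2) (bigD1 p) //= (Phi_scale t0 star_t2) PhiR // eqxx mulr1.
rewrite big1 ?addr0 => [->|p' /andP[dp' ne]]; first by rewrite scale0r.
rewrite (Phi_scale t0 star_t2) PhiR //; case: eqP => E; last by rewrite mulr0.
case/eqP: ne; move: dp dp' E => /andP[d1 d2] /andP[d1' d2'].
have [p1 E1] := ow _ d1 (size_tuple _); have [p2 E2] := ow _ d2 (size_tuple _).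
have [p1' E1'] := ow _ d1' (size_tuple _); have [p2' E2'] := ow _ d2' (size_tuple _).
rewrite -E1 -E2 -E1' -E2' (supp_kbas (p1, p2)) // (supp_kbas (p1', p2')) // => /Rel_inj[].
move=> e1 e2; rewrite {}e1 in E1'; rewrite {}e2 in E2'.
rewrite (surjective_pairing p) (surjective_pairing p'); congr pair; apply: val_inj => /=.
  by rewrite -E1 -E1'.
by rewrite -E2 -E2'.
Qed.

End Faithful.

(** * The isomorphism with the product of Temperley-Lieb categories *)

Lemma monochrome_id k (p : ncpairing k k) : id_pairing p <-> forall u w, monochrome p u w = (u == w).
Proof.
split=> [/forallP i u w|h].
  apply/monochromeP/eqP => [h|-> [j|j]].
  - by apply/ffunP => j; have := h (inl j); rewrite (eqP (i j)) => /esym.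
  - by rewrite (eqP (i j)).
  - by rewrite -(eqP (i j)) pairK (eqP (i j)).
apply/forallP => j; apply/eqP; have [u w|//|<-//] := @monochrome_sep _ _ p (inl j) (inr j).
by rewrite h => /eqP ->.
Qed.

Lemma supp_kid k (p : ncpairing k k * ncpairing k k) :
  (supp k k kid == Rel p) = id_pairing p.1 && id_pairing p.2.
Proof.
apply/eqP/andP => [E|[/monochrome_id h1 /monochrome_id h2]]; last first.
  apply/setP => -[x y]; rewrite !inE /= /kid h1 h2 lt0b.
  apply/eqP/andP => [/val_inj->|[/eqP e1 /eqP e2]]; first by rewrite !eqxx.
  by rewrite -(mix_hf x) -(mix_hf y) e1 e2.
have h u w u' w' : monochrome p.1 u w && monochrome p.2 u' w' = (u == w) && (u' == w').
  have := congr1 (fun R : crel k k => (mix u u', mix w w') \in R) E.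
  rewrite !inE /= !hf_mix /kid lt0b => <-; apply/eqP/andP => [e|[/eqP-> /eqP->] //].
  have {}e : mix u u' = mix w w' by apply: val_inj.
  by have := congr1 (@hf true k) e; have := congr1 (@hf false k) e; rewrite !hf_mix => -> ->; rewrite !eqxx.
split; apply/monochrome_id => u w.
  by have := h u w (c0 _) (c0 _); rewrite monochrome_0 eqxx !andbT.
by have := h (c0 _) (c0 _) u w; rewrite monochrome_0 eqxx.
Qed.

Lemma bicol_flip k l (p : pt k l) u w : bicol w u (pt_flip p) = bicol u w p.
Proof. by case: p. Qed.

Lemma pt_flipK k l : cancel (@pt_flip k l) (@pt_flip l k).
Proof. by case. Qed.

Lemma monochrome_flip k l (p : ncpairing k l) (r : ncpairing l k) :
  is_flip p r <-> forall u w, monochrome r w u = monochrome p u w.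
Proof.
split=> [/forallP f u w|h].
  apply/monochromeP/monochromeP => h e; last first.
    by rewrite -[e]pt_flipK (eqP (f _)) (bicol_flip _ u w) (bicol_flip _ u w) h.
  by have := h (pt_flip e); rewrite (eqP (f _)) !bicol_flip.
apply/forallP => x; have [w u i|E|->//] := @monochrome_sep _ _ r (pt_flip x) (pt_flip (val p x)).
  rewrite h in i; rewrite !bicol_flip; apply/esym; exact: (monochromeP _ _ _ i).
by have := pair_neq p x; rewrite -(inj_eq (can_inj (@pt_flipK k l))) E eqxx.
Qed.

Lemma rtr_Rel k l (p : ncpairing k l * ncpairing k l) (r : ncpairing l k * ncpairing l k) :
  rtr (Rel r) = Rel p ->
  forall p', is_flip p'.1 r.1 && is_flip p'.2 r.2 = (p' == p).
Proof.
move=> E p'.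
have h u w u' w' : monochrome p.1 u w && monochrome p.2 u' w' = monochrome r.1 w u && monochrome r.2 w' u'.
  have := congr1 (fun R : crel k l => (mix u u', mix w w') \in R) E.
  by rewrite !inE /= !hf_mix => ->.
have h1 u w : monochrome r.1 w u = monochrome p.1 u w.
  by have := h u w (c0 _) (c0 _); rewrite !monochrome_0 !andbT.
have h2 u w : monochrome r.2 w u = monochrome p.2 u w.
  by have := h (c0 _) (c0 _) u w; rewrite !monochrome_0.
apply/andP/eqP => [[/monochrome_flip f1 /monochrome_flip f2]|->].
  rewrite (surjective_pairing p) (surjective_pairing p'); congr pair; apply: monochrome_inj => u w.
    by rewrite -h1 f1.
  by rewrite -h2 f2.
by split; apply/monochrome_flip.
Qed.

Section Functor.
Variables (C : numClosedFieldType) (anti : bool) (t : C).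
Hypothesis t0 : t != 0.
Hypothesis star_t2 : star anti (t ^+ 2) = t ^+ 2.
Local Notation d := (t ^+ 2).
Local Notation N := (d ^+ 2).
Local Notation H := (bhom anti N).
Local Notation Phi := (Phi (t := t)).
Local Notation E := (NCBipartEven anti N).
Local Notation P := (of_basis anti (prod_cat (NCPair d) (NCPair d))).

Lemma wt_exp2 n : wt t (2 ^ n) = d ^+ n. Proof. by rewrite /wt pfactorK. Qed.

Lemma sum_Rel k l (f : H k l) (G : crel k l -> C) : even_mor f ->
  \sum_R Phi f R * G R = \sum_p Phi f (Rel p) * G (Rel p).
Proof.
move=> ef; rewrite (bigID (fun R => R \in codom (@Rel k l))) /= addrC big1 ?add0r; last first.
  move=> R /negP nR; have [->|/(Phi_even t0 star_t2 ef)[p E]] := eqVneq (Phi f R) 0.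
    by rewrite mul0r.
  by case: nR; rewrite E codom_f.
have U : uniq (codom (@Rel k l)) by rewrite (map_inj_uniq (@Rel_inj k l)) enum_uniq.
by rewrite -(big_uniq _ U) /= big_map big_enum.
Qed.

(** The composite of the even morphisms that realize [q] and [p] is even and
    has a single relation, so this relation comes from a pair of pairings. *)
Lemma rcomp_Rel k l m (q : ncpairing l m * ncpairing l m) (p : ncpairing k l * ncpairing k l) :
  exists r, rcomp (Rel q) (Rel p) = Rel r.
Proof.
have [g [eg Eg]] := Rel_exists t0 star_t2 q.
have [f [ef Ef]] := Rel_exists t0 star_t2 p.
apply: (Phi_even t0 star_t2 (even_comp eg ef)); rewrite -/(bcomp g f).
rewrite (Phi_comp t0 star_t2) (bigD1 (Rel q)) //= [X in _ + X]big1 ?addr0 => [|R ne]; last first.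
  by rewrite big1 // => R' _; rewrite Eg eq_sym (negPf ne) !mul0r.
rewrite (bigD1 (Rel p)) //= [X in _ + X]big1 ?addr0 => [|R ne]; last first.
  by rewrite Ef eq_sym (negPf ne) mulr0 mul0r.
by rewrite Eg Ef !eqxx !mul1r mulr1 rcount_Rel /wt expf_neq0 // d0.
Qed.

Definition coords k l (f : ehom anti N k l) : ldhom P k l := [ffun p => Phi f (Rel p)].

Lemma coords_linear k l : linear (@coords k l).
Proof.
move=> a f g; apply/ffunP => p; rewrite !ffunE /=.
by rewrite (Phi_add t0 star_t2) (Phi_scale t0 star_t2).
Qed.

Definition coordsL k l : {linear ldhom E k l -> ldhom P k l} :=
  HB.pack (@coords k l) (GRing.isLinear.Build _ _ _ _ (@coords k l) (@coords_linear k l)).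

Lemma coords_id k : coords (ldid E k) = ldid P k.
Proof.
apply/ffunP => p; rewrite !ffunE /= -/(bid anti N k).
by rewrite (is_kern_Phi (is_kern_id t0 star_t2 k)) ?mul1r ?supp_kid /kid ?eqxx // -natrM mulnb.
Qed.

(** The relation of a composite decides stacking, and the number of its middle
    colourings gives one factor [d] for each loop of either family. *)
Lemma coords_comp k l m (g : ldhom E l m) (f : ldhom E k l) :
  coords (ldcomp E g f) = ldcomp P (coords g) (coords f).
Proof.
apply/ffunP => r; rewrite !ffunE /= -/(bcomp g f) (Phi_comp t0 star_t2).
transitivity (\sum_R2 Phi g R2 * \sum_R1 Phi f R1 *
    (wt t (rcount R2 R1) * (rcomp R2 R1 == Rel r)%:R)).
  by apply: eq_bigr => R2 _; rewrite mulr_sumr; apply: eq_bigr => R1 _; rewrite -!mulrA.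
rewrite (sum_Rel _ (ehomP g)); apply: eq_bigr => q _.
rewrite (sum_Rel _ (ehomP f)) mulr_sumr; apply: eq_bigr => p _.
rewrite !ffunE -!mulrA; congr (_ * (_ * _)).
have [r0 E0] := rcomp_Rel q p; rewrite (Rel_stacking _ E0) rcount_Rel.
rewrite wt_exp2 -mulnb natrM; move: (loops _ _) (loops _ _) => n1 n2.
by rewrite exprD mulrC mulrACA -mulrA.
Qed.

(** The dagger transposes relations; the sign [eps] disappears because the
    total number of points is even. *)
Lemma coords_dag k l (f : ldhom E k l) : coords (lddag E f) = lddag P (coords f).
Proof.
apply/ffunP => r; rewrite !ffunE /= -/(bdag f) (Phi_dag t0 star_t2).
have ev : ~~ odd (k + l) by rewrite addnC; exact: ncpairing_even r.1.
rewrite eps_even // mul1r.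
have [g [eg Eg]] := Rel_exists t0 star_t2 r.
have [p Ep] : exists p, rtr (Rel r) = Rel p.
  apply: (Phi_even t0 star_t2 (even_dag eg)); rewrite -/(bdag g) (Phi_dag t0 star_t2).
  have -> : rtr (rtr (Rel r)) = Rel r by apply/setP => -[x y]; rewrite !inE.
  by rewrite Eg eqxx star1 mulr1 eps_even ?oner_eq0 // addnC.
rewrite Ep (bigD1 p) //= -natrM mulnb (rtr_Rel Ep) eqxx mulr1 ffunE big1 ?addr0 //.
by move=> p' ne; rewrite -natrM mulnb (rtr_Rel Ep) (negPf ne) mulr0.
Qed.

Lemma coords_bij k l : bijective (@coords k l).
Proof.
have inj (f g : ehom anti N k l) : coords f = coords g -> f = g.
  move=> h; apply/val_inj/eqP; rewrite -subr_eq0; apply/eqP/(Phi_inj t0 star_t2) => [|R].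
    by rewrite addrC -scaleN1r; apply: even_lin; exact: ehomP.
  have ed : even_mor (ehom_val f - ehom_val g).
    by rewrite addrC -scaleN1r; apply: even_lin; exact: ehomP.
  apply/eqP/negPn/negP => nz; have [p Ep] := Phi_even t0 star_t2 ed nz.
  case/negP: nz; rewrite Ep -scaleN1r (Phi_add t0 star_t2) (Phi_scale t0 star_t2).
  have := congr1 (fun c : {ffun _ -> C^o} => c p) h; rewrite !ffunE => ->.
  by rewrite mulN1r subrr.
have /choice[b bE] (p : ncpairing k l * ncpairing k l) :
    exists f : ehom anti N k l, forall R, Phi f R = (Rel p == R)%:R.
  by have [f [ef Ef]] := Rel_exists t0 star_t2 p; exists (EMor ef).
have rK : cancel (fun c : ldhom P k l => \sum_p c p *: b p) (@coords k l).
  move=> c; apply/ffunP => q; rewrite ffunE.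
  have -> : ehom_val (\sum_p c p *: b p) = \sum_p c p *: ehom_val (b p).
    by elim/big_ind2: _ => // _ u _ v <- <-.
  rewrite (Phi_sum t0 star_t2) (bigD1 q) //= (Phi_scale t0 star_t2) bE eqxx mulr1.
  rewrite big1 ?addr0 // => p ne; rewrite (Phi_scale t0 star_t2) bE.
  by rewrite (inj_eq (@Rel_inj _ _)) (negPf ne) mulr0.
by exists (fun c : ldhom P k l => \sum_p c p *: b p) => // f; apply: inj; exact: rK.
Qed.

Definition coordsF : functor E P := Functor (fmor := coordsL) coords_id coords_comp.

Lemma coordsF_iso : isomorphism coordsF /\ dagger coordsF.
Proof. by split=> [k l|k l f]; [exact: coords_bij|exact: coords_dag]. Qed.

End Functor.

(** * Juxtaposition *)

Section Juxtaposition.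
Variables (k l k' l' : nat).
Implicit Types (p : ncpairing k l) (q : ncpairing k' l') (r : ncpairing (k + k') (l + l')).

Definition lft m m' (u : {ffun 'I_(m + m') -> bool}) : {ffun 'I_m -> bool} :=
  [ffun i => u (lshift m' i)].
Definition rgt m m' (u : {ffun 'I_(m + m') -> bool}) : {ffun 'I_m' -> bool} :=
  [ffun i => u (rshift m i)].

Lemma bicol_left (u : {ffun 'I_(k + k') -> bool}) (w : {ffun 'I_(l + l') -> bool}) x : bicol u w (pt_left k' l' x) = bicol (lft u) (lft w) x.
Proof. by case: x => i; rewrite /= ffunE. Qed.
Lemma bicol_right (u : {ffun 'I_(k + k') -> bool}) (w : {ffun 'I_(l + l') -> bool}) x : bicol u w (pt_right k l x) = bicol (rgt u) (rgt w) x.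
Proof. by case: x => i; rewrite /= ffunE. Qed.

Lemma pt_cases (P : pt (k + k') (l + l') -> Prop) :
  (forall x, P (pt_left k' l' x)) -> (forall x, P (pt_right k l x)) -> forall x, P x.
Proof.
move=> hl hr [i|i]; case: (split_ordP i) => j ->.
- exact: (hl (inl j)). - exact: (hr (inl j)).
- exact: (hl (inr j)). - exact: (hr (inr j)).
Qed.

Lemma pt_left_inj : injective (@pt_left k l k' l').
Proof. by case=> i [] j //= [E]; congr (_ _); apply: val_inj. Qed.
Lemma pt_right_inj : injective (@pt_right k l k' l').
Proof. by case=> i [] j //= [/addnI E]; congr (_ _); apply: val_inj. Qed.

(** A colouring of a juxtaposition is a pair of colourings. *)
Lemma monochrome_juxtaposition p q r : is_juxtaposition p q r <->
  forall u w, monochrome r u w = monochrome p (lft u) (lft w) && monochrome q (rgt u) (rgt w).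
Proof.
split=> [/andP[/forallP hl /forallP hr] u w|h].
  apply/monochromeP/andP => [h|[/monochromeP h1 /monochromeP h2]].
    split; apply/monochromeP => e.
      by have := h (pt_left k' l' e); rewrite (eqP (hl e)) !bicol_left.
    by have := h (pt_right k l e); rewrite (eqP (hr e)) !bicol_right.
  apply: pt_cases => e; first by rewrite (eqP (hl e)) !bicol_left.
  by rewrite (eqP (hr e)) !bicol_right.
apply/andP; split; apply/forallP => x.
  have [u w|E|->//] := @monochrome_sep _ _ r (pt_left k' l' x) (pt_left k' l' (val p x)).
    by rewrite h !bicol_left => /andP[/monochromeP ->].
  by have := pair_neq p x; rewrite (pt_left_inj E) eqxx.
have [u w|E|->//] := @monochrome_sep _ _ r (pt_right k l x) (pt_right k l (val q x)).
  by rewrite h !bicol_right => /andP[_ /monochromeP ->].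
by have := pair_neq q x; rewrite (pt_right_inj E) eqxx.
Qed.

Lemma hf_left m m' b (x : (m + m').-tuple colour) : lft (hf b x) = hf b (ltuple x).
Proof.
apply/ffunP => i; rewrite !ffunE !(tnth_nth (false, false)) ltupleE.
by rewrite nth_take.
Qed.
Lemma hf_right m m' b (x : (m + m').-tuple colour) :
  rgt (hf b x) = hf (b (+) odd m) (rtuple x).
Proof.
apply/ffunP => i; rewrite !ffunE !(tnth_nth (false, false)) rtupleE.
by rewrite nth_drop /= oddD addbA.
Qed.

Definition twist (b : bool) (q : ncpairing k' l' * ncpairing k' l') :=
  if b then (q.2, q.1) else q.

(** The halves are numbered by their position, so shifting by an odd number of
    strands exchanges the two families. *)
Lemma rtens_Rel (p : ncpairing k l * ncpairing k l)
    (q : ncpairing k' l' * ncpairing k' l')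
    (r : ncpairing (k + k') (l + l') * ncpairing (k + k') (l + l')) : odd l = odd k ->
  (rtens (Rel p) (Rel q) == Rel r) =
  is_juxtaposition p.1 (twist (odd k) q).1 r.1 &&
  is_juxtaposition p.2 (twist (odd k) q).2 r.2.
Proof.
move=> o; set q' := twist _ q.
have mem x y : ((x, y) \in rtens (Rel p) (Rel q)) =
    (monochrome p.1 (lft (hf true x)) (lft (hf true y)) &&
     monochrome q'.1 (rgt (hf true x)) (rgt (hf true y))) &&
    (monochrome p.2 (lft (hf false x)) (lft (hf false y)) &&
     monochrome q'.2 (rgt (hf false x)) (rgt (hf false y))).
  rewrite !inE /= !hf_left !hf_right o /q' /twist; case: (odd k) => /=;
  rewrite -!andbA; do !bool_congr.
have lc n n' : lft (c0 (n + n')) = c0 n by apply/ffunP => i; rewrite !ffunE.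
have rc n n' : rgt (c0 (n + n')) = c0 n' by apply/ffunP => i; rewrite !ffunE.
apply/eqP/andP => [E|[/monochrome_juxtaposition h1 /monochrome_juxtaposition h2]]; last first.
  by apply/setP => -[x y]; rewrite mem inE /= h1 h2.
have h u w u' w' := congr1 (fun R : crel (k + k') (l + l') => (mix u u', mix w w') \in R) E.
split; apply/monochrome_juxtaposition => u w.
  have := h u w (c0 _) (c0 _); rewrite mem inE /= !hf_mix !lc !rc !monochrome_0 !andbT.
  by move=> ->.
have := h (c0 _) (c0 _) u w; rewrite mem inE /= !hf_mix !lc !rc !monochrome_0 /=.
by move=> ->.
Qed.

End Juxtaposition.

Section TensorOne.
Variables (C : numClosedFieldType) (anti : bool) (t : C).
Hypothesis t0 : t != 0.
Hypothesis star_t2 : star anti (t ^+ 2) = t ^+ 2.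
Local Notation d := (t ^+ 2).
Local Notation N := (d ^+ 2).
Local Notation H := (bhom anti N).
Local Notation Phi := (Phi (t := t)).
Local Notation E := (NCBipartEven anti N).
Local Notation P := (of_basis anti (prod_cat (NCPair d) (NCPair d))).

(** Exchanging the families is the obstruction to monoidality of the
    coordinates. *)
Definition swapped k l (f g : ehom anti N k l) : Prop :=
  forall p, Phi g (Rel (p.2, p.1)) = Phi f (Rel p).

(** On the right of an odd number of strands the coordinates of the second
    factor must be taken with the families exchanged. *)
Lemma coords_tens k l k' l' (f : ehom anti N k l) (g g' : ehom anti N k' l') :
  odd l = odd k -> (if odd k then swapped g g' else g' = g) ->
  coords (ldtens E f g') = ldtens P (coords f) (coords g).
Proof.
move=> o gg'; apply/ffunP => r; rewrite !ffunE /= -/(btens f g') (Phi_tens t0 star_t2).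
transitivity (\sum_R1 Phi f R1 * \sum_R2 Phi g' R2 * (rtens R1 R2 == Rel r)%:R).
  by apply: eq_bigr => R1 _; rewrite mulr_sumr; apply: eq_bigr => R2 _; rewrite mulrA.
rewrite (sum_Rel t0 star_t2 _ (ehomP f)); apply: eq_bigr => p _.
rewrite (sum_Rel t0 star_t2 _ (ehomP g')) mulr_sumr.
rewrite (reindex_inj (h := twist (odd k))); last first.
  by rewrite /twist; case: (odd k) => -[a b] [a' b'] //= [-> ->].
apply: eq_bigr => q _; rewrite !ffunE -mulrA rtens_Rel // -natrM mulnb.
congr (_ * (_ * _)); last by rewrite /twist; case: (odd k).
by move: gg'; rewrite /twist; case: (odd k) => [h|->] //; exact: h.
Qed.

End TensorOne.

(** * The categories are not monoidally isomorphic *)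

Lemma opw_inj k l : injective (@opw k l).
Proof.
move=> p p' E; apply: monochrome_inj => u w.
have e := ncpairing_even p.
have := respects_opw p true (mix u u) (mix w w) e.
by rewrite E respects_opw // !hf_mix => ->.
Qed.

Lemma dyck_size2 h : dyck 0 h -> size h = 2 -> h = [:: U; D].
Proof. by case: h => [|[] [|[] [|??]]]. Qed.

Lemma dyck_size4 h : dyck 0 h -> size h = 4 ->
  h = if nth false h 1 then [:: U; U; D; D] else [:: U; D; U; D].
Proof. by case: h => [|[] [|[] [|[] [|[] [|??]]]]]. Qed.

Lemma card_ncpairing20 : (#|{: ncpairing 2 0}| <= 1)%N.
Proof.
suff I : injective (fun _ : ncpairing 2 0 => tt) by rewrite (leq_trans (leq_card _ I)) ?card_unit.
move=> p p' _; apply: opw_inj.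
by rewrite (dyck_size2 (dyck_opw p) (size_opw p)) (dyck_size2 (dyck_opw p') (size_opw p')).
Qed.

(** There are two Dyck paths of length four, distinguished by the second
    step. *)
Lemma card_ncpairing22 : (#|{: ncpairing 2 2}| <= 2)%N.
Proof.
suff I : injective (fun p : ncpairing 2 2 => nth false (opw p) 1).
  by rewrite (leq_trans (leq_card _ I)) ?card_bool.
move=> p p' E.
apply: opw_inj; rewrite (dyck_size4 (dyck_opw p) (size_opw p)) E.
by rewrite -(dyck_size4 (dyck_opw p') (size_opw p')).
Qed.

Definition swR k l (R : crel k l) : crel k l :=
  [set xy : k.-tuple colour * l.-tuple colour | (map_tuple swc xy.1, map_tuple swc xy.2) \in R].

Lemma map_swcK x : map swc (map swc x) = x.
Proof. by elim: x => //= -[a b] x ->. Qed.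

Lemma swRK k l : involutive (@swR k l).
Proof.
by move=> R; apply/setP => -[x y]; rewrite !inE /=; congr (_ \in R); congr pair;
  apply: val_inj; rewrite /= map_swcK.
Qed.

Lemma hf_swc b k (x : k.-tuple colour) : hf b (map_tuple swc x) = hf (~~ b) x.
Proof.
by apply/ffunP => i; rewrite !ffunE tnth_map addNb; case: (b (+) odd i).
Qed.

Lemma swR_Rel k l (p : ncpairing k l * ncpairing k l) : swR (Rel p) = Rel (p.2, p.1).
Proof. by apply/setP => -[x y]; rewrite !inE /= !hf_swc andbC. Qed.

Lemma swR_spider s k l : swR (supp k l (kspider s)) = supp k l (kspider (~~ s)).
Proof.
apply/setP => -[x y]; rewrite !inE /= /kspider.
by case: s => //=; rewrite !map_swcK.
Qed.

Section SmallMorphisms.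
Variables (C : numClosedFieldType) (anti : bool) (t : C).
Hypothesis t0 : t != 0.
Hypothesis star_t2 : star anti (t ^+ 2) = t ^+ 2.
Local Notation d := (t ^+ 2).
Local Notation N := (d ^+ 2).
Local Notation H := (bhom anti N).
Local Notation Phi := (Phi (t := t)).
Local Notation E := (NCBipartEven anti N).
Local Notation P := (of_basis anti (prod_cat (NCPair d) (NCPair d))).
Local Notation hs s k l := (bpi anti N (TSpider s k l)).
Local Notation id1 := (bid anti N 1).

Definition cc : H 2 2 := bcomp (hs false 0 2) (hs false 2 0).
Definition kcc : kern := kcomp 0 (kspider false) (kspider false).

Lemma Phi_spider s k l R : kspider s (zs k) (zs l) = 1%N ->
  Phi (hs s k l) R = scoef t k l * (supp k l (kspider s) == R)%:R.
Proof. move=> h; exact: (is_kern_Phi (is_kern_sp t0 star_t2 s k l) h). Qed.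

Lemma Phi_id2 R : Phi (bid anti N 2) R = (supp 2 2 kid == R)%:R.
Proof. by rewrite (is_kern_Phi (is_kern_id t0 star_t2 2)) ?mul1r. Qed.

Lemma Phi_cc R : Phi cc R = (supp 2 2 kcc == R)%:R.
Proof.
have k := is_kern_comp t0 star_t2 (is_kern_sp t0 star_t2 false 0 2)
                       (is_kern_sp t0 star_t2 false 2 0).
rewrite (is_kern_Phi k); last by rewrite /kcomp /kspider /= !big_bool.
by rewrite /scoef exprVn divff ?mulr1 ?mul1r // expf_neq0.
Qed.

Lemma even_S s : even_mor (hs s 2 2).
Proof. by case: s; [exact: even_w22|exact: even_b22]. Qed.
Lemma even_cc : even_mor cc.
Proof. by apply: even_comp; [exact: ueven_cup|exact: ueven_cap]. Qed.

Local Notation R1 := (supp 2 2 kid).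
Local Notation RC := (supp 2 2 kcc).
Local Notation RS s := (supp 2 2 (kspider s)).

Lemma mem_supp k l K (x : k.-tuple colour) (y : l.-tuple colour) :
  ((x, y) \in supp k l K) = (0 < K x y)%N.
Proof. by rewrite inE. Qed.

(** Two colourings separate the four relations: one is admitted only by the
    identity and the black spider, the other only by the identity and the
    white spider. *)
Lemma small_neq : uniq [:: R1; RC; RS false; RS true].
Proof.
pose o : colour := (false, false); pose a : colour := (false, true); pose b : colour := (true, false).
pose f (R : crel 2 2) :=
  (([tuple b; o], [tuple b; o]) \in R, ([tuple a; o], [tuple a; o]) \in R).
apply: (@map_uniq _ _ f); rewrite /= /f !mem_supp /kid /kcc /kcomp /=.
by rewrite /kspider !big_bool.
Qed.

(** There are at most four pairs of pairings, and the identity, the cup-cap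
    and the two spiders already have four distinct relations. *)
Lemma Rel22 (p : ncpairing 2 2 * ncpairing 2 2) :
  Rel p \in [:: R1; RC; RS false; RS true].
Proof.
set s := [:: _; _; _; _]; have us : uniq s := small_neq.
pose X := [set Rel p | p in [set: ncpairing 2 2 * ncpairing 2 2]].
have sX : [set:: s] \subset X.
  apply/subsetP => R; rewrite inE => Rs; suff [q ->] : exists p, R = Rel p by exact: imset_f.
  have ne : forall r, ~~ odd r -> scoef t 0 r != 0.
    by move=> r _; rewrite /scoef mulf_neq0 ?expf_neq0 ?invr_eq0.
  move: Rs; rewrite !inE => /or4P[] /eqP ->.
  - by apply: (Phi_even t0 star_t2 (even_id _ _ 2)); rewrite Phi_id2 eqxx oner_eq0.
  - by apply: (Phi_even t0 star_t2 even_cc); rewrite Phi_cc eqxx oner_eq0.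
  - apply: (Phi_even t0 star_t2 (even_S false)); rewrite Phi_spider ?eqxx ?mulr1.
      exact: (ne 4).
    by rewrite /kspider !big_bool.
  - apply: (Phi_even t0 star_t2 (even_S true)); rewrite Phi_spider ?eqxx ?mulr1.
      exact: (ne 4).
    by rewrite /kspider !big_bool.
have /eqP EX : [set:: s] == X.
  rewrite eqEcard sX (leq_trans (leq_imset_card _ _)) // cardsT card_prod cardsE.
  rewrite (card_uniqP us); exact: (leq_mul card_ncpairing22 card_ncpairing22).
by have := imset_f (@Rel 2 2) (in_setT p); rewrite -/X -EX inE.
Qed.

Lemma scoef22 : scoef t 2 2 != 0.
Proof. by rewrite /scoef mulf_neq0 ?expf_neq0 ?invr_eq0. Qed.

Definition lin4 a b x y : H 2 2 :=
  a *: bid anti N 2 + b *: cc + (x *: hs false 2 2 + y *: hs true 2 2).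

Lemma even_lin4 a b x y : even_mor (lin4 a b x y).
Proof.
by do !apply: even_add; apply: even_scale; [exact: even_id|exact: even_cc|exact: even_S..].
Qed.

Lemma Phi_lin4 a b x y R : Phi (lin4 a b x y) R =
  a * (R1 == R)%:R + b * (RC == R)%:R +
  (x * (scoef t 2 2 * (RS false == R)%:R) + y * (scoef t 2 2 * (RS true == R)%:R)).
Proof.
rewrite !(Phi_add t0 star_t2) !(Phi_scale t0 star_t2) Phi_id2 Phi_cc !Phi_spider //;
by rewrite /kspider !big_bool.
Qed.

Lemma Phi_lin4E a b x y :
  [/\ Phi (lin4 a b x y) R1 = a, Phi (lin4 a b x y) RC = b,
      Phi (lin4 a b x y) (RS false) = x * scoef t 2 2 &
      Phi (lin4 a b x y) (RS true) = y * scoef t 2 2].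
Proof.
have := small_neq; rewrite /= !inE !negb_or => /and4P[/and3P[a1 a2 a3] /andP[a4 a5] a6 _].
have sym (R R' : crel 2 2) : R != R' -> ((R == R') = false) * ((R' == R) = false).
  by move=> ne; rewrite [R' == R]eq_sym (negPf ne).
rewrite !Phi_lin4 !eqxx !(sym _ _ a1, sym _ _ a2, sym _ _ a3, sym _ _ a4, sym _ _ a5, sym _ _ a6).
by rewrite !(mulr0, mulr1, addr0, add0r).
Qed.

Lemma span22 (f : H 2 2) : even_mor f -> exists a b x y, f = lin4 a b x y.
Proof.
move=> ef; exists (Phi f R1), (Phi f RC), (Phi f (RS false) / scoef t 2 2),
  (Phi f (RS true) / scoef t 2 2).
set g := lin4 _ _ _ _; have [g1 g2 g3 g4] := Phi_lin4E (Phi f R1) (Phi f RC)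
  (Phi f (RS false) / scoef t 2 2) (Phi f (RS true) / scoef t 2 2).
rewrite divfK ?scoef22 // in g3; rewrite divfK ?scoef22 // in g4.
have efg : even_mor (f - g).
  by rewrite -scaleN1r; apply: even_add => //; apply/even_scale/even_lin4.
apply/eqP; rewrite -subr_eq0; apply/eqP/(Phi_inj t0 star_t2 efg) => R.
apply/eqP/negPn/negP => nz; have [p E] := Phi_even t0 star_t2 efg nz.
case/negP: nz; rewrite -scaleN1r (Phi_add t0 star_t2) (Phi_scale t0 star_t2) mulN1r subr_eq0.
by have := Rel22 p; rewrite -E !inE => /or4P[] /eqP ->; rewrite ?g1 ?g2 ?g3 ?g4.
Qed.

Lemma lin4_inj a b x y : lin4 a b x y = 0 -> [/\ a = 0, b = 0, x = 0 & y = 0].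
Proof.
move=> E; have [] := Phi_lin4E a b x y; rewrite E !(Phi0 t0 star_t2) => <- <-.
by move=> /esym/eqP; rewrite mulf_eq0 (negPf scoef22) orbF => /eqP ->
   /esym/eqP; rewrite mulf_eq0 (negPf scoef22) orbF => /eqP ->.
Qed.

End SmallMorphisms.

Lemma swR_kid : swR (supp 2 2 kid) = supp 2 2 kid.
Proof.
apply/setP => -[x y]; rewrite !inE /= /kid !lt0b.
by rewrite (inj_eq (can_inj map_swcK)).
Qed.

Lemma swR_kcc : swR (supp 2 2 kcc) = supp 2 2 kcc.
Proof.
have cap (x : 2.-tuple colour) : kspider false (map swc x) [::] = kspider false x [::].
  case: x => -[|[a b] [|[a' b'] [|]]] //= _; rewrite /kspider !big_bool /=.
  by case: a b a' b' => [] [] [] [].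
have cup (x : 2.-tuple colour) : kspider false [::] (map swc x) = kspider false [::] x.
  case: x => -[|[a b] [|[a' b'] [|]]] //= _; rewrite /kspider !big_bool /=.
  by case: a b a' b' => [] [] [] [].
by apply/setP => -[x y]; rewrite !inE /= /kcc /kcomp /= cap cup.
Qed.

Section NonMonoidal.
Variables (C : numClosedFieldType) (anti : bool) (t : C).
Hypothesis t0 : t != 0.
Hypothesis star_t2 : star anti (t ^+ 2) = t ^+ 2.
Local Notation d := (t ^+ 2).
Local Notation N := (d ^+ 2).
Local Notation H := (bhom anti N).
Local Notation Phi := (Phi (t := t)).
Local Notation E := (NCBipartEven anti N).
Local Notation P := (of_basis anti (prod_cat (NCPair d) (NCPair d))).
Local Notation hs s k l := (bpi anti N (TSpider s k l)).
Local Notation id1 := (bid anti N 1).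
Local Notation lin4 := (lin4 anti t).

Lemma swapped_lin4 a b x y (ef : even_mor (lin4 a b x y)) (eg : even_mor (lin4 a b y x)) :
  swapped (EMor ef) (EMor eg).
Proof.
move=> p; rewrite -swR_Rel /= !(Phi_lin4 t0 star_t2).
have sw (R R' : crel 2 2) : (R == swR R') = (swR R == R').
  by rewrite -{1}(swRK R) (inj_eq (can_inj (@swRK 2 2))).
by rewrite !sw !swR_spider swR_kid swR_kcc [y * _ + _]addrC.
Qed.

Lemma all_eq20 (p q : ncpairing 2 0 * ncpairing 2 0) : p = q.
Proof.
case: p q => [p1 p2] [q1 q2].
have /fintype_le1P h := card_ncpairing20.
by rewrite (h q1 p1) (h q2 p2).
Qed.

Lemma Phi_cap R : Phi (hs false 2 0) R = (supp 2 0 (kspider false) == R)%:R.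
Proof.
rewrite (Phi_spider t0 star_t2); last by rewrite /kspider !big_bool.
by rewrite /scoef exprVn divff ?mul1r // expf_neq0.
Qed.

Lemma span20 (g : H 2 0) : even_mor g -> exists mu, g = mu *: hs false 2 0.
Proof.
move=> eg; set R := supp 2 0 (kspider false); exists (Phi g R).
have ed : even_mor (g - Phi g R *: hs false 2 0).
  by rewrite -scaleN1r; apply/even_add/even_scale/even_scale/even_b20.
apply/eqP; rewrite -subr_eq0; apply/eqP/(Phi_inj t0 star_t2 ed) => R'.
apply/eqP/negPn/negP => nz; have [p E1] := Phi_even t0 star_t2 ed nz.
have [q E2] : exists q, R = Rel q.
  apply: (Phi_even t0 star_t2 (even_b20 anti N)).
  by rewrite [Phi _ _]Phi_cap eqxx oner_eq0.
case/negP: nz; rewrite -scaleN1r (Phi_add t0 star_t2) !(Phi_scale t0 star_t2) Phi_cap.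
by rewrite -/R E1 E2 (all_eq20 p q) eqxx mulr1 mulN1r subrr.
Qed.

(** The two ways of turning a morphism on two strands around a cap. *)
Definition rotl (f : H 2 2) : H 3 1 := bcomp (btens (hs false 2 0) id1) (btens id1 f).
Definition rotr (f : H 2 2) : H 3 1 := bcomp (btens id1 (hs false 2 0)) (btens f id1).

Lemma rotlE f : Um (rotl f) = ucomp (wh 0 (sp anti N false 2 0) 1) (wh 1 (Um f) 0).
Proof.
transitivity (ucomp (Um (btens (hs false 2 0) id1)) (Um (btens id1 f))); first exact: Um_comp.
by rewrite !Um_tens /wh utens1l utens1r.
Qed.
Lemma rotrE f : Um (rotr f) = ucomp (wh 1 (sp anti N false 2 0) 0) (wh 0 (Um f) 1).
Proof.
transitivity (ucomp (Um (btens id1 (hs false 2 0))) (Um (btens f id1))); first exact: Um_comp.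
by rewrite !Um_tens /wh utens1l utens1r.
Qed.

Lemma rotr_inj : injective rotr.
Proof.
move=> f g E; rewrite -[f]bendK -[g]bendK; congr unbend; apply: Um_inj.
by rewrite !Um_bend -!rotrE E.
Qed.

Lemma rotl_lin a f g : rotl (a *: f + g) = a *: rotl f + rotl g.
Proof. by rewrite /rotl btensDr btensZr bcompDr bcompZr. Qed.
Lemma rotr_lin a f g : rotr (a *: f + g) = a *: rotr f + rotr g.
Proof. by rewrite /rotr btensDl btensZl bcompDr bcompZr. Qed.

Lemma rot_spider s : rotl (hs s 2 2) = rotr (hs s 2 2).
Proof. by apply: Um_inj; rewrite rotlE rotrE S_shift_cap. Qed.

Local Notation cup := (sp anti N false 0 2).
Local Notation cap := (sp anti N false 2 0).

Lemma Um_cc : Um (cc anti t) = ucomp cup cap.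
Proof. by rewrite Um_comp. Qed.

Lemma rotl_id : rotl (bid anti N 2) = rotr (cc anti t).
Proof.
apply: Um_inj; rewrite rotlE rotrE Um_cc -wh_comp // ucompA snake_r.
by rewrite ucomp1l // -[Um _]/(uid anti N 2) wh_id ucomp1r.
Qed.

Lemma rotl_cc : rotl (cc anti t) = rotr (bid anti N 2).
Proof.
apply: Um_inj; rewrite rotlE rotrE Um_cc -wh_comp // ucompA snake_l.
by rewrite ucomp1l // -[Um (bid _ _ _)]/(uid anti N 2) wh_id ucomp1r.
Qed.

Lemma lin4Z c a b x y : c *: lin4 a b x y = lin4 (c * a) (c * b) (c * x) (c * y).
Proof. by rewrite /lin4 !scalerDr !scalerA. Qed.
Lemma lin4D a b x y a' b' x' y' :
  lin4 a b x y + lin4 a' b' x' y' = lin4 (a + a') (b + b') (x + x') (y + y').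
Proof. by rewrite /lin4 !scalerDl addrACA; congr (_ + _); exact: addrACA. Qed.

Lemma rotl_lin4 a b x y : rotl (lin4 a b x y) = rotr (lin4 b a x y).
Proof.
have rl0 : rotl 0 = 0 by have := rotl_lin (-1) 0 0; rewrite scaler0 addr0 scaleN1r addNr.
have rr0 : rotr 0 = 0 by have := rotr_lin (-1) 0 0; rewrite scaler0 addr0 scaleN1r addNr.
have lE a' b' x' y' : lin4 a' b' x' y' = a' *: bid anti N 2 + (b' *: cc anti t +
    (x' *: hs false 2 2 + (y' *: hs true 2 2 + 0))).
  by rewrite /lin4 addr0 !addrA.
rewrite !lE !rotl_lin !rotr_lin rotl_id rotl_cc !rot_spider rl0 rr0.
by rewrite addrCA.
Qed.

(** Turning exchanges the identity and the cup-cap and fixes the spiders.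
    Combined with the exchange of families, which swaps the spiders, a
    solution has equal coefficients in each pair. *)
Lemma rot_fixed a b x y : rotl (lin4 a b y x) = rotr (lin4 a b x y) -> b = a /\ y = x.
Proof.
rewrite rotl_lin4 => /rotr_inj E.
have : lin4 (b - a) (a - b) (y - x) (x - y) = 0.
  have -> : lin4 (b - a) (a - b) (y - x) (x - y) = lin4 b a y x - lin4 a b x y.
    rewrite /lin4 !scalerBl !opprD.
    by rewrite [RHS]addrACA; congr (_ + _); exact: addrACA.
  by rewrite E subrr.
by case/(lin4_inj t0 star_t2) => /eqP + _ /eqP + _; rewrite !subr_eq0 => /eqP -> /eqP ->.
Qed.

Section Transfer.
Variable G : functor E P.
Hypotheses (isoG : isomorphism G) (monG : monoidal G).
Local Notation i1 := (ldid E 1).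
Local Notation ecap := (EMor (even_b20 anti N)).

Lemma coords_onto k l (c : ldhom P k l) : exists f : ehom anti N k l, coords f = c.
Proof. by have [h _ hK] := coords_bij t0 star_t2 k l; exists (h c). Qed.
Lemma coords_inj k l : injective (@coords C anti t k l).
Proof. exact: bij_inj (coords_bij t0 star_t2 k l). Qed.

(** All morphisms on two strands are combinations of four, and the image of
    the cap is a multiple of the cap. Hence the equation between the two
    turns, which the monoidal functor preserves, becomes the equation of
    [rot_fixed]. *)
Lemma transfer (f f' : ehom anti N 2 2) : rotl f = rotr f -> G 2 2 f = coords f' ->
  exists a x, ehom_val f' = lin4 a a x x.
Proof.
move=> rf Gf; have [g Eg] := coords_onto (G 2 0 ecap).
have [mu Emu] := span20 (ehomP g).
have mu0 : mu != 0.
  apply/negP => /eqP m0; rewrite m0 scale0r in Emu.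
  have g0 : g = 0 by apply: val_inj.
  have /(bij_inj (isoG 2 0)) c0 : G 2 0 ecap = G 2 0 0.
    by rewrite linear0 -Eg g0; exact: (linear0 (coordsL t0 star_t2 2 0)).
  have := Phi_cap (supp 2 0 (kspider false)); rewrite eqxx.
  have -> : hs false 2 0 = 0 :> H 2 0 by exact: (congr1 (@ehom_val _ _ _ _ _) c0).
  by rewrite (Phi0 t0 star_t2) => /esym/eqP; rewrite oner_eq0.
have [a [b [x [y Ef]]]] := span22 t0 star_t2 (ehomP f').
have ef : even_mor (lin4 a b x y) by rewrite -Ef; exact: ehomP.
have eg := even_lin4 anti t a b y x.
have Ef' : f' = EMor ef by apply: val_inj; rewrite /= Ef.
have sw : swapped f' (EMor eg) by rewrite Ef'; exact: swapped_lin4.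
have sg : swapped g g by move=> p; rewrite (all_eq20 (p.2, p.1) p).
have EQ : ldcomp E (ldtens E ecap i1) (ldtens E i1 f) =
          ldcomp E (ldtens E i1 ecap) (ldtens E f i1) :> ehom anti N 3 1.
  by apply: val_inj; exact: rf.
have L : G 3 1 (ldcomp E (ldtens E ecap i1) (ldtens E i1 f)) =
    coords (ldcomp E (ldtens E g i1) (ldtens E i1 (EMor eg))).
  rewrite (coords_comp t0 star_t2).
  apply: etrans (fmor_comp G _ _) _; congr (ldcomp P _ _).
    rewrite (@coords_tens _ _ _ t0 star_t2 2 0 1 1 g i1 i1) // (coords_id t0 star_t2) Eg -(fmor_id G).
    exact: (monG ecap i1).
  rewrite (@coords_tens _ _ _ t0 star_t2 1 1 2 2 i1 f' (EMor eg)) // (coords_id t0 star_t2) -Gf -(fmor_id G).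
  exact: (monG i1 f).
have R : G 3 1 (ldcomp E (ldtens E i1 ecap) (ldtens E f i1)) =
    coords (ldcomp E (ldtens E i1 g) (ldtens E f' i1)).
  rewrite (coords_comp t0 star_t2).
  apply: etrans (fmor_comp G _ _) _; congr (ldcomp P _ _).
    rewrite (@coords_tens _ _ _ t0 star_t2 1 1 2 0 i1 g g) // (coords_id t0 star_t2) Eg -(fmor_id G).
    exact: (monG i1 ecap).
  rewrite (@coords_tens _ _ _ t0 star_t2 2 2 1 1 f' i1 i1) // (coords_id t0 star_t2) -Gf -(fmor_id G).
  exact: (monG f i1).
have /coords_inj : coords (ldcomp E (ldtens E g i1) (ldtens E i1 (EMor eg))) =
    coords (ldcomp E (ldtens E i1 g) (ldtens E f' i1)) by rewrite -L -R EQ.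
move/(congr1 (@ehom_val _ _ _ _ _)) => /= h.
have {}h : bcomp (btens (ehom_val g) id1) (btens id1 (lin4 a b y x)) =
    bcomp (btens id1 (ehom_val g)) (btens (ehom_val f') id1) :> H 3 1 by exact: h.
rewrite Emu Ef btensZl btensZr !bcompZl in h.
have {}h : mu *: rotl (lin4 a b y x) = mu *: rotr (lin4 a b x y) by exact: h.
have [e1 e2] := rot_fixed (scalerI mu0 h).
by exists a, x; rewrite Ef e1 e2.
Qed.

(** The two spiders and the sum of the identity and the cup-cap are
    independent, but their images lie in a plane. *)
Lemma not_both : False.
Proof.
have fix_exists (f : H 2 2) (ef : even_mor f) : rotl f = rotr f ->
    exists a x, exists ex : even_mor (lin4 a a x x), G 2 2 (EMor ef) = coords (EMor ex).
  move=> rf; have [f' Ef'] := coords_onto (G 2 2 (EMor ef)).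
  have [a [x E]] := @transfer (EMor ef) f' rf (esym Ef').
  have ex : even_mor (lin4 a a x x) by rewrite -E; exact: ehomP.
  by exists a, x, ex; rewrite -Ef'; congr coords; apply: val_inj.
have rf3 : rotl (lin4 1 1 0 0) = rotr (lin4 1 1 0 0) by rewrite rotl_lin4.
have [a1 [b1 [e1 E1]]] := fix_exists _ (even_S anti t false) (rot_spider false).
have [a2 [b2 [e2 E2]]] := fix_exists _ (even_S anti t true) (rot_spider true).
have [a3 [b3 [e3 E3]]] := fix_exists _ (even_lin4 anti t 1 1 0 0) rf3.
have K x1 x2 x3 : x1 * a1 + x2 * a2 + x3 * a3 = 0 -> x1 * b1 + x2 * b2 + x3 * b3 = 0 ->
    [/\ x1 = 0, x2 = 0 & x3 = 0].
  move=> ha hb.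
  pose f : ehom anti N 2 2 := x1 *: EMor (even_S anti t false) +
    x2 *: EMor (even_S anti t true) + x3 *: EMor (even_lin4 anti t 1 1 0 0).
  have : G 2 2 f = G 2 2 0.
    rewrite !linearD !linearZ linear0 E1 E2 E3.
    transitivity (coordsL t0 star_t2 2 2 (x1 *: EMor e1 + x2 *: EMor e2 + x3 *: EMor e3)).
      by rewrite !linearD !linearZ.
    rewrite -[RHS](linear0 (coordsL t0 star_t2 2 2)); congr (coordsL _ _ _ _ _).
    apply: val_inj => /=.
    rewrite !lin4Z !lin4D ha hb /lin4 !scale0r !addr0; reflexivity.
  move/(bij_inj (isoG 2 2))/(congr1 (@ehom_val _ _ _ _ _)) => f0.
  have {f0} : lin4 x3 x3 x1 x2 = 0.
    apply: etrans f0; rewrite /f /lin4 /= !scale0r !addr0 !scale1r scalerDr addrC; reflexivity.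
  by case/(lin4_inj t0 star_t2).
have [_ _ /eqP h] := K (a2 * b3 - a3 * b2) (a3 * b1 - a1 * b3) (a1 * b2 - a2 * b1)
  ltac:(ring) ltac:(ring).
have h2 : a2 * b1 - a1 * b2 = 0 by apply/eqP; rewrite -oppr_eq0 opprB.
have [p2 /eqP p1 _] := K a2 (- a1) 0 ltac:(ring) ltac:(by rewrite mul0r addr0 mulNr).
have [q2 /eqP q1 _] := K b2 (- b1) 0 ltac:(by rewrite mul0r addr0 mulNr mulrC [b1 * _]mulrC -opprB h2 oppr0) ltac:(ring).
rewrite oppr_eq0 in p1; rewrite oppr_eq0 in q1.
have [/eqP] := K 1 0 0 ltac:(by rewrite (eqP p1) !mul0r mulr0 !addr0)
   ltac:(by rewrite (eqP q1) !mul0r mulr0 !addr0).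
by rewrite oner_eq0.
Qed.

End Transfer.

Lemma no_monoidal_iso : ~ exists G : functor E P, isomorphism G /\ monoidal G.
Proof. by case=> G [isoG monG]; exact: (not_both isoG monG). Qed.

End NonMonoidal.

(** * A Hilbert space representation of the Temperley-Lieb algebra *)

Section WordSums.
Variable C : numClosedFieldType.
Implicit Types F G : seq bool -> C.

Fixpoint sumb n F : C :=
  if n is n'.+1 then sumb n' (fun z => F (U :: z)) + sumb n' (fun z => F (D :: z))
  else F [::].

Lemma sumb_ext n F G : (forall z, size z = n -> F z = G z) -> sumb n F = sumb n G.
Proof.
elim: n F G => [|n IH] F G E /=; first exact: E.
by congr (_ + _); apply: IH => z sz; apply: E; rewrite /= sz.
Qed.

Lemma sumbD n F G : sumb n (fun z => F z + G z) = sumb n F + sumb n G.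
Proof. by elim: n F G => //= n IH F G; rewrite !IH addrACA. Qed.
Lemma sumbZ n c F : sumb n (fun z => c * F z) = c * sumb n F.
Proof. by elim: n F => //= n IH F; rewrite !IH mulrDr. Qed.
Lemma sumb0 n : sumb n (fun=> 0) = 0.
Proof. by elim: n => //= n ->; rewrite addr0. Qed.

Lemma sumb_cat m n F : sumb (m + n) F = sumb m (fun p => sumb n (fun q => F (p ++ q))).
Proof. by elim: m F => //= m IH F; rewrite !IH. Qed.

Lemma sumb_ge0 n F : (forall z, 0 <= F z) -> 0 <= sumb n F.
Proof. by elim: n F => [|n IH] F h /=; rewrite ?h // addr_ge0 // IH. Qed.

Lemma sumb_eq0 n F : (forall z, 0 <= F z) -> sumb n F = 0 ->
  forall z, size z = n -> F z = 0.
Proof.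
elim: n F => [|n IH] F h /= E [|b z] // [sz].
move/eqP: E; rewrite paddr_eq0 ?sumb_ge0 // => /andP[/eqP e1 /eqP e2].
by case: b; [exact: (IH (fun z => F (U :: z)))|exact: (IH (fun z => F (D :: z)))].
Qed.

End WordSums.

Section SpinChain.
Variables (C : numClosedFieldType) (s d : C).
Hypothesis s0 : s != 0.
Hypothesis sd : s ^+ 2 + s ^- 2 = d.
Hypothesis sr : s^* = s.
Implicit Types (F G : seq bool -> C) (z p q : seq bool).

(** A deformed singlet, whose squared norm is [d]. *)
Definition qv (a b : bool) : C := if a then if b then 0 else s else if b then s^-1 else 0.
Definition qsum (f : bool -> bool -> C) : C := s * f U D + s^-1 * f D U.

(** The orthogonal projection onto the deformed singlet at the positions [i]
    and [i + 1], times [d]. *)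
Fixpoint eW i F z : C :=
  match i, z with
  | 0%N, a :: b :: z' => qv a b * qsum (fun a' b' => F [:: a', b' & z'])
  | i'.+1, a :: z' => eW i' (fun y => F (a :: y)) z'
  | _, _ => 0
  end.

Lemma eW_ext i F G z : (forall y, size y = size z -> F y = G y) -> eW i F z = eW i G z.
Proof.
elim: i F G z => [|i IH] F G [|a z] E //=; last first.
  by apply: IH => y sy; apply: E; rewrite /= sy.
by case: z E => // b z E; rewrite /qsum !E.
Qed.

Lemma eW_lin i c F G z : eW i (fun y => c * F y + G y) z = c * eW i F z + eW i G z.
Proof.
elim: i F G z => [|i IH] F G [|a z] //=; rewrite ?mulr0 ?addr0 ?IH //.
by case: z => [|b z]; rewrite ?mulr0 ?addr0 // /qsum; ring.
Qed.
Lemma eW0 i z : eW i (fun=> 0) z = 0.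
Proof.
by elim: i z => [|i IH] [|a [|b z]] //=; rewrite /qsum ?mulr0 ?addr0 ?mulr0.
Qed.
Lemma eWZ i c F z : eW i (fun y => c * F y) z = c * eW i F z.
Proof.
by have := eW_lin i c F (fun=> 0) z; rewrite eW0 addr0 => <-; apply: eW_ext => y _; rewrite addr0.
Qed.
Lemma eWD i F G z : eW i (fun y => F y + G y) z = eW i F z + eW i G z.
Proof. by rewrite -[X in X + _]mul1r -eW_lin; apply: eW_ext => y _; rewrite mul1r. Qed.

Lemma eW_cat p a b q F :
  eW (size p) F (p ++ [:: a, b & q]) = qv a b * qsum (fun a' b' => F (p ++ [:: a', b' & q])).
Proof. by elim: p F => //= c p IH F; rewrite IH. Qed.

Lemma eW_idem i F z : (i.+1 < size z)%N -> eW i (eW i F) z = d * eW i F z.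
Proof.
elim: i F z => [|i IH] F [|a z] //= h; last exact: IH.
by case: z h => // b z _; rewrite -sd /qsum /qv /=; field.
Qed.

Lemma eW_tl i F z : (i.+2 < size z)%N -> eW i (eW i.+1 (eW i F)) z = eW i F z.
Proof.
elim: i F z => [|i IH] F [|a z] // h; last exact: (IH (fun y => F (a :: y)) z h).
case: z h => [|b [|c z]] // _ /=; congr (_ * _).
by rewrite /qsum /qv /=; case: c; field.
Qed.

Lemma eW_tl' i F z : (i.+2 < size z)%N -> eW i.+1 (eW i (eW i.+1 F)) z = eW i.+1 F z.
Proof.
elim: i F z => [|i IH] F [|a z] // h; last exact: (IH (fun y => F (a :: y)) z h).
case: z h => [|b [|c z]] // _ /=; congr (_ * _).
by rewrite /qsum /qv /=; case: a; field.
Qed.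

Lemma eW_far i j F z : (i.+1 < j)%N -> (j.+1 < size z)%N ->
  eW i (eW j F) z = eW j (eW i F) z.
Proof.
elim: i j F z => [|i IH] [|j] F [|a z] //= ij jz; last exact: IH.
by case: j ij jz => // j _; case: z => // b z jz /=; rewrite eWZ /qsum eWD !eWZ.
Qed.

Lemma eW_sa i n F G : (i.+1 < n)%N ->
  sumb n (fun z => eW i F z * G z) = sumb n (fun z => F z * eW i G z).
Proof.
elim: i n F G => [|i IH] [|n] F G //= h; last by rewrite !IH.
case: n h => // n _ /=.
have E F' (G' : seq bool -> C) : sumb n (fun z => qv U U * qsum (fun a' b' => F' [:: a', b' & z]) * G' [:: U, U & z]) +
   sumb n (fun z => qv U D * qsum (fun a' b' => F' [:: a', b' & z]) * G' [:: U, D & z]) +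
   (sumb n (fun z => qv D U * qsum (fun a' b' => F' [:: a', b' & z]) * G' [:: D, U & z]) +
   sumb n (fun z => qv D D * qsum (fun a' b' => F' [:: a', b' & z]) * G' [:: D, D & z])) =
   sumb n (fun z => qsum (fun a' b' => F' [:: a', b' & z]) * qsum (fun a' b' => G' [:: a', b' & z])).
  by rewrite -!sumbD; apply: sumb_ext => z _; rewrite /qv /qsum; ring.
rewrite E; transitivity (sumb n (fun z => qsum (fun a' b' => G [:: a', b' & z]) * qsum (fun a' b' => F [:: a', b' & z]))).
  by apply: sumb_ext => z _; rewrite mulrC.
rewrite -(E G F); congr (_ + _ + (_ + _)); apply: sumb_ext => z _; exact: mulrC.
Qed.

Lemma sVr : (s^-1)^* = s^-1. Proof. by rewrite fmorphV /= sr. Qed.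
Lemma qv_conj a b : (qv a b)^* = qv a b.
Proof. by case: a b => [] []; rewrite /qv ?conjC0 ?sr ?sVr. Qed.

Lemma eW_conj i F z : (eW i F z)^* = eW i (fun y => (F y)^*) z.
Proof.
elim: i F z => [|i IH] F [|a z] /=; rewrite ?conjC0 ?IH //.
case: z => [|b z]; rewrite ?conjC0 // rmorphM [X in X * _]qv_conj /qsum.
by rewrite rmorphD !rmorphM /= sr sVr.
Qed.

Fixpoint w0 z : C :=
  match z with a :: b :: z' => qv a b * w0 z' | [::] => 1 | _ => 0 end.

Lemma w0_conj z : (w0 z)^* = w0 z.
Proof.
have [n] := ubnP (size z); elim: n z => // n IH [|a [|b z]] /= h; rewrite ?conjC1 ?conjC0 //.
rewrite rmorphM /= IH; last by lia.
by rewrite qv_conj.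
Qed.

Lemma w0_cat p q : ~~ odd (size p) -> w0 (p ++ q) = w0 p * w0 q.
Proof.
have [n] := ubnP (size p); elim: n p => // n IH [|a [|b p]] //= h; first by rewrite mul1r.
by rewrite negbK => op; rewrite IH ?mulrA //; lia.
Qed.

Lemma eW_w0 i z : ~~ odd i -> (i.+1 < size z)%N -> eW i w0 z = d * w0 z.
Proof.
move=> oi hi; have sp : size (take i z) = i by rewrite size_takel //; lia.
rewrite -(cat_take_drop i z) (drop_nth U) ?(drop_nth U (n := i.+1)) //; last by lia.
move: (take i z) sp (nth _ _ _) (nth _ _ _) (drop _ _) => p sp a b q.
rewrite -[in LHS]sp eW_cat w0_cat ?sp //= /qsum !w0_cat ?sp //= -sd /qv.
by field.
Qed.

(** Functions are cut off to words of length [n], so that the Temperley-Lieb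
    relations hold as equalities of functions. *)
Definition msk n F : seq bool -> C := fun z => if size z == n then F z else 0.
Definition eWn n i F := msk n (eW i F).

Lemma eWn_size n i F z : size z = n -> eWn n i F z = eW i F z.
Proof. by rewrite /eWn /msk => ->; rewrite eqxx. Qed.

Lemma eWn2 n i j F : eWn n i (eWn n j F) = msk n (eW i (eW j F)).
Proof.
apply/funext => z; rewrite /eWn /msk; case: eqP => // sz.
by apply: eW_ext => y; rewrite sz => ->; rewrite eqxx.
Qed.

Lemma eWn3 n i j k F : eWn n i (eWn n j (eWn n k F)) = msk n (eW i (eW j (eW k F))).
Proof.
rewrite eWn2; apply/funext => z; rewrite /msk; case: eqP => // sz.
apply: eW_ext => y sy; apply: eW_ext => x sx.
by rewrite eWn_size // sx sy.
Qed.

Lemma mskE n F G : (forall z, size z = n -> F z = G z) -> msk n F = msk n G.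
Proof. by move=> E; apply/funext => z; rewrite /msk; case: eqP => // /E. Qed.

Local Notation W := (seq bool -> C^o : lmodType C).

Definition avec n h : seq bool -> C := @dvec C W (eWn n) (msk n w0) h.

Lemma avecE n h : avec n h = @dvec C W (eWn n) (msk n w0) h.
Proof. by []. Qed.

Lemma WZ a (g : W) z : (a *: g) z = a * g z. Proof. by []. Qed.

Lemma eWnZ n i a (g : W) : eWn n i (a *: g) = a *: (eWn n i g : W).
Proof.
apply/funext => z; rewrite WZ /eWn /msk; case: eqP => [_|_]; last by rewrite mulr0.
by rewrite -[RHS]eWZ.
Qed.
Lemma eWn_idem n i (g : W) : (i.+1 < n)%N -> eWn n i (eWn n i g) = d *: (eWn n i g : W).
Proof.
move=> hi; rewrite eWn2; apply/funext => z; rewrite WZ /eWn /msk.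
by case: eqP => [sz|_]; [rewrite eW_idem // sz|rewrite mulr0].
Qed.
Lemma eWn_tl n i g : (i.+2 < n)%N -> eWn n i (eWn n i.+1 (eWn n i g)) = eWn n i g.
Proof. by move=> hi; rewrite eWn3; apply: mskE => z sz; rewrite eW_tl // sz. Qed.
Lemma eWn_tl' n i g : (i.+2 < n)%N -> eWn n i.+1 (eWn n i (eWn n i.+1 g)) = eWn n i.+1 g.
Proof. by move=> hi; rewrite eWn3; apply: mskE => z sz; rewrite eW_tl' // sz. Qed.
Lemma eWn_far n i j g : (i.+1 < j)%N -> (j.+1 < n)%N ->
  eWn n i (eWn n j g) = eWn n j (eWn n i g).
Proof. by move=> ij jn; rewrite !eWn2; apply: mskE => z sz; rewrite eW_far // sz. Qed.
Lemma eWn_w0 n i : (i.+1 < n)%N -> ~~ odd i ->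
  eWn n i (msk n w0) = d *: (msk n w0 : W).
Proof.
move=> hi oi; apply/funext => z; rewrite WZ /eWn /msk.
case: eqP => sz; last by rewrite mulr0.
rewrite -(eW_w0 oi) ?sz //; apply: eW_ext => y ->; by rewrite sz eqxx.
Qed.

Hypothesis d0 : d != 0.

Lemma avec_raise n p q : ~~ odd n -> dyck 0 (p ++ [:: D, U & q]) ->
  (size p + (size q).+2 = n)%N ->
  avec n (p ++ [:: U, D & q]) = eWn n (size p) (avec n (p ++ [:: D, U & q])).
Proof.
move=> on dp sz; have en := even_halfK on.
apply: (@dvec_raise C W d n./2 (eWn n) d0 _ _ p q dp); rewrite en //.
by move=> i j x; exact: eWn_far.
Qed.

Lemma avec_zigzag n m : avec n (zigzag m) = msk n w0.
Proof. by rewrite /avec /dvec dyckword_zigzag. Qed.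

(** For words of a given length this is an affine function of the area below
    the path, and turning a valley into a peak increases it by one. *)
Fixpoint pot z : nat := if z is a :: z' then ((if a then size z else 0) + pot z')%N else 0.

Lemma pot_swap p q : pot (p ++ [:: U, D & q]) = (pot (p ++ [:: D, U & q])).+1.
Proof.
elim: p => [|b p IH] /=; first by lia.
by rewrite IH !size_cat /=; case: b; lia.
Qed.

Lemma w0_pot m z : size z = m.*2 -> w0 z != 0 ->
  z = zigzag m \/ (pot z < pot (zigzag m))%N.
Proof.
elim: m z => [|m IH] [|a [|b z]] //=; first by left.
move=> [sz] h; have [] := IH z sz.
- by apply/negP => /eqP e; case/eqP: h; rewrite e mulr0.
- by move=> ->; move: h; case: a; case: b; rewrite /qv ?mul0r ?eqxx // => _;
    [left|right; rewrite size_zigzag; lia].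
by move: h; case: a; case: b; rewrite /qv ?mul0r ?eqxx // => _ lt; right;
  rewrite ?size_zigzag ?sz; lia.
Qed.

Lemma w0_zigzag m : w0 (zigzag m) != 0.
Proof. by elim: m => [|m IH] /=; rewrite ?oner_eq0 // mulf_neq0. Qed.

(** Raising a path adds the raised word with coefficient [s * s^-1] times the
    previous leading coefficient, and all other words in the support have
    smaller potential. *)
Lemma avec_tri n h : ~~ odd n -> dyck 0 h -> size h = n ->
  avec n h h != 0 /\
  forall z, size z = n -> avec n h z != 0 -> z = h \/ (pot z < pot h)%N.
Proof.
move=> on dh sh; have en := even_halfK on; rewrite -en in sh.
apply: (@dyck_ind n./2 (fun h => avec n h h != 0 /\
  forall z, size z = n -> avec n h z != 0 -> z = h \/ (pot z < pot h)%N)) dh sh.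
  rewrite avec_zigzag /msk; split.
    by rewrite size_zigzag en eqxx w0_zigzag.
  by move=> z sz; rewrite sz eqxx; apply: w0_pot; rewrite en.
move=> p q dp; rewrite en => sz [IH1 IH2].
have sq x y : size (p ++ [:: x, y & q]) = n by rewrite size_cat.
rewrite avec_raise //; split.
  rewrite eWn_size // eW_cat /qsum mulrDr mulrA [X in X + _]mulrC.
  have -> : avec n (p ++ [:: D, U & q]) (p ++ [:: U, D & q]) = 0.
    apply/eqP/negPn/negP => /(IH2 _ (sq _ _))[E|]; last by rewrite pot_swap; lia.
    by have := pot_swap p q; rewrite E; lia.
  by rewrite mul0r add0r !mulf_neq0 // invr_eq0.
move=> z; move: (take (size p) z) (cat_take_drop (size p) z) => p' Ez sz' nz.
have sp' : size (take (size p) z) = size p by rewrite size_takel //; lia.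
have [p1 [a [b [q1 [Ez1 sp1]]]]] : exists p1 a b q1, z = p1 ++ [:: a, b & q1] /\ size p1 = size p.
  exists (take (size p) z), (nth U z (size p)), (nth U z (size p).+1), (drop (size p).+2 z).
  by rewrite -!drop_nth ?cat_take_drop ?sz' //; lia.
have sq1 x y : size (p1 ++ [:: x, y & q1]) = n by rewrite -sz' Ez1 !size_cat.
move: nz; rewrite eWn_size // {1}Ez1 -sp1 eW_cat mulf_eq0 negb_or => /andP[qn sn].
have lt : (pot z <= (pot (p1 ++ [:: D, U & q1])).+1)%N.
  by move: qn; rewrite Ez1 /qv; case: (a); case: (b); rewrite ?eqxx // ?pot_swap; lia.
have zc : z = p1 ++ [:: U, D & q1] \/ z = p1 ++ [:: D, U & q1].
  by move: qn; rewrite Ez1 /qv; case: (a); case: (b); rewrite ?eqxx //; [left|right].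
have ps := pot_swap p q; have ps1 := pot_swap p1 q1.
have key x y : (x, y) = (U, D) \/ (x, y) = (D, U) ->
    avec n (p ++ [:: D, U & q]) (p1 ++ [:: x, y & q1]) != 0 ->
    z = p ++ [:: U, D & q] \/ (pot z < pot (p ++ [:: U, D & q]))%N.
  move=> xy /(IH2 _ (sq1 _ _))[/eqP|lt1]; last by right; case: xy lt1 => -[-> ->]; lia.
  rewrite eqseq_cat // !eqseq_cons => /and4P[/eqP pp /eqP ex /eqP ey /eqP qq].
  by case: zc => ->; rewrite pp qq; [left|right; rewrite pot_swap].
have [e1|n1] := eqVneq (avec n (p ++ [:: D, U & q]) (p1 ++ [:: U, D & q1])) 0.
  apply: (key D U); first by right.
  apply/negP => /eqP e2; case/eqP: sn; by rewrite /qsum e1 e2 !mulr0 addr0.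
by apply: (key U D) => //; left.
Qed.

(** A relation between the vectors is tested on a path of maximal potential
    among those that occur. *)
Lemma avec_free n (c : n.-tuple bool -> C) : ~~ odd n ->
  (forall z, size z = n -> \sum_(h : n.-tuple bool | dyck 0 h) c h * avec n h z = 0) ->
  forall h : n.-tuple bool, dyck 0 h -> c h = 0.
Proof.
move=> on E h dh; apply/eqP/negPn/negP => ch.
case: (arg_maxnP (P := fun h : n.-tuple bool => dyck 0 h && (c h != 0)) (fun h => pot h) (i0 := h)).
  by rewrite dh.
move=> {ch dh}h /andP[dh ch] hmax; move/eqP: (E h (size_tuple h)).
have [a1 a2] := avec_tri on dh (size_tuple h).
rewrite (bigD1 h) //= big1 ?addr0 => [|g /andP[dg gh]].
  by rewrite mulf_eq0 (negPf ch) (negPf a1).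
have [->|cg] := eqVneq (c g) 0; first by rewrite mul0r.
have [->|ag] := eqVneq (avec n g h) 0; first by rewrite mulr0.
have [_ b2] := avec_tri on dg (size_tuple g).
have [/val_inj e|lt] := b2 h (size_tuple h) ag; first by rewrite e eqxx in gh.
by have := hmax g; rewrite dg cg => /(_ isT); rewrite /= => le; move: (leq_trans lt le); rewrite ltnn.
Qed.

End SpinChain.

(** * The Gram form of even functionals *)

Section Gram.
Variables (C : numClosedFieldType) (N d s : C).
Hypothesis N0 : N != 0.
Hypothesis starN : star true N = N.
Hypothesis d2 : d ^+ 2 = N.
Hypothesis s0 : s != 0.
Hypothesis sd : s ^+ 2 + s ^- 2 = d.
Hypothesis sr : s^* = s.
Local Notation um := (um true N).
Local Notation uid := (uid true N).
Local Notation H := (bhom true N).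
Local Notation sp := (sp true N).
Local Notation "g '**' f" := (ucomp g f) (at level 45, right associativity).
Local Notation S c := (sp c 2 2).
Local Notation cup := (sp false 0 2).
Local Notation cap := (sp false 2 0).
Local Notation dd n := (dd true N d n).
Local Notation caps := (caps true N).
Local Notation ucaps := (ucaps true N).
Local Notation tl := (tl d).
Local Notation wvec := (wvec d).
Local Notation eW := (eW s).
Local Notation eWn := (eWn s).
Local Notation w0 := (w0 s).
Local Notation avec := (avec s).
Local Notation W := (seq bool -> C^o : lmodType C).
Local Notation fun2 := (seq bool -> seq bool -> C).
Local Notation tup n := (n.-tuple bool * n.-tuple bool)%type.

Let d0 : d != 0. Proof. by move: N0; rewrite -d2 sqrf_eq0. Qed.

Lemma d_real : d^* = d.
Proof. by rewrite -sd rmorphD /= fmorphV !rmorphXn /= sr. Qed.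

Section Links.
Variable n : nat.
Hypothesis on : ~~ odd n.
Implicit Types (x : H n 0) (g k : fun2).

Definition TL (c : bool) i g : fun2 := fun y z =>
  if c then eW i (g y) z else eW i (fun y' => g y' z) y.

Lemma TLE c i g y z :
  TL c i g y z = if c then eW i (g y) z else eW i (fun y' => g y' z) y.
Proof. by []. Qed.

(** Applying the normal form in the product of the two modules gives the same
    scalars and paths in both. *)
Lemma tl_nf2 c v h i :
  (forall j, (j.+1 < n)%N -> ~~ odd j -> tl c j v = d *: v) ->
  dyck 0 h -> size h = n -> (i.+1 < n)%N ->
  exists a h', [/\ dyck 0 h', size h' = n,
    tl c i (wvec c (dyckword 0 0 h) v) = a *: wvec c (dyckword 0 0 h') v :> H n 0 &
    forall z, size z = n -> eW i (avec n h) z = a * avec n h' z].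
Proof.
move=> hv dh sh hi; have en := even_halfK on.
pose V : lmodType C := (H n 0 * W)%type.
pose e i (x : V) : V := (tl c i x.1, eWn n i x.2).
have eE w (x : V) : eword (V := V) e w x = (wvec c w x.1, eword (V := W) (eWn n) w x.2).
  by elim: w x => [|j w IH] [x1 x2] //=; rewrite IH.
have := @nf_step C V d n./2 e d0 _ _ _ _ _ (v, msk n w0) _ h i; rewrite en.
case=> // [j a [x1 x2]|j [x1 x2] hj|j [x1 x2] hj|j [x1 x2] hj|j k [x1 x2] hj hk|j hj oj
          |a [h' [dh' sh']]].
- by rewrite /e /= tlZ // eWnZ.
- by rewrite /e /= tl_idem // (eWn_idem s0 sd).
- by rewrite /e /= tl_tl // (eWn_tl s0).
- by rewrite /e /= tl_tl' // (eWn_tl' s0).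
- by rewrite /e /= tl_far // eWn_far.
- by rewrite /e /= hv // (eWn_w0 s0 sd).
rewrite /dvec !eE => -[e1 e2]; exists a, h'; split=> // z sz.
by have := congr1 (fun F => F z) e2; rewrite /= eWn_size.
Qed.

(** A functional and a vector are linked when they have the same coordinates
    with respect to pairs of Dyck paths. The coordinates of the vector are
    unique, so a link transports identities from the spin chain to
    functionals. *)
Definition link x g : Prop := exists c : tup n -> C,
  x = \sum_(p : tup n | dyck 0 p.1 && dyck 0 p.2) c p *: dd n p.1 p.2 /\
  forall y z, size y = n -> size z = n ->
    g y z = \sum_(p : tup n | dyck 0 p.1 && dyck 0 p.2) c p * (avec n p.1 y * avec n p.2 z).

Lemma link_ext x g g' : link x g ->
  (forall y z, size y = n -> size z = n -> g y z = g' y z) -> link x g'.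
Proof. by move=> [c [-> Eg]] E; exists c; split=> // y z sy sz; rewrite -E // Eg. Qed.

Lemma link0 : link 0 (fun _ _ => 0).
Proof.
exists (fun=> 0); split; first by rewrite big1 // => p _; rewrite scale0r.
by move=> y z _ _; rewrite big1 // => p _; rewrite mul0r.
Qed.

Lemma link_lin a x g (y : H n 0) k : link x g -> link y k ->
  link (a *: x + y) (fun u v => a * g u v + k u v).
Proof.
move=> [c [-> Eg]] [c' [-> Ek]]; exists (fun p => a * c p + c' p); split.
  rewrite scaler_sumr -big_split; apply: eq_bigr => p _ /=.
  by rewrite scalerA scalerDl.
move=> u v su sv; rewrite Eg // Ek // mulr_sumr -big_split; apply: eq_bigr => p _ /=.
by rewrite mulrDl -mulrA.
Qed.

(** Any property of linked pairs that is closed under linear combinations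
    passes to sums. *)
Lemma closed_sum (Q : H n 0 -> fun2 -> Prop) (J : Type) (r : seq J) (P : pred J)
    (c : J -> C) (X : J -> H n 0) (G : J -> fun2) :
  Q 0 (fun _ _ => 0) ->
  (forall a x g (y : H n 0) k, Q x g -> Q y k -> Q (a *: x + y) (fun u v => a * g u v + k u v)) ->
  (forall j, P j -> Q (X j) (G j)) ->
  Q (\sum_(j <- r | P j) c j *: X j) (fun u v => \sum_(j <- r | P j) c j * G j u v).
Proof.
move=> Q0 Ql QJ; elim: r => [|j r IH].
  by rewrite big_nil; have -> : (fun u v => \sum_(j <- [::] | P j) c j * G j u v) =
    fun _ _ => 0 by apply/funext => u; apply/funext => v; rewrite big_nil.
rewrite big_cons; have -> : (fun u v => \sum_(j <- j :: r | P j) c j * G j u v) =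
    fun u v => if P j then c j * G j u v + \sum_(j <- r | P j) c j * G j u v
               else \sum_(j <- r | P j) c j * G j u v.
  by apply/funext => u; apply/funext => v; rewrite big_cons.
by case: ifP => // Pj; apply: Ql => //; exact: QJ.
Qed.

Lemma link_dd h1 h2 : dyck 0 h1 -> size h1 = n -> dyck 0 h2 -> size h2 = n ->
  link (dd n h1 h2) (fun y z => avec n h1 y * avec n h2 z).
Proof.
move=> d1 /eqP s1 d2' /eqP s2.
pose p0 : tup n := (Tuple s1, Tuple s2).
have Pp0 : dyck 0 p0.1 && dyck 0 p0.2 by rewrite /= d1.
exists (fun p => (p == p0)%:R); split=> [|y z _ _].
  rewrite (bigD1 p0) //= eqxx scale1r big1 ?addr0 // => p /andP[_ /negPf ->].
  by rewrite scale0r.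
rewrite (bigD1 p0) //= eqxx mul1r big1 ?addr0 // => p /andP[_ /negPf ->].
by rewrite mul0r.
Qed.

Lemma TL_lin c i a g k y z :
  TL c i (fun u v => a * g u v + k u v) y z = a * TL c i g y z + TL c i k y z.
Proof. by rewrite /TL; case: c; rewrite eW_lin. Qed.

Lemma link_tl c i x g : (i.+1 < n)%N -> link x g -> link (tl c i x) (TL c i g).
Proof.
move=> hi [cf [-> Eg]].
pose Q x g := link (tl c i x) (TL c i g).
have Q1 : Q (\sum_(p : tup n | dyck 0 p.1 && dyck 0 p.2) cf p *: dd n p.1 p.2)
  (fun y z => \sum_(p : tup n | dyck 0 p.1 && dyck 0 p.2) cf p * (avec n p.1 y * avec n p.2 z)).
  apply: (closed_sum (Q := Q)) => [|a x1 g1 y k q1 q2|p /andP[dp1 dp2]].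
  - rewrite /Q; have -> : tl c i (0 : H n 0) = 0 by have := tlZ d c i 0 (0 : H n 0); rewrite !scale0r.
    by apply: link_ext link0 _ => y z _ _; rewrite /TL; case: (c); rewrite eW0.
  - rewrite /Q; have -> : tl c i (a *: x1 + y) = a *: tl c i x1 + tl c i y.
      by rewrite /tl genD genZ.
    by apply: link_ext (link_lin a q1 q2) _ => u v _ _; rewrite TL_lin.
  have b1 := dyck_below N0 dp1 (size_tuple _); have b2 := dyck_below N0 dp2 (size_tuple _).
  rewrite /Q /TL; case: (c).
    rewrite ddE (@wvec_comm1 _ _ _ _ N0 starN d2 true) //.
    have [kk *|a [h' [dh' sh' -> Ea]]] := @tl_nf2 true (caps n) _ i _ dp2 (size_tuple _) hi.
      exact: tl_caps.
    rewrite wvecZ -[_ *: _]addr0.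
    apply: link_ext (link_lin a (link_dd dp1 (size_tuple _) dh' sh') link0) _.
    by move=> y z sy sz; rewrite addr0 eWZ Ea // mulrCA.
  have [kk *|a [h' [dh' sh' -> Ea]]] := @tl_nf2 false
    (wvec true (dyckword 0 0 p.2) (caps n)) _ i _ dp1 (size_tuple _) hi.
    by rewrite (@wvec_comm1 _ _ _ _ N0 starN d2 false) // tl_caps // wvecZ.
  rewrite -[_ *: _]addr0.
  apply: link_ext (link_lin a (link_dd dh' sh' dp2 (size_tuple _)) link0) _.
  move=> y z sy sz; rewrite addr0 mulrA -Ea // mulrC -eWZ; apply: eW_ext => u _.
  by rewrite mulrC.
apply: link_ext Q1 _ => y z sy sz; rewrite /TL; case: (c).
  by apply: eW_ext => u su; rewrite Eg // su.
by apply: eW_ext => u su; rewrite Eg // su.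
Qed.

Lemma link_zero x g : link x g ->
  (forall y z, size y = n -> size z = n -> g y z = 0) -> x = 0.
Proof.
move=> [c [-> Eg]] g0; apply: big1 => p /andP[d1 d2'].
suff -> : c p = 0 by rewrite scale0r.
have e y z : size y = n -> size z = n ->
    \sum_(h1 : n.-tuple bool | dyck 0 h1)
      (\sum_(h2 : n.-tuple bool | dyck 0 h2) c (h1, h2) * avec n h2 z) * avec n h1 y = 0.
  move=> sy sz; apply: etrans (g0 y z sy sz); rewrite Eg //.
  under eq_bigr do rewrite mulr_suml.
  rewrite pair_big /=; apply: eq_bigr => -[h1 h2] _ /=.
  by rewrite -mulrA [avec n h2 z * _]mulrC.
rewrite (surjective_pairing p).
apply: (avec_free s0 d0 on (c := fun h2 => c (p.1, h2))) d2' => z sz.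
by have := avec_free s0 d0 on (c := fun h1 : n.-tuple bool =>
  \sum_(h2 : n.-tuple bool | dyck 0 h2) c (h1, h2) * avec n h2 z)
  (fun y sy => e y z sy sz) d1.
Qed.

End Links.
End Gram.

Section GramForm.
Variables (C : numClosedFieldType) (N d s : C).
Hypothesis N0 : N != 0.
Hypothesis starN : star true N = N.
Hypothesis d2 : d ^+ 2 = N.
Hypothesis s0 : s != 0.
Hypothesis sd : s ^+ 2 + s ^- 2 = d.
Hypothesis sr : s^* = s.
Local Notation um := (um true N).
Local Notation uid := (uid true N).
Local Notation H := (bhom true N).
Local Notation sp := (sp true N).
Local Notation "g '**' f" := (ucomp g f) (at level 45, right associativity).
Local Notation S c := (sp c 2 2).
Local Notation cup := (sp false 0 2).
Local Notation cap := (sp false 2 0).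
Local Notation dd n := (dd true N d n).
Local Notation caps := (caps true N).
Local Notation ucaps := (ucaps true N).
Local Notation tl := (tl d).
Local Notation wvec := (wvec d).
Local Notation eW := (eW s).
Local Notation eWn := (eWn s).
Local Notation w0 := (w0 s).
Local Notation avec := (avec s).
Local Notation W := (seq bool -> C^o : lmodType C).
Local Notation fun2 := (seq bool -> seq bool -> C).
Local Notation tup n := (n.-tuple bool * n.-tuple bool)%type.

Let d0 : d != 0. Proof. by move: N0; rewrite -d2 sqrf_eq0. Qed.

Local Notation link := (link d s).
Local Notation TL := (TL s).

Fixpoint upow c j : um := if j is j'.+1 then utens (upow c j') (S c) else uid 0.

Lemma udom_upow c j : udom (upow c j) = j.*2.
Proof. by elim: j => //= j IH; rewrite udom_tens IH udom_sp addn2. Qed.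
Lemma ucod_upow c j : ucod (upow c j) = j.*2.
Proof. by elim: j => //= j IH; rewrite ucod_tens IH ucod_sp addn2. Qed.

Lemma ucaps_tens m : ucaps m.+1 = utens (ucaps m) cap.
Proof.
rewrite ucapsSr /wh utens1r -{1}[ucaps m]utens1r utens_comp ?udom_ucaps //.
by rewrite ucomp1r ?udom_ucaps // ucomp1l.
Qed.

Lemma udim_caps m : (udom (ucaps m) = m.*2) * (ucod (ucaps m) = 0%N).
Proof. by rewrite udom_ucaps ucod_ucaps. Qed.

(** Black and white spiders on all neighbouring pairs cut every pair of
    strands. *)
Lemma upow_comp j : upow false j ** upow true j =
  uscale (N^-1 ^+ j) (udag (ucaps j) ** ucaps j).
Proof.
elim: j => [|j IH].
  by rewrite /= udag_id !ucomp1l // uscale1.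
rewrite ucaps_tens /= utens_comp ?udom_upow ?ucod_upow // IH.
rewrite (SSn starN false) utensZl utensZr uscaleA -exprSr.
by rewrite udag_tens sp_dag utens_comp // ?udom_dag ?ucod_dag ?udim_caps.
Qed.

Lemma ucaps_norm m : ucaps m ** udag (ucaps m) = uscale (N ^+ m) (uid 0).
Proof.
elim: m => [|m IH]; first by rewrite /= udag_id ucomp1l // uscale1.
rewrite ucaps_tens udag_tens sp_dag utens_comp ?ucod_dag ?udim_caps // IH capcup.
by rewrite utensZl utensZr uscaleA utens_id exprSr.
Qed.

Fixpoint evens n c j (x : H n 0) : H n 0 :=
  if j is j'.+1 then tl c j'.*2 (evens c j' x) else x.

Lemma Um_evens n c j (x : H n 0) : (j.*2 <= n)%N ->
  Um (evens c j x) = uscale (d ^+ j) (Um x ** utens (upow c j) (uid (n - j.*2))).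
Proof.
elim: j => [|j IH] hj; first by rewrite /= utens1l subn0 ucomp1r // uscale1.
rewrite /= tlE odd_double addbF Um_gen ?IH //; try by lia.
rewrite ucompZl uscaleA -exprS -ucompA; congr (uscale _ (_ ** _)).
have e : ucod (utens (S c) (uid (n - j.*2 - 2))) = (n - j.*2)%N.
  by rewrite ucod_tens ucod_sp ucod_id; move: hj; rewrite doubleS; lia.
rewrite /wh utens_comp ?udom_upow ?e // ucomp1r ?udom_upow // ucomp1l // utensA.
by congr (utens _ (uid _)); lia.
Qed.

(** The generators of both families at all even positions cut every pair of
    strands, so their product replaces [x] by a multiple of the caps. *)
Lemma evens_caps m (x : H m.*2 0) :
  Um (evens true m (evens false m x)) = Um x ** udag (ucaps m) ** ucaps m.
Proof.
rewrite !Um_evens // subnn !utens1r ucompZl uscaleA -ucompA upow_comp ucompZr uscaleA.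
by rewrite -exprMn -expr2 d2 -exprMn divff // expr1n uscale1.
Qed.

End GramForm.

Section Pairing.
Variables (C : numClosedFieldType) (N d s : C).
Hypothesis N0 : N != 0.
Hypothesis starN : star true N = N.
Hypothesis d2 : d ^+ 2 = N.
Hypothesis s0 : s != 0.
Hypothesis sd : s ^+ 2 + s ^- 2 = d.
Hypothesis sr : s^* = s.
Local Notation um := (um true N).
Local Notation uid := (uid true N).
Local Notation H := (bhom true N).
Local Notation sp := (sp true N).
Local Notation "g '**' f" := (ucomp g f) (at level 45, right associativity).
Local Notation S c := (sp c 2 2).
Local Notation cup := (sp false 0 2).
Local Notation cap := (sp false 2 0).
Local Notation dd n := (dd true N d n).
Local Notation caps := (caps true N).
Local Notation ucaps := (ucaps true N).
Local Notation tl := (tl d).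
Local Notation wvec := (wvec d).
Local Notation eW := (eW s).
Local Notation eWn := (eWn s).
Local Notation w0 := (w0 s).
Local Notation avec := (avec s).
Local Notation W := (seq bool -> C^o : lmodType C).
Local Notation fun2 := (seq bool -> seq bool -> C).
Local Notation tup n := (n.-tuple bool * n.-tuple bool)%type.

Let d0 : d != 0. Proof. by move: N0; rewrite -d2 sqrf_eq0. Qed.

Local Notation link := (link d s).
Local Notation TL := (TL s).

Local Notation evens := (evens d).

Lemma sumb_exch n m (F : seq bool -> seq bool -> C) :
  sumb n (fun y => sumb m (F y)) = sumb m (fun z => sumb n (F^~ z)).
Proof. by elim: n F => //= n IH F; rewrite !IH sumbD. Qed.

Fixpoint evensW j (F : seq bool -> C) : seq bool -> C :=
  if j is j'.+1 then eW j'.*2 (evensW j' F) else F.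

(** The generators at all even positions replace a vector by a multiple of the
    product of singlets. *)
Lemma evensW_cat j F p q : size p = j.*2 ->
  evensW j F (p ++ q) = w0 p * sumb j.*2 (fun u => w0 u * F (u ++ q)).
Proof.
elim: j F p q => [|j IH] F p q; first by move/size0nil => -> /=; rewrite !mul1r.
move=> sp; have [p' [a [b [-> sp']]]] : exists p' a b, p = p' ++ [:: a; b] /\ size p' = j.*2.
  exists (take j.*2 p), (nth U p j.*2), (nth U p j.*2.+1).
  rewrite size_takel; last by rewrite sp doubleS; lia.
  split=> //; rewrite -{1}(cat_take_drop j.*2 p) (drop_nth U) ?sp ?doubleS //.
  by rewrite (drop_nth U) ?sp ?doubleS // drop_oversize // sp doubleS.
have oj (u : seq bool) : size u = j.*2 -> ~~ odd (size u) by move=> ->; rewrite odd_double.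
have -> : sumb j.+1.*2 (fun u => w0 u * F (u ++ q)) =
    s * sumb j.*2 (fun u => w0 u * F (u ++ [:: U, D & q])) +
    s^-1 * sumb j.*2 (fun u => w0 u * F (u ++ [:: D, U & q])).
  rewrite doubleS -addn2 sumb_cat -!sumbZ -sumbD; apply: sumb_ext => u su.
  by rewrite [LHS]/= !(w0_cat s0) ?oj //= -!catA /qv /=; ring.
rewrite [LHS]/= -catA -sp' [_ ++ q]/= eW_cat (w0_cat s0) ?oj //= mulr1.
by rewrite sp' /qsum !IH // /qv; case: (a); case: (b); ring.
Qed.

Lemma evensW_full j F y : size y = j.*2 ->
  evensW j F y = w0 y * sumb j.*2 (fun u => w0 u * F u).
Proof.
move=> sy; have := evensW_cat F [::] sy; rewrite cats0 => ->.
by congr (_ * _); apply: sumb_ext => u _; rewrite cats0.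
Qed.

Definition ip n (g k : fun2) : C := sumb n (fun z => sumb n (fun y => g y z * (k y z)^*)).
Definition w00 : fun2 := fun y z => w0 y * w0 z.

Lemma ip_ext n g g' k k' :
  (forall y z, size y = n -> size z = n -> g y z = g' y z) ->
  (forall y z, size y = n -> size z = n -> k y z = k' y z) ->
  ip n g k = ip n g' k'.
Proof.
by move=> Eg Ek; apply: sumb_ext => z sz; apply: sumb_ext => y sy; rewrite Eg ?Ek.
Qed.

Lemma ip_TL n c i g k : (i.+1 < n)%N -> ip n g (TL c i k) = ip n (TL c i g) k.
Proof.
move=> hi; rewrite /ip /TL; case: c; last first.
  apply: sumb_ext => z _; rewrite eW_sa //; apply: sumb_ext => y _.
  by rewrite (eW_conj sr).
rewrite sumb_exch [RHS]sumb_exch; apply: sumb_ext => y _; rewrite eW_sa //.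
by apply: sumb_ext => z _; rewrite (eW_conj sr).
Qed.

Section Fixed.
Variable m : nat.
Local Notation n := m.*2.
Let on : ~~ odd n. Proof. by rewrite odd_double. Qed.

Definition evens2 c j (g : fun2) : fun2 := fun y z =>
  if c then evensW j (g y) z else evensW j (fun y' => g y' z) y.

Lemma link_evens c j (x : H n 0) g : (j <= m)%N -> link x g ->
  link (evens c j x) (evens2 c j g).
Proof.
elim: j => [|j IH] hj lx; first by apply: link_ext lx _ => y z _ _; rewrite /evens2; case: c.
apply: link_ext (link_tl N0 starN d2 s0 sd on c _ (IH (ltnW hj) lx)) _; first by lia.
by move=> y z _ _; rewrite /evens2 TLE; case: c {IH}.
Qed.

Lemma link_caps : link (caps n) w00.
Proof.
rewrite (caps_dd true N d on); have sz : size (zigzag m) = n by rewrite size_zigzag.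
rewrite doubleK; apply: link_ext (link_dd N d s (dyck_zigzag m) sz (dyck_zigzag m) sz) _.
by move=> y z sy sz'; rewrite avec_zigzag /msk sy sz' eqxx.
Qed.

Lemma link_even (x : H n 0) g : link x g -> even_mor x.
Proof.
case=> c [-> _]; elim/big_ind: _ => [|y z|p _]; [exact: even_zero|exact: even_add|].
by apply/even_scale/even_dd.
Qed.

Lemma scalar00 (r : H 0 0) : even_mor r -> exists mu, r = mu *: bid true N 0.
Proof.
move=> er; have [c ->] := even_expand N0 starN d2 er.
exists (\sum_(p : tup 0 | dyck 0 p.1 && dyck 0 p.2) c p).
rewrite scaler_suml; apply: eq_bigr => -[p1 p2] _; congr (_ *: _).
rewrite (tuple0 p1) (tuple0 p2) /= ddE /=.
by apply: Um_inj; rewrite Um_caps.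
Qed.

Definition good_pair (y : H n 0) (k : fun2) := forall (x : H n 0) g, link x g ->
  bcomp x (bdag y) = ip n g k *: bid true N 0.

(** The product of all generators at even positions sends [x] to the multiple
    of the caps given by the pairing, and the vector [g] to the multiple of
    the product of singlets given by the inner product. As these stay linked,
    the two multiples agree. *)
Lemma good_caps : good_pair (caps n) w00.
Proof.
move=> x g lx.
have ec : even_mor (caps n) by exact: link_even link_caps.
have [mu Emu] := scalar00 (even_comp (link_even lx) (even_dag ec)).
rewrite -/(bdag _) -/(bcomp _ _) in Emu; rewrite Emu.
have lx2 := link_evens true (leqnn m) (link_evens false (leqnn m) lx).
have Uc : Um (caps n) = ucaps m by rewrite Um_caps // doubleK.
have Ex2 : evens true m (evens false m x) = mu *: caps n.
  apply: Um_inj; rewrite (evens_caps N0 starN d2 s0) -Uc ucompA -Um_dag -Um_comp Emu !Um_scale ucompZl.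
  by rewrite ucomp1l.
rewrite Ex2 in lx2.
have E0 : mu *: caps n - ip n g w00 *: caps n = 0.
  rewrite addrC -scaleNr; apply: (link_zero N0 d2 s0 on (link_lin (- ip n g w00) link_caps lx2)).
  move=> y z sy sz; rewrite /evens2 !evensW_full // mulNr.
  have -> : sumb n (fun u => w0 u * evensW m (fun y' => g y' u) y) = w0 y * ip n g w00.
    rewrite -sumbZ; apply: sumb_ext => u su; rewrite evensW_full // -!sumbZ.
    apply: sumb_ext => v sv; rewrite /w00 rmorphM /= !(w0_conj s0 sr); ring.
  by rewrite /w00; ring.
have : bcomp (mu *: caps n - ip n g w00 *: caps n) (bdag (caps n)) = 0.
  by rewrite E0 bcomp0l.
have Ec : bcomp (caps n) (bdag (caps n)) = N ^+ m *: bid true N 0.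
  by apply: Um_inj; rewrite Um_comp Um_dag Um_scale Uc ucaps_norm.
rewrite -scalerBl bcompZl Ec scalerA mulrC -scalerA => /eqP.
rewrite scaler_eq0 expf_eq0 (negPf N0) andbF orFb scalerBl subr_eq0 => /eqP.
by [].
Qed.

(** The generators are self-adjoint on both sides. *)
Lemma good_tl c i (y : H n 0) k : (i.+1 < n)%N -> good_pair y k ->
  good_pair (tl c i y) (TL c i k).
Proof.
move=> hi gy x g lx; rewrite ip_TL // -(gy _ _ (link_tl N0 starN d2 s0 sd on c hi lx)).
apply: Um_inj; rewrite !Um_comp !Um_dag !tlE !Um_gen //.
rewrite udag_scale ucompZr ucompZl.
have -> : star true d = d by exact: (d_real sd sr).
rewrite udag_comp; last by rewrite ucod_wh ucod_sp -[udom (Um y)]/n; move: hi; clear; lia.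
by rewrite udag_wh sp_dag ucompA.
Qed.

Lemma good_ext (y : H n 0) k k' : good_pair y k ->
  (forall u v, size u = n -> size v = n -> k u v = k' u v) -> good_pair y k'.
Proof. by move=> gy E x g lx; rewrite (gy x g lx); congr (_ *: _); apply: ip_ext. Qed.

Lemma good_dd h1 h2 : dyck 0 h1 -> size h1 = n -> dyck 0 h2 -> size h2 = n ->
  good_pair (dd n h1 h2) (fun y z => avec n h1 y * avec n h2 z).
Proof.
move=> d1 s1 d2' s2; have b1 := dyck_below N0 d1 s1; have b2 := dyck_below N0 d2' s2.
rewrite ddE !avecE /dvec.
elim: (dyckword 0 0 h1) b1 => [|i w IH] /=; last first.
  case/andP => hi hw; apply: good_ext (good_tl false hi (IH hw)) _ => u v su sv.
  rewrite TLE eWn_size // mulrC -eWZ; apply: eW_ext => u' _; exact: mulrC.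
elim: (dyckword 0 0 h2) b2 => [|i w IH] /=; last first.
  move=> /andP[hi hw] _; apply: good_ext (good_tl true hi (IH hw isT)) _ => u v su sv.
  by rewrite TLE eWn_size // eWZ.
move=> _ _; apply: good_ext good_caps _ => u v su sv.
by rewrite /msk su sv eqxx.
Qed.

Lemma ipD a g k k' : ip n g (fun u v => a * k u v + k' u v) = a^* * ip n g k + ip n g k'.
Proof.
rewrite /ip -sumbZ -sumbD; apply: sumb_ext => z _; rewrite -sumbZ -sumbD.
by apply: sumb_ext => y _; rewrite rmorphD rmorphM /=; ring.
Qed.

Lemma link_good (y : H n 0) k : link y k -> good_pair y k.
Proof.
move=> [c [-> Ek]].
apply: good_ext (closed_sum (Q := good_pair) _ _ _ _ _) _.
  move=> x g lx; rewrite bdag0 bcomp0r.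
  have -> : ip n g (fun _ _ => 0) = 0.
    rewrite /ip -[RHS](sumb0 C n); apply: sumb_ext => z _.
    by rewrite -[RHS](sumb0 C n); apply: sumb_ext => u _; rewrite conjC0 mulr0.
  by rewrite scale0r.
  move=> a x1 k1 x2 k2 q1 q2 x g lx.
  by rewrite bdagD bdagZ bcompDr bcompZr (q1 x g lx) (q2 x g lx) ipD scalerDl scalerA.
  move=> p /andP[e1 e2]; exact: (good_dd e1 (size_tuple _) e2 (size_tuple _)).
by move=> u v su sv; rewrite Ek.
Qed.

(** The pairing of [x] with itself is the square of the norm of its vector. *)
Lemma gram (x : H n 0) : even_mor x -> x != 0 ->
  exists2 a, a != 0 & bcomp x (bdag x) = a *: bid true N 0.
Proof.
move=> ex nx; have [c Ec] := even_expand N0 starN d2 ex.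
pose g : fun2 := fun y z => \sum_(p : tup n | dyck 0 p.1 && dyck 0 p.2)
  c p * (avec n p.1 y * avec n p.2 z).
have lx : link x g by exists c.
exists (ip n g g); last exact: (link_good lx lx).
apply: contraNneq nx => g0; apply/eqP/(link_zero N0 d2 s0 on lx) => y z sy sz.
have sq_ge0 z' y' : 0 <= g y' z' * (g y' z')^* by exact: mul_conjC_ge0.
have := sumb_eq0 (fun z' => sumb_ge0 n (sq_ge0 z')) g0 sz.
by move/(sumb_eq0 (sq_ge0 z))/(_ _ sy)/eqP; rewrite mul_conjC_eq0 => /eqP.
Qed.

End Fixed.
End Pairing.

(** * Fibre functors *)

Lemma even_odd_zero (C : numClosedFieldType) (N d : C) n (x : bhom true N n 0) :
  N != 0 -> star true N = N -> d ^+ 2 = N -> odd n -> even_mor x -> x = 0.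
Proof.
move=> N0 starN d2 on ex; have [c ->] := even_expand N0 starN d2 ex.
rewrite big1 // => p /andP[d1 _].
have := dyck_odd_height (c := 0) (p := p.1) (q := [::]).
rewrite cats0 => /(_ d1); rewrite size_tuple on.
by have := dyck_cat (c := 0) (p := p.1) (q := [::]); rewrite cats0 => /(_ d1) /= /eqP ->.
Qed.

(** The parameter [s] is the square root of the larger root of [r ^ 2 - d * r
    + 1]. *)
Lemma spin_parameter (C : numClosedFieldType) (N : C) : 4%:R <= N ->
  exists d s : C, [/\ d ^+ 2 = N, s != 0, s ^+ 2 + s ^- 2 = d & s^* = s].
Proof.
move=> N4; pose d := sqrtC N; pose w := sqrtC (N - 4%:R); pose r := (d + w) / 2%:R.
have d2 : d ^+ 2 = N by exact: sqrtCK.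
have w2 : w ^+ 2 = N - 4%:R by exact: sqrtCK.
have N0 : 0 < N by apply: lt_le_trans N4; rewrite ltr0n.
have d0 : 0 < d by rewrite sqrtC_gt0.
have w0 : 0 <= w by rewrite sqrtC_ge0 subr_ge0.
have r0 : 0 < r by rewrite divr_gt0 ?ltr0n // ltr_wpDr.
have s0 : 0 < sqrtC r by rewrite sqrtC_gt0.
exists d, (sqrtC r); split=> //; first by rewrite gt_eqF.
  rewrite sqrtCK; apply: (mulfI (lt0r_neq0 r0)); rewrite mulrDr divff ?gt_eqF //.
  have E : d * w * 2 = d * w * 2 by [].
  rewrite /r; have -> : (d + w) / 2%:R * ((d + w) / 2%:R) = (d ^+ 2 + w ^+ 2 + 2 * (d * w)) / 4%:R.
    by field.
  have -> : (d + w) / 2%:R * d = (2 * d ^+ 2 + 2 * (d * w)) / 4%:R by field.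
  by rewrite w2 d2; field.
by rewrite geC0_conj // ltW.
Qed.

Section FibreFunctor.
Variables (C : numClosedFieldType) (N : C) (M : nat).
Hypothesis N4 : 4%:R <= N.
Variable F : functor (NCBipartEven true N) (Mat C M).
Hypothesis monF : monoidal F.

(** If a functional [x] is killed, so is its pairing with itself, a nonzero
    multiple of the identity of [0]; but the functor preserves this identity.
    Bending reduces morphisms to functionals. *)
Lemma fibre_zero k l (f : ehom true N k l) : F k l f = 0 -> f = 0.
Proof.
have [d [s [d2 s0 sd sr]]] := spin_parameter N4.
have Npos : 0 < N by apply: lt_le_trans N4; rewrite ltr0n.
have N0 : N != 0 by rewrite gt_eqF.
have starN : star true N = N by rewrite /star geC0_conj // ltW.
move=> Ff; apply: val_inj.
apply: (@bend_zero C true N (fun k l f => exists ef : even_mor f, F k l (EMor ef) = 0)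
  N0 starN); last first.
- by exists (ehomP f); rewrite -Ff; congr (F _ _ _); apply: val_inj.
- exact: ehomP.
- move=> n x ex [ex' Fx]; case: (boolP (odd n)) => [on|on].
    exact: (even_odd_zero N0 starN d2 on ex).
  have en := even_halfK on; move: x ex ex' Fx; rewrite -en => x ex ex' Fx.
  apply/eqP/negPn/negP => nx; have [a a0 Ea] := gram N0 starN d2 s0 sd sr ex nx.
  have : F 0 0 (ldcomp (NCBipartEven true N) (EMor ex') (lddag (NCBipartEven true N) (EMor ex'))) = 0.
    by rewrite fmor_comp Fx /= mul0mx.
  have -> : ldcomp (NCBipartEven true N) (EMor ex') (lddag (NCBipartEven true N) (EMor ex')) =
      a *: ldid (NCBipartEven true N) 0.
    by apply: val_inj; exact: Ea.
  rewrite linearZ /= fmor_id /= => /matrixP/(_ ord0 ord0)/eqP.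
  by rewrite !mxE mulr1 (negPf a0).
- move=> k' l' g eg [eg' Fg].
  have et : even_mor (btens g (bid true N 1)) by apply: even_tens => //; exact: even_id.
  exists et; have -> : EMor et = ldtens (NCBipartEven true N) (EMor eg') (ldid (NCBipartEven true N) 1).
    by apply: val_inj.
  rewrite monF Fg /= tens0mx; apply/matrixP => i j; by rewrite castmxE !mxE.
- move=> k' l' m' g h eg eh [eh' Fh].
  exists (even_comp eg eh); have -> : EMor (even_comp eg eh) =
    ldcomp (NCBipartEven true N) (EMor eg) (EMor eh') by apply: val_inj.
  by rewrite fmor_comp Fh /= mulmx0.
Qed.

End FibreFunctor.

Theorem mainTheorem4 (R : realType) (N sqrtN : R[i])
    (hN : N != 0) (hsqrt : sqrtN ^+ 2 = N) :
  (forall anti : bool, star anti sqrtN = sqrtN ->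
     let E := NCBipartEven anti N in
     let P := of_basis anti (prod_cat (NCPair sqrtN) (NCPair sqrtN)) in
     (exists F : functor E P, isomorphism F /\ dagger F) /\
     ~ (exists F : functor E P, isomorphism F /\ monoidal F))
  /\
  (4%:R <= N ->
     forall (M : nat) (F : functor (NCBipartEven true N) (Mat R[i] M)),
       fibre_functor F -> forall k l : nat, injective (F k l)).
Proof.
have [t Et] : exists t, t ^+ 2 = sqrtN by exists (sqrtC sqrtN); exact: sqrtCK.
subst sqrtN; subst N; split.
  have t0 : t != 0 by move: hN; rewrite !sqrf_eq0.
  move=> anti star_t2 E P; split; last exact: no_monoidal_iso.
  by exists (coordsF t0 star_t2); exact: coordsF_iso.
move=> N4 M F [_ monF _] k l f g E.
apply/eqP; rewrite -subr_eq0; apply/eqP/(fibre_zero N4 monF).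
by rewrite linearB /= E subrr.
Qed.
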